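(* Let $c\ge2$ be a constant integer, $n=\frac{c^l-1}{c-1}$, and $K<n/2$. There exists an $m\times n$ matrix $A$ with $m=O(K)$ and a recovery algorithm that, given $Ax$ for any $x\in\mathbb{R}^n$, returns $x^*$ with $$\|x-x^*\|_1\le C\sqrt{\log(n/K)}\min_{x'\in\mathcal{T}_K}\|x-x'\|_1$$ for some absolute constant $C>1$. As long as the coefficients of $x$ are integers bounded by $n^{O(1)}$, the algorithm runs in time $O(K^2n\log^{c_0}n)$ for some constant $c_0$.
   Context: The coordinates $1,\dots,n$ are identified with the nodes of a full $c$-ary rooted tree $T(c,l)$ of depth $l$ (which has exactly $n$ nodes). $\mathcal{T}_K\subseteq\mathbb{R}^n$ is the set of vectors whose support is contained in some set $S$ of at most $K$ nodes that contains the root and is connected in $T(c,l)$. *)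

(* Defs.v *)
From HB Require Import structures.
From mathcomp Require Import all_boot all_order all_algebra.
From mathcomp Require Import reals exp.

Set Implicit Arguments.
Unset Strict Implicit.
Unset Printing Implicit Defensive.

Import Order.TTheory GRing.Theory Num.Theory.
Local Open Scope ring_scope.

(** ** The tree-sparse model *)

(* The nodes of the full c-ary tree with l levels are numbered in breadth-first
   order from 0, level k being the interval
     [(c^k - 1)/(c - 1), (c^(k+1) - 1)/(c - 1)[.
   The root is then 0 and the children of node i are c*i + 1, ..., c*i + c. So
   the relation below on 'I_n is the edge relation of T(c,l), from parent to
   child, whenever n = (c^l - 1)/(c - 1). *)
Definition tree_parent (c n : nat) : rel 'I_n :=
  fun i j => (0 < j)%N && (j.-1 %/ c == i)%N.

Definition tree_edge (c n : nat) : rel 'I_n :=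
  fun i j => tree_parent c i j || tree_parent c j i.

Definition tree_connected (c n : nat) (S : {set 'I_n}) : Prop :=
  {in S &, forall i j,
     connect (fun u v => [&& u \in S, v \in S & tree_edge c u v]) i j}.

Definition tree_support (c n K : nat) (S : {set 'I_n}) : Prop :=
  [/\ (#|S| <= K)%N,
      (exists2 r, r \in S & r = 0%N :> nat) &
      tree_connected c S].

Definition tree_sparse (R : realType) (c n K : nat) (x : 'cV[R]_n) : Prop :=
  exists2 S : {set 'I_n}, tree_support c K S & forall i, x i 0 != 0 -> i \in S.

Definition l1norm (R : realType) (n : nat) (x : 'cV[R]_n) : R :=
  \sum_i `|x i 0|.

(* d is the minimum of |x - x'|_1 over x' in T_K, which must be attained *)
Definition is_min_tree_dist (R : realType) (c n K : nat) (x : 'cV[R]_n)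
    (d : R) : Prop :=
  (exists2 x', tree_sparse c K x' & d = l1norm (x - x')) /\
  (forall x', tree_sparse c K x' -> d <= l1norm (x - x')).

(** ** Real RAM *)

(* Structured programs over a random access machine with exact real arithmetic.
   Registers are named by constants of the program; the index and real memories
   are addressed through index registers. The only passage between the two
   sorts is the embedding of indices into the reals: there is no rounding, no
   root extraction, and no real constant in a program. *)
Inductive instr : Type :=
  | IConst (r k : nat)
  | IAdd (r a b : nat)
  | ISub (r a b : nat)
  | IMul (r a b : nat)
  | IDiv (r a b : nat)
  | ILoad (r a : nat)
  | IStore (a b : nat)
  | RConv (r a : nat)
  | RAdd (r a b : nat)
  | RSub (r a b : nat)
  | RMul (r a b : nat)
  | RDiv (r a b : nat)
  | RLoad (r a : nat)
  | RStore (a b : nat).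

Inductive test : Type :=
  | ILt (a b : nat)
  | RLt (a b : nat).

Inductive cmd : Type :=
  | Skip
  | Do (i : instr)
  | Seq (p q : cmd)
  | If (b : test) (p q : cmd)
  | While (b : test) (p : cmd).

Record state (R : realType) : Type := State {
  ireg : nat -> nat;
  imem : nat -> nat;
  rreg : nat -> R;
  rmem : nat -> R }.

Definition upd (T : Type) (f : nat -> T) (k : nat) (v : T) : nat -> T :=
  fun j => if j == k then v else f j.

Definition set_ireg (R : realType) (s : state R) r v :=
  State (upd (ireg s) r v) (imem s) (rreg s) (rmem s).
Definition set_imem (R : realType) (s : state R) k v :=
  State (ireg s) (upd (imem s) k v) (rreg s) (rmem s).
Definition set_rreg (R : realType) (s : state R) r v :=
  State (ireg s) (imem s) (upd (rreg s) r v) (rmem s).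
Definition set_rmem (R : realType) (s : state R) k v :=
  State (ireg s) (imem s) (rreg s) (upd (rmem s) k v).

(* ISub is truncated; IDiv and RDiv by zero give zero. *)
Definition run_instr (R : realType) (i : instr) (s : state R) : state R :=
  match i with
  | IConst r k => set_ireg s r k
  | IAdd r a b => set_ireg s r (ireg s a + ireg s b)%N
  | ISub r a b => set_ireg s r (ireg s a - ireg s b)%N
  | IMul r a b => set_ireg s r (ireg s a * ireg s b)%N
  | IDiv r a b => set_ireg s r (ireg s a %/ ireg s b)%N
  | ILoad r a => set_ireg s r (imem s (ireg s a))
  | IStore a b => set_imem s (ireg s a) (ireg s b)
  | RConv r a => set_rreg s r (ireg s a)%:R
  | RAdd r a b => set_rreg s r (rreg s a + rreg s b)
  | RSub r a b => set_rreg s r (rreg s a - rreg s b)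
  | RMul r a b => set_rreg s r (rreg s a * rreg s b)
  | RDiv r a b => set_rreg s r (rreg s a / rreg s b)
  | RLoad r a => set_rreg s r (rmem s (ireg s a))
  | RStore a b => set_rmem s (ireg s a) (rreg s b)
  end.

Definition bitlen (k : nat) : nat := (trunc_log 2 k).+1.

(* Operations on reals have unit cost. Every index or address that is used is
   charged its bit length, so that nothing is gained from arithmetic on large
   integers. *)
Definition instr_cost (R : realType) (i : instr) (s : state R) : nat :=
  match i with
  | IConst _ k => bitlen k
  | IAdd _ a b | ISub _ a b | IMul _ a b | IDiv _ a b =>
      (bitlen (ireg s a) + bitlen (ireg s b))%N
  | ILoad _ a => (bitlen (ireg s a) + bitlen (imem s (ireg s a)))%N
  | IStore a b => (bitlen (ireg s a) + bitlen (ireg s b))%N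
  | RConv _ a => bitlen (ireg s a)
  | RAdd _ _ _ | RSub _ _ _ | RMul _ _ _ | RDiv _ _ _ => 1%N
  | RLoad _ a => bitlen (ireg s a)
  | RStore a _ => bitlen (ireg s a)
  end.

Definition eval_test (R : realType) (b : test) (s : state R) : bool :=
  match b with
  | ILt a b => (ireg s a < ireg s b)%N
  | RLt a b => rreg s a < rreg s b
  end.

Definition test_cost (R : realType) (b : test) (s : state R) : nat :=
  match b with
  | ILt a b => (bitlen (ireg s a) + bitlen (ireg s b))%N
  | RLt _ _ => 1%N
  end.

(* exec p s s' t: started in s, the program p halts in s' after time t *)
Inductive exec (R : realType) : cmd -> state R -> state R -> nat -> Prop :=
  | exec_skip s : exec Skip s s 0%N
  | exec_do i s : exec (Do i) s (run_instr i s) (instr_cost i s)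
  | exec_seq p q s s' s'' t t' :
      exec p s s' t -> exec q s' s'' t' -> exec (Seq p q) s s'' (t + t')%N
  | exec_if b p q s s' t :
      exec (if eval_test b s then p else q) s s' t ->
      exec (If b p q) s s' (test_cost b s + t)%N
  | exec_while_false b p s :
      ~~ eval_test b s -> exec (While b p) s s (test_cost b s)
  | exec_while_true b p s s' s'' t t' :
      eval_test b s -> exec p s s' t -> exec (While b p) s' s'' t' ->
      exec (While b p) s s'' (test_cost b s + t + t')%N.

Lemma exec_det (R : realType) (p : cmd) (s s1 s2 : state R) (t1 t2 : nat) :
  exec p s s1 t1 -> exec p s s2 t2 -> s1 = s2 /\ t1 = t2.
Proof.
move=> e1; elim: e1 s2 t2 => {p s s1 t1}.
- by move=> s s2 t2 e2; inversion e2.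
- by move=> i s s2 t2 e2; inversion e2.
- move=> p q s s' s'' t t' _ IHp _ IHq s2 t2 e2.
  inversion e2 as [| |p0 q0 s0 s3 s4 u u' ep eq| | |]; subst.
  have [? ?] := IHp _ _ ep; subst.
  by have [? ?] := IHq _ _ eq; subst.
- move=> b p q s s' t _ IH s2 t2 e2.
  inversion e2 as [| | |b0 p0 q0 s0 s3 u e| |]; subst.
  by have [? ?] := IH _ _ e; subst.
- move=> b p s nb s2 t2 e2.
  inversion e2 as [| | | | |b0 p0 s0 s3 s4 u u' bT]; subst => //.
  by rewrite bT in nb.
- move=> b p s s' s'' t t' bT _ IHp _ IHw s2 t2 e2.
  inversion e2 as [| | | |b0 p0 s0 nb|b0 p0 s0 s3 s4 u u' _ ep ew]; subst.
    by rewrite bT in nb.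
  have [? ?] := IHp _ _ ep; subst.
  by have [? ?] := IHw _ _ ew; subst.
Qed.

(* The parameters (c, l, K, m, n) are in the first index registers. The real
   memory holds A in row-major order, followed by y. Everything else is 0. *)
Definition input (R : realType) (c l K m n : nat) (A : 'M[R]_(m, n))
    (y : 'cV[R]_m) : state R :=
  State
    (nth 0%N [:: c; l; K; m; n])
    (fun _ => 0%N)
    (fun _ => 0)
    (nth 0 ([seq A i j | i <- enum 'I_m, j <- enum 'I_n] ++
            [seq y i 0 | i <- enum 'I_m])).

(* The output is read in the n cells that follow A and y. *)
Definition output (R : realType) (m n : nat) (s : state R) : 'cV[R]_n :=
  \col_(j < n) rmem s (m * n + m + j)%N.

(* Given the measurements y = Ax, P returns xs in time t. *)
Definition returns (R : realType) (P : cmd) (c l K m n : nat)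
    (A : 'M[R]_(m, n)) (y : 'cV[R]_m) (xs : 'cV[R]_n) (t : nat) : Prop :=
  exists2 s : state R, exec P (input c l K A y) s t & xs = output m n s.

(* Main.v *)
(* The measurement matrix A has random signs.  There are only exp(O(c k)) rooted
   subtrees with k nodes, so that O(K) rows suffice for A to be a near isometry
   (up to the factor sqrt m) on vectors supported on subtrees with 9K nodes.
   Iterative hard thresholding, with exact projection onto the subtrees with 3K
   nodes, then converges linearly until the residual is within a constant factor
   of the best one; the projection is a knapsack dynamic program over the nodes
   in preorder.  The number of iterations is doubled until the residual of the
   least-squares fit w on the current subtree is 0 or exceeds the error that this
   convergence leaves.  This happens eventually because finitely many least-
   squares residuals exist, and after O(K log n) iterations for integer data
   because a nonzero residual is a quotient of integers with O(K log n) bits.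

   For the l1 bound, any K / log(n/K) nodes lie in a rooted subtree with O(K)
   nodes.  So A is also a near isometry on arbitrary vectors of that sparsity;
   cutting the tail e of x into blocks of decreasing magnitude gives
   |A e| = O(sqrt(m log(n/K) / K) |e|_1), and the factor sqrt K lost by
   Cauchy-Schwarz on the supports leaves sqrt(log(n/K)). *)

Require Import Defs.
From HB Require Import structures.
From mathcomp Require Import all_boot all_order all_algebra.
From mathcomp Require Import perm boolp reals sequences exp.
From mathcomp Require Import zify ring lra.
Set Implicit Arguments.
Unset Strict Implicit.
Unset Printing Implicit Defensive.
Import Order.TTheory GRing.Theory Num.Theory.
Local Open Scope ring_scope.

(** * A small language of bounded loops *)

(** The statement asks for machine code in which every index is charged its bit length. The program
    is therefore written in a small language whose loop bounds depend on the parameters only; one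
    compiler proof gives both its meaning and a running time readable from the syntax, and the
    algorithm is verified on that meaning alone. In place of a net of the sphere, near isometry is
    obtained by a union bound over integer vectors of small l1 norm and passed on to real vectors by
    a self-improving estimate of the rounding error. The machine has no square root. The
    least-squares fit comes from Gram-Schmidt without normalisation, applied to columns that carry
    their coefficient vectors along, [y] being the last column; this takes time of order
    [K ^ 2 * (m + n)], and one iteration of thresholding takes order [m * n]. The run on [x] must
    satisfy the error bound for all real [x], but the time bound only for integer [x], and its time
    is fixed before the exponent [a] is known. It is analysed twice, with different bounds on the
    number of rounds, and determinism of execution joins the two. *)

Inductive iop := OAdd | OSub | OMul | ODiv.

Inductive iexp :=
  | EVar (r : nat)
  | ECst (k : nat)
  | EBin (o : iop) (a b : iexp)
  | EMem (a : iexp).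

Inductive rexp :=
  | XNat (e : iexp)
  | XMem (e : iexp)
  | XBin (o : iop) (x y : rexp)
  | XSum (r : nat) (e : iexp) (x : rexp)
  | XIte (a b x y : rexp).

Inductive stmt :=
  | SSkip
  | SSet (r : nat) (e : iexp)
  | SIst (a e : iexp)
  | SRst (a : iexp) (x : rexp)
  | SSeq (p q : stmt)
  | SIf (x y : rexp) (p q : stmt)
  | SFor (r : nat) (e : iexp) (p : stmt).

Definition evo (o : iop) : nat -> nat -> nat :=
  match o with OAdd => addn | OSub => subn | OMul => muln | ODiv => divn end.

Definition evro (R : realType) (o : iop) : R -> R -> R :=
  match o with
  | OAdd => fun x y => x + y
  | OSub => fun x y => x - y
  | OMul => fun x y => x * y
  | ODiv => fun x y => x / y
  end.

Fixpoint evI (R : realType) (s : state R) (e : iexp) : nat :=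
  match e with
  | EVar r => ireg s r
  | ECst k => k
  | EBin o a b => evo o (evI s a) (evI s b)
  | EMem a => imem s (evI s a)
  end.

Fixpoint evX (R : realType) (x : rexp) (s : state R) : R :=
  match x with
  | XNat e => (evI s e)%:R
  | XMem e => rmem s (evI s e)
  | XBin o x y => evro o (evX x s) (evX y s)
  | XSum r e x => \sum_(i < evI s e) evX x (set_ireg s r i)
  | XIte a b x y => if evX a s < evX b s then evX x s else evX y s
  end.

(* Indices that are stored are capped at [m * n]: this bounds every index value
   of a run without any reasoning about the program. *)
Definition ecap : iexp := EBin OMul (EVar 3) (EVar 4).
Definition eclamp (e : iexp) : iexp := EBin OSub e (EBin OSub e ecap).

Fixpoint den (R : realType) (p : stmt) (s : state R) : state R :=
  match p with
  | SSkip => s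
  | SSet r e => set_ireg s r (evI s (eclamp e))
  | SIst a e => set_imem s (evI s a) (evI s (eclamp e))
  | SRst a x => set_rmem s (evI s a) (evX x s)
  | SSeq p q => den q (den p s)
  | SIf x y p q => if evX x s < evX y s then den p s else den q s
  | SFor r e p => iteri (evI s e) (fun i s' => den p (set_ireg s' r i)) s
  end.

(* Registers 0, ..., 5 hold the parameters and are never written; registers
   from [nvar] on are reserved for the compiler. *)
Definition npar := 6%N.
Definition nvar := 24%N.

(** If registers and memory cells have at most [b] bits, [e] has at most [isz e * b] bits. A
    constant [k] counts for [k.+1] because [k < 2 ^ k.+1]. *)
Fixpoint isz (e : iexp) : nat :=
  match e with
  | EVar _ => 1%N
  | ECst k => k.+1
  | EBin _ a b => (isz a + isz b).+1
  | EMem a => (isz a).+1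
  end.

Fixpoint wfI (e : iexp) : bool :=
  match e with
  | EVar r => (r < nvar)%N
  | ECst _ => true
  | EBin _ a b => wfI a && wfI b
  | EMem a => wfI a
  end.

Fixpoint parI (e : iexp) : bool :=
  match e with
  | EVar r => (r < npar)%N
  | ECst _ => true
  | EBin _ a b => parI a && parI b
  | EMem a => false
  end.

(** Loop bounds read parameters only, so that a statement cannot change the length of its own loops
    and its cost can be computed in the initial state. The limit 8 is the size of the longest bound
    in the program, [eK1 + e1]. *)
Definition bndI (e : iexp) : bool := parI e && (isz e <= 8)%N.
Definition isvar (r : nat) : bool := (npar <= r < nvar)%N.

Fixpoint wfX (x : rexp) : bool :=
  match x with
  | XNat e | XMem e => wfI e
  | XBin _ x y => wfX x && wfX y
  | XSum r e x => [&& isvar r, bndI e & wfX x]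
  | XIte a b x y => [&& wfX a, wfX b, wfX x & wfX y]
  end.

Fixpoint wfS (p : stmt) : bool :=
  match p with
  | SSkip => true
  | SSet r e => isvar r && wfI e
  | SIst a e => wfI a && wfI e
  | SRst a x => wfI a && wfX x
  | SSeq p q => wfS p && wfS q
  | SIf x y p q => [&& wfX x, wfX y, wfS p & wfS q]
  | SFor r e p => [&& isvar r, bndI e & wfS p]
  end.

Definition iinstr (o : iop) : nat -> nat -> nat -> instr :=
  match o with OAdd => IAdd | OSub => ISub | OMul => IMul | ODiv => IDiv end.
Definition rinstr (o : iop) : nat -> nat -> nat -> instr :=
  match o with OAdd => RAdd | OSub => RSub | OMul => RMul | ODiv => RDiv end.

Definition cmove (r a : nat) : cmd :=
  Seq (Do (IConst r 0)) (Do (IAdd r r a)).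

Fixpoint compI (e : iexp) (d : nat) : cmd :=
  match e with
  | EVar r => cmove d r
  | ECst k => Do (IConst d k)
  | EBin o a b =>
      Seq (compI a d) (Seq (compI b d.+1) (Do (iinstr o d d d.+1)))
  | EMem a => Seq (compI a d) (Do (ILoad d d))
  end.

(** [d] and [f] are the first free index and real registers. [XSum] merely binds its register, so
    its old value is saved in [d] and restored; [RSub f f f] makes the initial zero, since programs
    contain no real constant. *)
Fixpoint compX (x : rexp) (d f : nat) : cmd :=
  match x with
  | XNat e => Seq (compI e d) (Do (RConv f d))
  | XMem e => Seq (compI e d) (Do (RLoad f d))
  | XBin o x y =>
      Seq (compX x d f) (Seq (compX y d f.+1) (Do (rinstr o f f f.+1)))
  | XSum r e x =>
      Seq (Seq (cmove d r) (Seq (compI e d.+1)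
        (Seq (Do (IConst d.+2 0)) (Seq (Do (IConst d.+3 1))
        (Do (RSub f f f))))))
        (Seq (While (ILt d.+2 d.+1)
           (Seq (cmove r d.+2) (Seq (compX x d.+4 f.+1)
             (Seq (Do (RAdd f f f.+1)) (Do (IAdd d.+2 d.+2 d.+3))))))
        (cmove r d))
  | XIte a b x y =>
      Seq (compX a d f) (Seq (compX b d f.+1)
        (If (RLt f f.+1) (compX x d f) (compX y d f)))
  end.

Fixpoint compS (p : stmt) (d : nat) : cmd :=
  match p with
  | SSkip => Skip
  | SSet r e => Seq (compI (eclamp e) d) (cmove r d)
  | SIst a e =>
      Seq (compI a d) (Seq (compI (eclamp e) d.+1) (Do (IStore d d.+1)))
  | SRst a x => Seq (compI a d) (Seq (compX x d.+1 0) (Do (RStore d 0)))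
  | SSeq p q => Seq (compS p d) (compS q d)
  | SIf x y p q =>
      Seq (compX x d 0) (Seq (compX y d 1)
        (If (RLt 0 1) (compS p d) (compS q d)))
  | SFor r e p =>
      Seq (compI e d) (Seq (Do (IConst d.+1 0)) (Seq (Do (IConst d.+2 1))
        (While (ILt d.+1 d)
          (Seq (cmove r d.+1) (Seq (compS p d.+3)
            (Do (IAdd d.+1 d.+1 d.+2)))))))
  end.

(** Costs are in units of the bit bound [b]. The square is natural: a number of instructions linear
    in [isz e], each charged for operands of up to [isz e] units. *)
Definition cI (e : iexp) : nat := (4 * isz e ^ 2)%N.

(** The constants 500 and 100 are generous allowances for setting up a loop and for the bookkeeping
    of one iteration. *)
Fixpoint cX (R : realType) (s : state R) (x : rexp) : nat :=
  match x with
  | XNat e | XMem e => cI e + isz e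
  | XBin _ x y => (cX s x + cX s y).+1
  | XSum r e x => 500 + evI s e * (cX s x + 100)
  | XIte a b x y => (cX s a + cX s b + cX s x + cX s y).+1
  end%N.

Fixpoint cS (R : realType) (s : state R) (p : stmt) : nat :=
  match p with
  | SSkip => 0
  | SSet r e => cI (eclamp e) + isz (eclamp e) + 3
  | SIst a e => cI a + cI (eclamp e) + isz a + isz (eclamp e)
  | SRst a x => cI a + cX s x + isz a
  | SSeq p q => cS s p + cS s q
  | SIf x y p q => (cX s x + cX s y + cS s p + cS s q).+1
  | SFor r e p => 500 + evI s e * (cS s p + 100)
  end%N.

(** * Correctness and cost of the compiler *)

Lemma bitlen_le (x p : nat) : (0 < p)%N -> (x < 2 ^ p)%N -> (bitlen x <= p)%N.
Proof.
move=> p0 xp; rewrite /bitlen; case: (posnP x) => [->|x0].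
  by rewrite trunc_log0.
by rewrite -(ltn_exp2l _ _ (isT : 1 < 2)%N) (leq_ltn_trans (trunc_logP _ x0)).
Qed.

Definition runs (R : realType) (p : cmd) (s : state R) (T : nat)
    (Q : state R -> Prop) : Prop :=
  exists s' t, [/\ exec p s s' t, (t <= T)%N & Q s'].

Lemma runs_seq (R : realType) p q (s : state R) T1 T2 T Q :
  runs p s T1 (fun s' => runs q s' T2 Q) -> (T1 + T2 <= T)%N ->
  runs (Seq p q) s T Q.
Proof.
move=> [s' [t [e le [s'' [t' [e' le' q'']]]]]] leT.
exists s'', (t + t')%N; split=> //; first exact: exec_seq e e'.
by apply: leq_trans leT; apply: leq_add.
Qed.

Lemma runs_do (R : realType) i (s : state R) T (Q : state R -> Prop) :
  (instr_cost i s <= T)%N -> Q (run_instr i s) -> runs (Do i) s T Q.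
Proof. by move=> le q; exists (run_instr i s), (instr_cost i s); split=> //; exact: exec_do. Qed.

Lemma runs_if (R : realType) b p q (s : state R) T Q :
  runs (if eval_test b s then p else q) s (T - test_cost b s) Q ->
  (test_cost b s <= T)%N -> runs (If b p q) s T Q.
Proof.
move=> [s' [t [e le q']]] leT; exists s', (test_cost b s + t)%N.
split=> //; first exact: exec_if. by lia.
Qed.

Lemma runs_mono (R : realType) p (s : state R) T T' (Q Q' : state R -> Prop) :
  runs p s T Q -> (T <= T')%N -> (forall s', Q s' -> Q' s') -> runs p s T' Q'.
Proof.
move=> [s' [t [e le q]]] leT QQ; exists s', t; split=> //; last exact: QQ.
exact: leq_trans leT.
Qed.

(** The invariant has to reveal the counter and the bound because the test is charged their bit
    lengths; one more test is paid for than there are iterations. *)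
Lemma runs_loop (R : realType) a b p (s : state R) N T1 T2
    (Inv : nat -> state R -> Prop) :
  Inv 0%N s ->
  (forall i s', Inv i s' -> (ireg s' a = i /\ ireg s' b = N) /\
     (bitlen i + bitlen N <= T1)%N) ->
  (forall i s', (i < N)%N -> Inv i s' -> runs p s' T2 (Inv i.+1)) ->
  runs (While (ILt a b) p) s (T1 + N * (T1 + T2)) (Inv N).
Proof.
move=> I0 HI Hp.
suff H k : forall i s', (i + k = N)%N -> Inv i s' ->
    runs (While (ILt a b) p) s' (T1 + k * (T1 + T2)) (Inv N).
  by apply: (H N 0%N).
elim: k => [|k IH] i s' ik Ii.
  have [[ea eb] ht] := HI _ _ Ii.
  exists s', (test_cost (ILt a b) s'); split.
  - by apply: exec_while_false; rewrite /= ea eb -ik addn0 ltnn.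
  - by rewrite /= ea eb; lia.
  - by rewrite -ik addn0.
have [[ea eb] ht] := HI _ _ Ii.
have [|s1 [t1 [e1 l1 I1]]] := Hp i s' _ Ii; first by lia.
have [|s2 [t2 [e2 l2 I2]]] := IH i.+1 s1 _ I1; first by lia.
exists s2, (test_cost (ILt a b) s' + t1 + t2)%N; split=> //.
  by apply: exec_while_true e1 e2; rewrite /= ea eb; lia.
by rewrite /= ea eb; nia.
Qed.

(** Real registers are left out: no source expression reads them, they are scratch space of the
    compiler. *)
Definition agree (R : realType) (d : nat) (s s' : state R) : Prop :=
  [/\ forall r, (r < d)%N -> ireg s' r = ireg s r,
      imem s' =1 imem s & rmem s' =1 rmem s].

(** Loop bounds have a clause of their own since a sum or product of registers below [2 ^ b] may
    exceed [2 ^ b]. *)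
Definition bounded (R : realType) (b : nat) (s : state R) : Prop :=
  [/\ forall r, (r < nvar)%N -> (ireg s r < 2 ^ b)%N,
      forall a, (imem s a < 2 ^ b)%N &
      forall e, bndI e -> (evI s e < 2 ^ b)%N].

Lemma agree_refl (R : realType) d (s : state R) : agree d s s.
Proof. by []. Qed.

Lemma agree_trans (R : realType) d (s s' s'' : state R) :
  agree d s s' -> agree d s' s'' -> agree d s s''.
Proof.
move=> [a1 a2 a3] [b1 b2 b3]; split=> [r rd|a|a].
- by rewrite b1 // a1.
- by rewrite b2 a2.
- by rewrite b3 a3.
Qed.

Lemma agreeW (R : realType) d d' (s s' : state R) :
  (d' <= d)%N -> agree d s s' -> agree d' s s'.
Proof. by move=> le [a1 a2 a3]; split=> // r rd; apply: a1; apply: leq_trans le. Qed.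

Lemma evI_agree (R : realType) (s s' : state R) e :
  agree nvar s s' -> wfI e -> evI s' e = evI s e.
Proof.
move=> [a1 a2 a3]; elim: e => //=.
- by move=> o a IHa b IHb /andP[wa wb]; rewrite IHa // IHb.
- by move=> a IHa wa; rewrite IHa // a2.
Qed.

Lemma agree_set_ireg (R : realType) d (s s' : state R) r v :
  agree d s s' -> agree d (set_ireg s r v) (set_ireg s' r v).
Proof.
move=> [a1 a2 a3]; split=> //= q qd; rewrite /upd; case: eqP => // _.
exact: a1.
Qed.

Lemma parI_wfI e : parI e -> wfI e.
Proof.
elim: e => //=; first by move=> r; rewrite /npar /nvar; lia.
by move=> o a IHa b IHb /andP[/IHa -> /IHb ->].
Qed.

Lemma evX_agree (R : realType) x (s s' : state R) :
  agree nvar s s' -> wfX x -> evX x s' = evX x s.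
Proof.
elim: x s s' => /=.
- by move=> e s s' ag w; rewrite (evI_agree ag).
- by move=> e s s' ag w; rewrite (evI_agree ag) //; case: ag.
- by move=> o x IHx y IHy s s' ag /andP[wx wy]; rewrite (IHx s) // (IHy s).
- move=> r e x IH s s' ag /and3P[_ /andP[/parI_wfI we _] wx].
  rewrite (evI_agree ag) //; apply: eq_bigr => i _; apply: IH => //.
  exact: agree_set_ireg.
- move=> a IHa b IHb x IHx y IHy s s' ag /and4P[wa wb wx wy].
  by rewrite (IHa s) // (IHb s) // (IHx s) // (IHy s).
Qed.

Lemma evI_par (R : realType) (s s' : state R) e :
  (forall r, (r < npar)%N -> ireg s' r = ireg s r) -> parI e ->
  evI s' e = evI s e.
Proof.
move=> h; elim: e => //= o a IHa b IHb /andP[wa wb]; by rewrite IHa // IHb.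
Qed.

Lemma bounded_agree (R : realType) b (s s' : state R) :
  agree nvar s s' -> bounded b s -> bounded b s'.
Proof.
move=> ag [b1 b2 b3]; split.
- by move=> r rn; case: ag => a1 _ _; rewrite a1 // b1.
- by move=> a; case: ag => _ -> _.
- by move=> e we; rewrite (evI_agree ag) ?b3 //; apply: parI_wfI; case/andP: we.
Qed.

Lemma bounded_set_ireg (R : realType) b (s : state R) r v :
  isvar r -> (v < 2 ^ b)%N -> bounded b s -> bounded b (set_ireg s r v).
Proof.
move=> /andP[rp rn] vb [b1 b2 b3]; split=> //=.
- by move=> q qn; rewrite /upd; case: eqP => // _; apply: b1.
- move=> e /[dup] we /andP[pe _]; rewrite (@evI_par R s) ?b3 // => q qp /=.
  by rewrite /upd; case: eqP => // qr; move: qp rp; rewrite qr ltnNge => /negbTE ->.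
Qed.

(** Bit lengths add under multiplication; the extra unit that [isz] grants to [EBin] absorbs the
    factor 2 of a sum. A memory read falls back to the bound on cells. *)
Lemma evI_bound (R : realType) b (s : state R) e :
  (0 < b)%N -> (forall r, (r < nvar)%N -> (ireg s r < 2 ^ b)%N) ->
  (forall a, (imem s a < 2 ^ b)%N) -> wfI e -> (evI s e < 2 ^ (isz e * b))%N.
Proof.
move=> b0 b1 b2; elim: e => /=.
- by move=> r rn; rewrite mul1n; apply: b1.
- move=> k _; apply: (@leq_trans (2 ^ k.+1)); first by apply: ltnW; exact: ltn_expl.
  by rewrite leq_exp2l //; nia.
- move=> o x IHx y IHy /andP[/IHx {}IHx /IHy {}IHy].
  have p1 : (0 < 2 ^ (isz x * b))%N by rewrite expn_gt0.
  have p2 : (0 < 2 ^ (isz y * b))%N by rewrite expn_gt0.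
  have p3 : (2 <= 2 ^ b)%N by rewrite -[X in (X <= _)%N]expn1 leq_exp2l.
  have -> : (2 ^ ((isz x + isz y).+1 * b) =
             2 ^ b * 2 ^ (isz x * b) * 2 ^ (isz y * b))%N.
    by rewrite -!expnD; congr (_ ^ _)%N; lia.
  move: IHx IHy p1 p2 p3.
  move: (2 ^ (isz x * b))%N (2 ^ (isz y * b))%N (2 ^ b)%N (evI s x) (evI s y).
  move=> X Y Z u v uX vY X0 Y0 Z2.
  have XY : (2 * (X * Y) <= Z * X * Y)%N by rewrite -mulnA leq_mul2r Z2 orbT.
  suff : (evo o u v < 2 * (X * Y))%N by move=> h; exact: leq_trans XY.
  have d := leq_div u v.
  by case: o => /=; nia.
- move=> a _ _; apply: leq_trans (b2 _) _.
  by rewrite leq_exp2l // mulSn leq_addr.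
Qed.

Lemma evI_bitlen (R : realType) b (s : state R) e :
  (0 < b)%N -> bounded b s -> wfI e -> (bitlen (evI s e) <= isz e * b)%N.
Proof.
move=> b0 bs we; have [b1 b2 _] := bs; apply: bitlen_le; last exact: evI_bound.
by case: e we => //= *; nia.
Qed.

Lemma isz_gt0 e : (0 < isz e)%N. Proof. by case: e. Qed.

Lemma runs_move (R : realType) b r a (s : state R) T (Q : state R -> Prop) :
  r <> a -> (bitlen (ireg s a) <= b)%N -> (2 + b <= T)%N ->
  (forall s', (forall q, q <> r -> ireg s' q = ireg s q) ->
     ireg s' r = ireg s a -> imem s' = imem s -> rreg s' = rreg s ->
     rmem s' = rmem s -> Q s') ->
  runs (cmove r a) s T Q.
Proof.
move=> ra la leT HQ.
apply: (@runs_seq _ _ _ _ 1 (1 + b)); last by lia.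
apply: runs_do; first by rewrite /= /bitlen trunc_log0.
apply: runs_do => /=.
  rewrite /upd eqxx; case: eqP => [/esym //|_]; rewrite /bitlen trunc_log0.
  by move: la; rewrite /bitlen; lia.
apply: HQ => //=.
- by move=> q /eqP /negbTE qr; rewrite /upd qr.
- rewrite /upd !eqxx; case: eqP => [/esym //|_]; by rewrite add0n.
Qed.

Lemma compI_runs (R : realType) b e d (s : state R) :
  (0 < b)%N -> bounded b s -> wfI e -> (nvar <= d)%N ->
  runs (compI e d) s (cI e * b) (fun s' =>
    [/\ ireg s' d = evI s e, forall r, (r < d)%N -> ireg s' r = ireg s r,
        imem s' = imem s, rreg s' = rreg s & rmem s' = rmem s]).
Proof.
move=> b0; elim: e d s => [r|k|o x IHx y IHy|a IHa] d s bs we nd.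
- apply: (@runs_move _ b); first by move=> dr; move: we nd; rewrite dr /=; lia.
  + by have := evI_bitlen b0 bs we; rewrite /= mul1n.
  + by rewrite /cI /=; lia.
  + move=> s' h1 h2 h3 h4 h5; split=> // q qd; apply: h1; lia.
- apply: runs_do => /=.
    apply: leq_trans (evI_bitlen b0 bs we) _ => /=.
    by rewrite leq_mul2r; apply/orP; right; rewrite /cI /=; nia.
  split=> //=; first by rewrite /upd eqxx.
  by move=> q qd; rewrite /upd; case: eqP => //; lia.
- have /andP[wx wy] := we.
  apply: (@runs_seq _ _ _ _ (cI x * b) (cI y * b + (isz x + isz y) * b)); last first.
    by rewrite /cI /=; have := isz_gt0 x; have := isz_gt0 y; nia.
  apply: runs_mono (IHx d s bs wx nd) (leqnn _) _ => s1 [e1 e2 e3 e4 e5].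
  have ag : agree nvar s s1.
    by split=> [r rn|a|a]; rewrite ?e3 ?e5 // e2 //; apply: leq_trans nd.
  have bs1 := bounded_agree ag bs.
  apply: (@runs_seq _ _ _ _ (cI y * b) ((isz x + isz y) * b)) => //.
  apply: runs_mono (IHy d.+1 s1 bs1 wy (leqW nd)) (leqnn _) _ => s2 [f1 f2 f3 f4 f5].
  have ed : ireg s2 d = evI s x by rewrite f2.
  have ed1 : ireg s2 d.+1 = evI s y by rewrite f1 (evI_agree ag).
  apply: runs_do.
    have := evI_bitlen b0 bs wx; have := evI_bitlen b0 bs wy.
    by case: o {we} => /=; rewrite ed ed1; lia.
  have -> : run_instr (iinstr o d d d.+1) s2
          = set_ireg s2 d (evo o (ireg s2 d) (ireg s2 d.+1)) by case: o {we}.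
  split=> /=; rewrite ?f3 ?f4 ?f5 //.
    by rewrite /upd eqxx ed ed1.
  move=> r rd; rewrite /upd; case: eqP => [|_]; first by lia.
  by rewrite f2 ?e2 //; lia.
- apply: (@runs_seq _ _ _ _ (cI a * b) (isz a * b + b)); last first.
    by rewrite /cI /=; have := isz_gt0 a; nia.
  apply: runs_mono (IHa d s bs we nd) (leqnn _) _ => s1 [e1 e2 e3 e4 e5].
  apply: runs_do => /=.
    rewrite e1 e3; apply: leq_add; first exact: evI_bitlen.
    by apply: bitlen_le => //; case: bs.
  split=> //=; first by rewrite /upd eqxx e1 e3.
  by move=> r rd; rewrite /upd; case: eqP => [|_]; [lia | exact: e2].
Qed.

Lemma agree_par (R : realType) (s s' : state R) :
  agree nvar s s' -> forall r, (r < npar)%N -> ireg s' r = ireg s r.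
Proof. by move=> [h _ _] r rn; apply: h; apply: ltn_trans rn _. Qed.

Lemma cX_par (R : realType) (s s' : state R) x :
  (forall r, (r < npar)%N -> ireg s' r = ireg s r) -> wfX x ->
  cX s' x = cX s x.
Proof.
move=> h; elim: x => //=.
- by move=> o x IHx y IHy /andP[wx wy]; rewrite IHx // IHy.
- move=> r e x IH /and3P[_ /andP[pe _] wx].
  by rewrite IH // (evI_par h).
- by move=> a IHa b IHb x IHx y IHy /and4P[wa wb wx wy]; rewrite IHa // IHb // IHx // IHy.
Qed.

Lemma cS_par (R : realType) (s s' : state R) p :
  (forall r, (r < npar)%N -> ireg s' r = ireg s r) -> wfS p ->
  cS s' p = cS s p.
Proof.
move=> h; elim: p => //=.
- by move=> a x /andP[_ wx]; rewrite (cX_par h).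
- by move=> p IHp q IHq /andP[wp wq]; rewrite IHp // IHq.
- by move=> x y p IHp q IHq /and4P[wx wy wp wq]; rewrite !(cX_par h) // IHp // IHq.
- by move=> r e p IH /and3P[_ /andP[pe _] wp]; rewrite IH // (evI_par h).
Qed.

Lemma bndI_cI e : bndI e -> [/\ wfI e, (cI e <= 256)%N & (isz e <= 8)%N].
Proof.
move=> /andP[/parI_wfI we le]; split=> //; rewrite /cI.
have : (isz e ^ 2 <= 8 ^ 2)%N by rewrite leq_exp2r.
by rewrite (_ : 8 ^ 2 = 64)%N //; lia.
Qed.

Lemma compX_runs (R : realType) b x d f (s : state R) :
  (0 < b)%N -> bounded b s -> wfX x -> (nvar <= d)%N ->
  runs (compX x d f) s (cX s x * b) (fun s' =>
    [/\ rreg s' f = evX x s, agree d s s' &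
        forall r, (r < f)%N -> rreg s' r = rreg s r]).
Proof.
move=> b0; elim: x d f s => /=.
- move=> e d f s bs we nd.
  apply: (@runs_seq _ _ _ _ (cI e * b) (isz e * b)); last by lia.
  apply: runs_mono (compI_runs b0 bs we nd) (leqnn _) _ => s1 [e1 e2 e3 e4 e5].
  apply: runs_do => /=; first by rewrite e1; exact: evI_bitlen.
  split=> /=; first by rewrite /upd eqxx e1.
    by split=> //= a; rewrite ?e3 ?e5.
  by move=> r rf; rewrite /upd e4; case: eqP => //; lia.
- move=> e d f s bs we nd.
  apply: (@runs_seq _ _ _ _ (cI e * b) (isz e * b)); last by lia.
  apply: runs_mono (compI_runs b0 bs we nd) (leqnn _) _ => s1 [e1 e2 e3 e4 e5].
  apply: runs_do => /=; first by rewrite e1; exact: evI_bitlen.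
  split=> /=; first by rewrite /upd eqxx e1 e5.
    by split=> //= a; rewrite ?e3 ?e5.
  by move=> r rf; rewrite /upd e4; case: eqP => //; lia.
- move=> o x IHx y IHy d f s bs /andP[wx wy] nd.
  apply: (@runs_seq _ _ _ _ (cX s x * b) (cX s y * b + b)); last by lia.
  apply: runs_mono (IHx d f s bs wx nd) (leqnn _) _ => s1 [e1 e2 e3].
  have ag := agreeW nd e2; have bs1 := bounded_agree ag bs.
  apply: (@runs_seq _ _ _ _ (cX s y * b) b) => //.
  have -> : cX s y = cX s1 y.
    by apply/esym/cX_par => //; exact: agree_par ag.
  apply: runs_mono (IHy d f.+1 s1 bs1 wy nd) (leqnn _) _ => s2 [f1 f2 f3].
  apply: runs_do; first by case: o.
  have -> : run_instr (rinstr o f f f.+1) s2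
          = set_rreg s2 f (evro o (rreg s2 f) (rreg s2 f.+1)) by case: o.
  split=> /=.
  + by rewrite /upd eqxx f1 (evX_agree ag) // f3 // e1.
  + exact: agree_trans e2 f2.
  + move=> r rf; rewrite /upd; case: eqP => [|_]; first by lia.
    by rewrite f3 ?e3 //; lia.
- move=> r e x IH d f s bs /and3P[vr be wx] nd.
  have [we ce se] := bndI_cI be; have /andP[rp rn] := vr.
  have rd : (r < d)%N by apply: leq_trans nd.
  set N := evI s e; have Nb : (N < 2 ^ b)%N by case: bs => _ _; apply.
  have bl i : (i <= N)%N -> (bitlen i <= b)%N.
    by move=> iN; apply: bitlen_le => //; apply: leq_ltn_trans Nb.
  apply: (@runs_seq _ _ _ _ (300 * b) (N * (cX s x * b + 100 * b) + 200 * b)); last by nia.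
  apply: (@runs_seq _ _ _ _ (3 * b) (260 * b)); last by lia.
  apply: (@runs_move _ b); first by lia.
  + by apply: bitlen_le => //; case: bs => h _ _; apply: h.
  + by lia.
  move=> s1 a1 a2 a3 a4 a5.
  have ag1 : agree d s s1 by split=> [q qd|a|a]; rewrite ?a3 ?a5 // a1 //; lia.
  have bs1 := bounded_agree (agreeW nd ag1) bs.
  apply: (@runs_seq _ _ _ _ (256 * b) (3 * b)); last by lia.
  apply: runs_mono (compI_runs b0 bs1 we (leqW nd)) _ _; first by nia.
  move=> s2 [e1 e2 e3 e4 e5].
  apply: (@runs_seq _ _ _ _ b (2 * b)); last by lia.
  apply: runs_do; first by rewrite /= /bitlen trunc_log0.
  apply: (@runs_seq _ _ _ _ b b); last by lia.
  apply: runs_do; first by rewrite /= /bitlen.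
  apply: runs_do => //.
  set s3 := run_instr _ _.
  (* The register [r] is exempt from preservation because each iteration overwrites it; its original
     value waits in register [d]. *)
  pose Inv i (s' : state R) := [/\ ireg s' d = ireg s r, ireg s' d.+1 = N,
     ireg s' d.+2 = i, ireg s' d.+3 = 1%N & [/\
     rreg s' f = \sum_(j < i) evX x (set_ireg s r j),
     forall q, (q < d)%N -> q <> r -> ireg s' q = ireg s q,
     imem s' =1 imem s, rmem s' =1 rmem s &
     forall q, (q < f)%N -> rreg s' q = rreg s q]].
  have I0 : Inv 0%N s3.
    split; [| | | |split] => //=.
    * by rewrite /upd; do 2 (case: eqP => [|_]; first by lia); rewrite e2 ?a2 //; lia.
    * rewrite /upd; do 2 (case: eqP => [|_]; first by lia).
      by rewrite e1 (evI_agree (agreeW nd ag1)).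
    * by rewrite /upd eqxx; case: eqP => //; lia.
    * by rewrite /upd eqxx.
    * by rewrite /upd eqxx big_ord0 subrr.
    * move=> q qd qr; rewrite /upd; do 2 (case: eqP => [|_]; first by lia).
      by rewrite e2 ?a1 //; lia.
    * by rewrite e3 a3.
    * by rewrite e5 a5.
    * by move=> q qf; rewrite /upd; case: eqP => [|_]; [lia | rewrite e4 a4].
  apply: (@runs_seq _ _ _ _ (2 * b + N * (2 * b + (cX s x * b + 12 * b))) (3 * b)); last by nia.
  apply: runs_mono (@runs_loop _ d.+2 d.+1 _ s3 N (2 * b) (cX s x * b + 12 * b)
           (fun i s' => Inv i s' /\ (i <= N)%N) _ _ _) (leqnn _) _.
  + by [].
  + by move=> i s' [[h1 h2 h3 h4 h5] iN]; split; [split|have := bl _ iN; have := bl _ (leqnn N); lia].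
  + move=> i s' iN [[h1 h2 h3 h4 [h5 h6 h7 h8 h9]] _].
    apply: (@runs_seq _ _ _ _ (3 * b) (cX s x * b + 6 * b)); last by lia.
    apply: (@runs_move _ b); [by lia | by rewrite h3; apply: bl; lia | by lia |].
    move=> s4 b1 b2 b3 b4 b5.
    have ag4 : agree d (set_ireg s r i) s4.
      split=> [q qd|a|a] /=; rewrite ?b3 ?b5 ?h7 ?h8 //.
      by rewrite /upd; case: eqP => [->|qr]; [rewrite b2 h3 | rewrite b1 // h6].
    have bsi : bounded b (set_ireg s r i) by apply: bounded_set_ireg => //; lia.
    have bs4 := bounded_agree (agreeW nd ag4) bsi.
    apply: (@runs_seq _ _ _ _ (cX s x * b) (6 * b)) => //.
    have -> : cX s x = cX s4 x.
      apply/esym/cX_par => // q qn; have qd : (q < d)%N by rewrite /npar /nvar in qn nd *; lia.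
      by rewrite b1 ?h6 //; rewrite /npar in qn rp; lia.
    have nd4 : (nvar <= d.+4)%N by lia.
    apply: runs_mono (IH d.+4 f.+1 s4 bs4 wx nd4) (leqnn _) _ => s5 [f1 [f2 f2' f2''] f3].
    apply: (@runs_seq _ _ _ _ b (3 * b)); last by lia.
    apply: runs_do => //.
    apply: runs_do.
      rewrite /= !f2 // !b1; [|lia|lia]. rewrite h3 h4.
      have := bl i (ltnW iN); have -> : bitlen 1 = 1%N by []. by lia.
    split=> //; split; [| | | |split] => /=.
    * by rewrite /upd; case: eqP => [|_]; [lia|]; rewrite f2 ?b1 ?h1 //; lia.
    * by rewrite /upd; case: eqP => [|_]; [lia|]; rewrite f2 ?b1 ?h2 //; lia.
    * by rewrite /upd eqxx !f2 ?b1 ?h3 ?h4 ?addn1 //; lia.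
    * by rewrite /upd; case: eqP => [|_]; [lia|]; rewrite f2 ?b1 ?h4 //; lia.
    * rewrite /upd eqxx f1 f3 // b4 h5 big_ord_recr /=; congr (_ + _).
      exact: evX_agree (agreeW nd ag4) wx.
    * by move=> q qd qr; rewrite /upd; case: eqP => [|_]; [lia|]; rewrite f2 ?b1 ?h6 //; lia.
    * by move=> a; rewrite f2' b3 h7.
    * by move=> a; rewrite f2'' b5 h8.
    * move=> q qf; rewrite /upd; case: eqP => [|_]; [lia|].
      by rewrite f3 ?b4 ?h9 //; lia.
  + move=> s' [[h1 h2 h3 h4 [h5 h6 h7 h8 h9]] _].
    apply: (@runs_move _ b); [by lia | | by lia |].
      by rewrite h1; apply: bitlen_le => //; case: bs => h _ _; apply: h.
    move=> s4 b1 b2 b3 b4 b5; split.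
    * by rewrite b4 h5.
    * split=> [q qd|a|a]; rewrite ?b3 ?b5 ?h7 ?h8 //.
      by case: (q =P r) => [->|qr]; [rewrite b2 h1 | rewrite b1 // h6].
    * by move=> q qf; rewrite b4 h9.
- move=> a IHa b' IHb x IHx y IHy d f s bs /and4P[wa wb wx wy] nd.
  apply: (@runs_seq _ _ _ _ (cX s a * b) ((cX s b' + cX s x + cX s y).+1 * b)); last by lia.
  apply: runs_mono (IHa d f s bs wa nd) (leqnn _) _ => s1 [e1 e2 e3].
  have ag := agreeW nd e2; have bs1 := bounded_agree ag bs.
  apply: (@runs_seq _ _ _ _ (cX s b' * b) ((cX s x + cX s y).+1 * b)); last by lia.
  have -> : cX s b' = cX s1 b'.
    by apply/esym/cX_par => //; exact: agree_par ag.
  apply: runs_mono (IHb d f.+1 s1 bs1 wb nd) (leqnn _) _ => s2 [f1 f2 f3].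
  have e12 := agree_trans e2 f2; have ag2 := agreeW nd e12.
  have bs2 := bounded_agree ag2 bs.
  have par := agree_par ag2.
  apply: runs_if; last by rewrite /=; lia.
  have -> : eval_test (RLt f f.+1) s2 = (evX a s < evX b' s).
    by rewrite /= f1 f3 // e1 (evX_agree ag).
  case: ifP => _.
  + apply: runs_mono (IHx d f s2 bs2 wx nd) _ _.
      by rewrite (cX_par par) //=; nia.
    move=> s3 [g1 g2 g3]; split; [by rewrite g1 (evX_agree ag2) | exact: agree_trans e12 g2 |].
    by move=> r rf; rewrite g3 // f3 ?e3 //; lia.
  + apply: runs_mono (IHy d f s2 bs2 wy nd) _ _.
      by rewrite (cX_par par) //=; nia.
    move=> s3 [g1 g2 g3]; split; [by rewrite g1 (evX_agree ag2) | exact: agree_trans e12 g2 |].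
    by move=> r rf; rewrite g3 // f3 ?e3 //; lia.
Qed.

(** With truncated subtraction [e - (e - cap)] is the minimum of [e] and the cap, and the cap is
    itself an admissible loop bound. *)
Lemma evI_clamp (R : realType) b (s : state R) e :
  bounded b s -> (evI s (eclamp e) < 2 ^ b)%N.
Proof.
move=> [_ _ /(_ ecap isT)] /= h.
by apply: leq_ltn_trans h; lia.
Qed.

Lemma bounded_set_imem (R : realType) b (s : state R) a v :
  (v < 2 ^ b)%N -> bounded b s -> bounded b (set_imem s a v).
Proof.
move=> vb [b1 b2 b3]; split=> //= [q|e be].
  by rewrite /upd; case: eqP.
by rewrite (@evI_par R s) ?b3 //; case/andP: be.
Qed.

Lemma bounded_set_rmem (R : realType) b (s : state R) a v :
  bounded b s -> bounded b (set_rmem s a v).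
Proof.
move=> [b1 b2 b3]; split=> //= e be.
by rewrite (@evI_par R s) ?b3 //; case/andP: be.
Qed.

Lemma set_ireg_par (R : realType) (s : state R) r v q :
  isvar r -> (q < npar)%N -> ireg (set_ireg s r v) q = ireg s q.
Proof. by move=> /andP[rp _] qp /=; rewrite /upd; case: eqP => // qr; lia. Qed.

Lemma den_par (R : realType) p (s : state R) :
  wfS p -> forall q, (q < npar)%N -> ireg (den p s) q = ireg s q.
Proof.
elim: p s => //=.
- by move=> r e s /andP[vr _] q; exact: set_ireg_par.
- by move=> p IHp q IHq s /andP[wp wq] r rn; rewrite IHq // IHp.
- by move=> x y p IHp q IHq s /and4P[_ _ wp wq] r rn; case: ifP => _; rewrite ?IHp ?IHq.
- move=> r e p IH s /and3P[vr _ wp] q qn.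
  elim: (evI s e) => //= i IHi; by rewrite IH // set_ireg_par.
Qed.

Lemma den_bounded (R : realType) b p (s : state R) :
  wfS p -> bounded b s -> bounded b (den p s).
Proof.
elim: p s => //=.
- move=> r e s /andP[vr _] bs; apply: bounded_set_ireg => //; exact: evI_clamp.
- move=> a e s _ bs; apply: bounded_set_imem => //; exact: evI_clamp.
- by move=> a x s _ bs; exact: bounded_set_rmem.
- by move=> p IHp q IHq s /andP[wp wq] bs; apply: IHq => //; apply: IHp.
- by move=> x y p IHp q IHq s /and4P[_ _ wp wq] bs; case: ifP => _; [apply: IHp|apply: IHq].
- move=> r e p IH s /and3P[vr be wp] bs.
  have : (evI s e <= evI s e)%N by [].
  elim: {1 3}(evI s e) => //= i IHi le; apply: IH => //.
  apply: bounded_set_ireg => //; last by apply: IHi; exact: ltnW.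
  by apply: ltn_trans le _; case: bs => _ _; apply.
Qed.

(** [t] is the source state and [s] the machine state that simulates it. The last clause protects
    the counters which enclosing loops keep in the registers between [nvar] and [d]. *)
Lemma compS_runs (R : realType) b p d (s t : state R) :
  (0 < b)%N -> bounded b t -> wfS p -> (nvar <= d)%N -> agree nvar t s ->
  runs (compS p d) s (cS t p * b) (fun s' => agree nvar (den p t) s' /\
     forall r, (nvar <= r < d)%N -> ireg s' r = ireg s r).
Proof.
move=> b0; elim: p d s t => /=.
- by move=> d s t bt _ nd ag; exists s, 0%N; split=> //; exact: exec_skip.
- move=> r e d s t bt /andP[vr we] nd ag.
  have bs := bounded_agree ag bt; have /andP[rp rn] := vr.
  have wc : wfI (eclamp e) by rewrite /= we.
  apply: (@runs_seq _ _ _ _ (cI (eclamp e) * b) ((isz (eclamp e) + 3) * b)); last first.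
    by rewrite /=; lia.
  apply: runs_mono (compI_runs b0 bs wc nd) (leqnn _) _ => s1 [e1 e2 e3 e4 e5].
  apply: (@runs_move _ b); [by lia | | by nia |].
    by rewrite e1; apply: bitlen_le => //; exact: evI_clamp.
  move=> s2 f1 f2 f3 f4 f5; have [g1 g2 g3] := ag; split; [split=> [q qn|a|a] /= |].
  + rewrite /upd; case: eqP => [->|qr]; first by rewrite f2 e1 (evI_agree ag wc).
    by rewrite f1 // e2 ?g1 //; lia.
  + by rewrite f3 e3 g2.
  + by rewrite f5 e5 g3.
  + by move=> q qd; rewrite f1 ?e2 //; lia.
- move=> a e d s t bt /andP[wa we] nd ag.
  have bs := bounded_agree ag bt.
  have wc : wfI (eclamp e) by rewrite /= we.
  apply: (@runs_seq _ _ _ _ (cI a * b) ((cI (eclamp e) + isz a + isz (eclamp e)) * b)); last by rewrite /=; lia.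
  apply: runs_mono (compI_runs b0 bs wa nd) (leqnn _) _ => s1 [e1 e2 e3 e4 e5].
  have ag1 : agree nvar t s1.
    have [g1 g2 g3] := ag; split=> [r rn|q|q]; rewrite ?e3 ?e5 //.
    by rewrite e2 ?g1 //; lia.
  have bs1 := bounded_agree ag1 bt.
  apply: (@runs_seq _ _ _ _ (cI (eclamp e) * b) ((isz a + isz (eclamp e)) * b)); last by rewrite /=; lia.
  apply: runs_mono (compI_runs b0 bs1 wc (leqW nd)) (leqnn _) _ => s2 [f1 f2 f3 f4 f5].
  have ed : ireg s2 d = evI t a by rewrite f2 // e1 (evI_agree ag).
  have ed1 : ireg s2 d.+1 = evI t (eclamp e) by rewrite f1 (evI_agree ag1 wc).
  apply: runs_do.
    rewrite [instr_cost _ _]/= ed ed1.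
    by have := evI_bitlen b0 bt wa; have := evI_bitlen b0 bt wc; lia.
  have [g1 g2 g3] := ag1; split; [split=> [q qn|q|q] /= |].
  + by rewrite f2 ?g1 //; lia.
  + by rewrite /upd ed ed1; case: eqP => // _; rewrite f3 g2.
  + by rewrite f5 g3.
  + by move=> q qd; rewrite /= f2 ?e2 //; lia.
- move=> a x d s t bt /andP[wa wx] nd ag.
  have bs := bounded_agree ag bt.
  apply: (@runs_seq _ _ _ _ (cI a * b) ((cX t x + isz a) * b)); last by lia.
  apply: runs_mono (compI_runs b0 bs wa nd) (leqnn _) _ => s1 [e1 e2 e3 e4 e5].
  have ag1 : agree nvar t s1.
    have [g1 g2 g3] := ag; split=> [r rn|q|q]; rewrite ?e3 ?e5 //.
    by rewrite e2 ?g1 //; lia.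
  have bs1 := bounded_agree ag1 bt.
  apply: (@runs_seq _ _ _ _ (cX t x * b) (isz a * b)); last by lia.
  rewrite -(cX_par (agree_par ag1) wx).
  apply: runs_mono (compX_runs 0 b0 bs1 wx (leqW nd)) (leqnn _) _ => s2 [f1 [f2 f3 f4] _].
  have ed : ireg s2 d = evI t a by rewrite f2 // e1 (evI_agree ag).
  apply: runs_do; first by rewrite /= ed; exact: evI_bitlen.
  have [g1 g2 g3] := ag1; split; [split=> [q qn|q|q] /= |].
  + by rewrite f2 ?g1 //; lia.
  + by rewrite f3 g2.
  + by rewrite /upd ed f1 (evX_agree ag1) //; case: eqP => // _; rewrite f4 g3.
  + by move=> q qd; rewrite /= f2 ?e2 //; lia.
- move=> p IHp q IHq d s t bt /andP[wp wq] nd ag.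
  apply: (@runs_seq _ _ _ _ (cS t p * b) (cS t q * b)); last by lia.
  apply: runs_mono (IHp d s t bt wp nd ag) (leqnn _) _ => s1 [a1 h1].
  rewrite -(cS_par (den_par t wp) wq).
  apply: runs_mono (IHq d s1 _ (den_bounded wp bt) wq nd a1) (leqnn _) _ => s2 [a2 h2].
  by split=> // r rd; rewrite h2 ?h1.
- move=> x y p IHp q IHq d s t bt /and4P[wx wy wp wq] nd ag.
  have bs := bounded_agree ag bt.
  apply: (@runs_seq _ _ _ _ (cX t x * b) ((cX t y + cS t p + cS t q).+1 * b)); last by lia.
  rewrite -{1}(cX_par (agree_par ag) wx).
  apply: runs_mono (compX_runs 0 b0 bs wx nd) (leqnn _) _ => s1 [e1 e2 _].
  have ag1 := agree_trans ag (agreeW nd e2).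
  have bs1 := bounded_agree ag1 bt.
  apply: (@runs_seq _ _ _ _ (cX t y * b) ((cS t p + cS t q).+1 * b)); last by lia.
  rewrite -{1}(cX_par (agree_par ag1) wy).
  apply: runs_mono (compX_runs 1 b0 bs1 wy nd) (leqnn _) _ => s2 [f1 f2 f3].
  have ag2 := agree_trans ag1 (agreeW nd f2).
  apply: runs_if; last by rewrite /=; lia.
  have -> : eval_test (RLt 0 1) s2 = (evX x t < evX y t).
    by rewrite /= f1 f3 // e1 (evX_agree ag) // (evX_agree ag1).
  have hr r : (nvar <= r < d)%N -> ireg s2 r = ireg s r.
    by move=> /andP[_ rd]; case: f2 => -> // _ _; case: e2 => ->.
  case: ifP => _.
  + apply: runs_mono (IHp d s2 t bt wp nd ag2) _ _; first by rewrite /=; nia.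
    by move=> s3 [a3 h3]; split=> // r rd; rewrite h3 ?hr.
  + apply: runs_mono (IHq d s2 t bt wq nd ag2) _ _; first by rewrite /=; nia.
    by move=> s3 [a3 h3]; split=> // r rd; rewrite h3 ?hr.
- move=> r e p IH d s t bt /and3P[vr be wp] nd ag.
  have bs := bounded_agree ag bt.
  have [we ce se] := bndI_cI be; have /andP[rp rn] := vr.
  have eN : evI s e = evI t e by rewrite (evI_agree ag).
  set N := evI t e in eN *; have Nb : (N < 2 ^ b)%N by case: bt => _ _; apply.
  have bl i : (i <= N)%N -> (bitlen i <= b)%N.
    by move=> iN; apply: bitlen_le => //; apply: leq_ltn_trans Nb.
  apply: (@runs_seq _ _ _ _ (256 * b) (N * (cS t p * b + 100 * b) + 200 * b)); last by nia.
  apply: runs_mono (compI_runs b0 bs we nd) _ _; first by nia.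
  move=> s1 [e1 e2 e3 e4 e5].
  apply: (@runs_seq _ _ _ _ b (N * (cS t p * b + 100 * b) + 100 * b)); last by nia.
  apply: runs_do; first by rewrite /= /bitlen trunc_log0.
  apply: (@runs_seq _ _ _ _ b (N * (cS t p * b + 100 * b) + 10 * b)); last by nia.
  apply: runs_do; first by rewrite /= /bitlen.
  set s3 := run_instr _ _.
  set body := fun i s' => den p (set_ireg s' r i).
  pose Inv i (s' : state R) := [/\ ireg s' d = N, ireg s' d.+1 = i,
     ireg s' d.+2 = 1%N, agree nvar (iteri i body t) s' &
     forall q, (nvar <= q < d)%N -> ireg s' q = ireg s q].
  have I0 : Inv 0%N s3.
    split=> //=.
    * by rewrite /upd; do 2 (case: eqP => [|_]; first by lia); rewrite e1.
    * by rewrite /upd eqxx; case: eqP => //; lia.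
    * by rewrite /upd eqxx.
    * have [g1 g2 g3] := ag; split=> [q qn|a|a] /=; rewrite ?e3 ?e5 //.
      rewrite /upd; do 2 (case: eqP => [|_]; first by lia).
      by rewrite e2 ?g1 //; lia.
    * move=> q qd; rewrite /upd; do 2 (case: eqP => [|_]; first by lia).
      by rewrite e2 //; lia.
  have bti i : (i <= N)%N -> bounded b (iteri i body t).
    elim: i => //= i IHi iN; apply: den_bounded => //.
    apply: bounded_set_ireg => //; last by apply: IHi; exact: ltnW.
    exact: ltn_trans iN _.
  have pti i q : (q < npar)%N -> ireg (iteri i body t) q = ireg t q.
    by move=> qn; elim: i => //= i IHi; rewrite den_par // set_ireg_par.
  apply: runs_mono (@runs_loop _ d.+1 d _ s3 N (2 * b) (cS t p * b + 12 * b)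
           (fun i s' => Inv i s' /\ (i <= N)%N) _ _ _) _ _.
  + by [].
  + by move=> i s' [[h1 h2 h3 h4 h5] iN]; split; [split|have := bl _ iN; have := bl _ (leqnn N); lia].
  + move=> i s' iN [[h1 h2 h3 h4 h5] _].
    apply: (@runs_seq _ _ _ _ (3 * b) (cS t p * b + 6 * b)); last by lia.
    apply: (@runs_move _ b); [by lia | by rewrite h2; apply: bl; lia | by lia |].
    move=> s4 b1 b2 b3 b4 b5.
    have [g1 g2 g3] := h4.
    have ag4 : agree nvar (set_ireg (iteri i body t) r i) s4.
      split=> [q qn|a|a] /=; rewrite ?b3 ?b5 ?g2 ?g3 //.
      by rewrite /upd; case: eqP => [->|qr]; [rewrite b2 h2 | rewrite b1 // g1].
    have bsi : bounded b (set_ireg (iteri i body t) r i).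
      by apply: bounded_set_ireg => //; [lia | apply: bti; exact: ltnW].
    apply: (@runs_seq _ _ _ _ (cS t p * b) (6 * b)) => //.
    have -> : cS t p = cS (set_ireg (iteri i body t) r i) p.
      by apply/esym/cS_par => // q qn; rewrite set_ireg_par // pti.
    have nd3 : (nvar <= d.+3)%N by lia.
    apply: runs_mono (IH d.+3 s4 _ bsi wp nd3 ag4) (leqnn _) _ => s5 [[f1 f2 f3] f4].
    apply: runs_do.
      rewrite /= !f4; [|lia|lia]. rewrite !b1; [|lia|lia]. rewrite h2 h3.
      by have := bl i (ltnW iN); have -> : bitlen 1 = 1%N by []; lia.
    split=> //; split=> /=.
    * by rewrite /upd; case: eqP => [|_]; [lia|]; rewrite f4 ?b1 ?h1 //; lia.
    * by rewrite /upd eqxx !f4 ?b1 ?h2 ?h3 ?addn1 //; lia.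
    * by rewrite /upd; case: eqP => [|_]; [lia|]; rewrite f4 ?b1 ?h3 //; lia.
    * split=> //= q qn; rewrite /upd; case: eqP => [|_]; [lia|exact: f1].
    * by move=> q qd; rewrite /upd; case: eqP => [|_]; [lia|]; rewrite f4 ?b1 ?h5 //; lia.
  + by nia.
  + by move=> s' [[h1 h2 h3 h4 h5] _].
Qed.

(** * Random sign matrices *)

Section Cosh.
Variable R : realType.
Implicit Types x y : R.

(** By [expR y <= (1 - y)^-1] the left side is at most [2 / (1 - x ^+ 2)], and
    [(1 - u)^-1 <= 1 + 2 * u] for [u] between 0 and [1 / 2]. *)
Lemma cosh_le_small x :
  x ^+ 2 <= 2^-1 -> expR x + expR (- x) <= 2 * expR (2 * x ^+ 2).
Proof.
move=> hx.
have h1 y : y < 1 -> expR y <= (1 - y)^-1.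
  move=> y1; have d : 0 < 1 - y by lra.
  rewrite -[expR y]invrK lef_pV2 ?posrE ?invr_gt0 ?expR_gt0 // -expRN.
  by have := expR_ge1Dx (- y); lra.
have x1 : x < 1 by nra.
have x2 : - x < 1 by nra.
have e := expR_ge1Dx (2 * x ^+ 2).
apply: (@le_trans _ _ (2 * (1 + 2 * x ^+ 2))); last by lra.
apply: le_trans (lerD (h1 _ x1) (h1 _ x2)) _.
have d1 : 0 < 1 - x by lra.
have d2 : 0 < 1 + x by lra.
rewrite opprK; have -> : (1 - x)^-1 + (1 + x)^-1 = 2 / ((1 - x) * (1 + x)).
  by field; rewrite !gt_eqF.
rewrite ler_pdivrMr ?mulr_gt0 //.
have x0 : 0 <= x ^+ 2 by exact: sqr_ge0.
nra.
Qed.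

(* cosh (2x) = 2 (cosh x)^2 - 1 transports the bound from x to 2x. *)
Lemma cosh_le x : expR x + expR (- x) <= 2 * expR (2 * x ^+ 2).
Proof.
suff H k : forall x, `|x| <= 2 ^+ k / 2 -> expR x + expR (- x) <= 2 * expR (2 * x ^+ 2).
  pose k := Num.Def.archi_bound (2 * `|x|).
  apply: (H k); rewrite ler_pdivlMr // mulrC.
  have h : 2 * `|x| < k%:R by apply: archi_boundP; rewrite mulr_ge0.
  apply: ltW; apply: lt_le_trans h _.
  by rewrite -natrX ler_nat ltnW // ltn_expl.
elim: k => [|k IH] {}x hx.
  apply: cosh_le_small; rewrite -real_normK ?num_real //.
  have := normr_ge0 x; rewrite expr0 in hx; nra.
have {}IH : expR (x / 2) + expR (- (x / 2)) <= 2 * expR (2 * (x / 2) ^+ 2).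
  apply: IH; rewrite normrM [X in _ * X]ger0_norm ?invr_ge0 //.
  by move: hx; rewrite exprS; lra.
set a := expR (x / 2) in IH; set b := expR (- (x / 2)) in IH.
set g := expR (2 * (x / 2) ^+ 2) in IH.
have ab : a * b = 1 by rewrite /a /b -expRD subrr expR0.
have -> : expR x = a ^+ 2 by rewrite /a expr2 -expRD; congr expR; field.
have -> : expR (- x) = b ^+ 2 by rewrite /b expr2 -expRD; congr expR; field.
have -> : expR (2 * x ^+ 2) = g ^+ 4.
  by rewrite /g -expRM_natl; congr expR; field.
have a0 : 0 < a by exact: expR_gt0.
have b0 : 0 < b by exact: expR_gt0.
have h : (a + b) ^+ 2 <= (2 * g) ^+ 2.
  by rewrite ler_pXn2r // nnegrE ?mulr_ge0 ?addr_ge0 ?expR_ge0.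
have -> : a ^+ 2 + b ^+ 2 = (a + b) ^+ 2 - 2 * (a * b) by ring.
rewrite ab mulr1.
(* What remains is [4 * g ^+ 2 - 2 <= 2 * g ^+ 4]. *)
have := sqr_ge0 (g ^+ 2 - 1); move: h; rewrite !exprMn.
have -> : g ^+ 4 = (g ^+ 2) ^+ 2 by rewrite -exprM.
by move: (g ^+ 2) ((a + b) ^+ 2) => u v; nra.
Qed.
End Cosh.

Section Signs.
Variables (R : realType) (n : nat).
Implicit Types (w : 'I_n -> R) (e : {ffun 'I_n -> bool}).

Definition sgsum w e : R := \sum_i (-1) ^+ e i * w i.
Definition sqn w : R := \sum_i w i ^+ 2.
Definition nz w : {set 'I_n} := [set i | w i != 0].
Definition flip (i : 'I_n) e : {ffun 'I_n -> bool} :=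
  [ffun j => if j == i then ~~ e j else e j].

Lemma flipK i : involutive (flip i).
Proof. by move=> e; apply/ffunP => j; rewrite !ffunE; case: eqP => // _; rewrite negbK. Qed.

(** The arithmetic of the induction in [sgsum_mgf]: deleting a coordinate of square [a] turns the
    parameter [s] into [s']. The smallness condition survives, and the quadratic term of the
    exponent pays for the change. *)
Lemma mgf_scalar (s q a : R) : 0 <= q -> 0 <= a -> `|s| * (q + a) <= 32^-1 ->
  let s' := s + 8 * s ^+ 2 * a in
  `|s'| * q <= 32^-1 /\
  s * a + (s' * q + 16 * s' ^+ 2 * q ^+ 2) <=
    s * (q + a) + 16 * s ^+ 2 * (q + a) ^+ 2.
Proof.
move=> q0 a0 h s'.
have s0 := normr_ge0 s; have s2 : s ^+ 2 = `|s| ^+ 2 by rewrite real_normK ?num_real.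
have sle : s <= `|s| by exact: ler_norm.
set S := `|s| in h s0 s2 sle.
have Sq : S * q <= 32^-1 by nra.
have Sa : S * a <= 32^-1 by nra.
have Sq0 : 0 <= S * q by exact: mulr_ge0.
have Sa0 : 0 <= S * a by exact: mulr_ge0.
split.
  apply: (@le_trans _ _ ((S + 8 * S ^+ 2 * a) * q)).
    apply: ler_wpM2r => //; rewrite /s'; apply: le_trans (ler_normD _ _) _.
    rewrite lerD2l ger0_norm ?s2 //.
    by rewrite mulr_ge0 ?mulr_ge0 ?sqr_ge0.
  have -> : (S + 8 * S ^+ 2 * a) * q = S * q + 8 * (S * a) * (S * q) by ring.
  move: h; rewrite mulrDr; move: (S * q) (S * a) Sq Sa Sq0 Sa0 => u v; nra.
have P0 : 0 <= s ^+ 2 * a * q by apply: mulr_ge0 => //; apply: mulr_ge0 => //; exact: sqr_ge0.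
have -> : s * a + (s' * q + 16 * s' ^+ 2 * q ^+ 2) = s * (q + a) + 16 * s ^+ 2 * q ^+ 2
   + s ^+ 2 * a * q * (8 + 256 * (s * q) + 1024 * (s ^+ 2 * (a * q))).
  by rewrite /s'; ring.
have -> : s * (q + a) + 16 * s ^+ 2 * (q + a) ^+ 2 = s * (q + a) + 16 * s ^+ 2 * q ^+ 2
   + (s ^+ 2 * a * q * 32 + 16 * (s * a) ^+ 2) by ring.
rewrite lerD2l; apply: (@le_trans _ _ (s ^+ 2 * a * q * 32)); last first.
  by rewrite lerDl mulr_ge0 ?sqr_ge0.
apply: ler_wpM2l => //.
have h1 : s * q <= 32^-1 by apply: le_trans Sq; apply: ler_wpM2r.
have h2 : s ^+ 2 * (a * q) <= 32^-1 * 32^-1.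
  have -> : s ^+ 2 * (a * q) = (S * a) * (S * q) by rewrite s2; ring.
  exact: ler_pM.
lra.
Qed.

Lemma sgsum_mgf k (s : R) w :
  (#|nz w| <= k)%N -> `|s| * sqn w <= 32^-1 ->
  \sum_e expR (s * sgsum w e ^+ 2) <=
    2 ^+ n * expR (s * sqn w + 16 * s ^+ 2 * sqn w ^+ 2).
Proof.
elim: k s w => [|k IH] s w.
  rewrite leqn0 cards_eq0 => /eqP w0 _.
  have {}w0 i : w i = 0 by move/setP: w0 => /(_ i); rewrite !inE => /negbFE /eqP.
  have -> : sqn w = 0 by rewrite /sqn big1 // => i _; rewrite w0 expr0n.
  rewrite mulr0 expr0n /= mulr0 addr0 expR0 mulr1.
  rewrite (eq_bigr (fun=> 1)); last first.
    move=> e _; rewrite /sgsum big1; first by rewrite expr0n /= mulr0 expR0.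
    by move=> i _; rewrite w0 mulr0.
  by rewrite sumr_const card_ffun card_bool card_ord natrX.
case: (pickP (mem (nz w))) => [i|/eq_card0 c0]; last first.
  by move=> _; apply: IH; rewrite c0.
rewrite inE => wi ck hs.
pose w' j := if j == i then 0 else w j.
have cw' : (#|nz w'| <= k)%N.
  rewrite -ltnS; apply: leq_trans ck; apply: proper_card; apply/properP; split.
    by apply/subsetP => j; rewrite /nz !inE /w'; case: (j == i) => //; rewrite eqxx.
  by exists i => //; rewrite /nz !inE /w' !eqxx.
have qE : sqn w = sqn w' + w i ^+ 2.
  rewrite /sqn (bigD1 i) //= [X in _ = X + _](bigD1 i) //= {1}/w' eqxx expr0n add0r addrC.
  by congr (_ + _); apply: eq_bigr => j /negbTE ji; rewrite /w' ji.
have XE e : sgsum w e = sgsum w' e + (-1) ^+ e i * w i.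
  rewrite /sgsum (bigD1 i) //= [X in _ = X + _](bigD1 i) //= {1}/w' eqxx mulr0 add0r addrC.
  by congr (_ + _); apply: eq_bigr => j /negbTE ji; rewrite /w' ji.
have XF e : sgsum w (flip i e) = sgsum w' e - (-1) ^+ e i * w i.
  rewrite XE ffunE eqxx signrN mulNr; congr (_ - _).
  rewrite /sgsum; apply: eq_bigr => j _; rewrite ffunE /w'.
  by case: eqP => // _; rewrite !mulr0.
have q'0 : 0 <= sqn w' by apply: sumr_ge0 => j _; exact: sqr_ge0.
rewrite qE in hs *.
have [h1 h2] := mgf_scalar q'0 (sqr_ge0 (w i)) hs.
set s' := s + _ in h1 h2.
have IHs := IH s' w' cw' h1.
set F := \sum_e _.
(* Each sign pattern is paired with its flip at [i], which is the averaging over the sign of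
   [w i]. *)
have FE : 2 * F = \sum_e (expR (s * sgsum w e ^+ 2) + expR (s * sgsum w (flip i e) ^+ 2)).
  rewrite big_split /= mulr_natl mulr2n; congr (_ + _).
  by rewrite /F (reindex_inj (inv_inj (flipK i))).
have : 2 * F <= 2 * (expR (s * w i ^+ 2) * \sum_e expR (s' * sgsum w' e ^+ 2)).
  rewrite FE mulr_sumr mulr_sumr; apply: ler_sum => e _.
  rewrite XE XF; set X := sgsum w' e; set t := (-1) ^+ e i * w i.
  have t2 : t ^+ 2 = w i ^+ 2 by rewrite /t exprMn sqrr_sign mul1r.
  have -> : s * (X + t) ^+ 2 = (s * X ^+ 2 + s * t ^+ 2) + 2 * s * X * t by ring.
  have -> : s * (X - t) ^+ 2 = (s * X ^+ 2 + s * t ^+ 2) + - (2 * s * X * t) by ring.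
  rewrite [expR (_ + 2 * s * X * t)]expRD [expR (_ + - _)]expRD -mulrDr.
  apply: le_trans (ler_wpM2l (expR_ge0 _) (cosh_le _)) _.
  rewrite mulrCA -!expRD ler_pM2l // ler_expR /s' -t2.
  by rewrite le_eqVlt; apply/orP; left; apply/eqP; ring.
rewrite ler_pM2l // => le1; apply: le_trans le1 _.
apply: le_trans (ler_wpM2l (expR_ge0 _) IHs) _.
by rewrite mulrCA ler_pM2l ?exprn_gt0 // -expRD ler_expR.
Qed.

Variable m : nat.
Implicit Type M : {ffun 'I_m -> {ffun 'I_n -> bool}}.

Definition quad w M : R := \sum_i sgsum w (M i) ^+ 2.

Lemma quad_mgf (s : R) w : `|s| * sqn w <= 32^-1 ->
  \sum_M expR (s * quad w M) <=
    2 ^+ (n * m) * expR (m%:R * (s * sqn w + 16 * s ^+ 2 * sqn w ^+ 2)).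
Proof.
move=> hs.
have -> : \sum_M expR (s * quad w M) = (\sum_e expR (s * sgsum w e ^+ 2)) ^+ m.
  transitivity (\sum_(M : {ffun 'I_m -> {ffun 'I_n -> bool}}) \prod_i expR (s * sgsum w (M i) ^+ 2)).
    by apply: eq_bigr => M _; rewrite mulr_sumr expR_sum.
  rewrite -(bigA_distr_bigA (fun=> fun e => expR (s * sgsum w e ^+ 2))) /=.
  by rewrite prodr_const card_ord.
rewrite exprM expRM_natl -exprMn.
apply: lerXn2r; rewrite ?nnegrE.
- by apply: sumr_ge0 => e _; exact: expR_ge0.
- by rewrite mulr_ge0 ?expR_ge0 ?exprn_ge0.
- exact: (@sgsum_mgf #|nz w|).
Qed.

(** The exponential Markov inequality; [sg] is 1 for the upper tail and -1 for the lower one. *)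
Lemma quad_tail (sg eta : R) w : sg ^+ 2 = 1 -> 0 <= eta <= 1 -> 0 < sqn w ->
  #|[set M | eta * m%:R * sqn w < sg * (quad w M - m%:R * sqn w)]|%:R <=
    2 ^+ (n * m) * expR (- (m%:R * eta ^+ 2 / 64)).
Proof.
move=> sg2 /andP[e0 e1] q0; set q := sqn w in q0 *.
have qn0 : q != 0 by rewrite gt_eqF.
have sgn : `|sg| = 1.
  apply/eqP; rewrite -(@eqrXn2 _ 2) ?normr_ge0 // expr1n -normrX sg2 normr1 //.
(* With [r] the absolute value of [s * q], this choice minimises [16 * r ^+ 2 - eta * r]; the
   minimum is [- eta ^+ 2 / 64], and [eta <= 1] makes the choice admissible for [quad_mgf]. *)
pose s := sg * eta / (32 * q).
have sq : `|s| * q <= 32^-1.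
  rewrite /s !normrM sgn mul1r (ger0_norm e0) ger0_norm ?invr_ge0; last by lra.
  rewrite invfM mulrA mulfVK // ler_pdivrMr // mulVf ?pnatr_eq0 //.
have h := quad_mgf sq.
pose th := s * (1 + sg * eta) * m%:R * q.
have : expR th * #|[set M | eta * m%:R * q < sg * (quad w M - m%:R * q)]|%:R <=
    \sum_M expR (s * quad w M).
  rewrite mulr_natr -sumr_const [leRHS](bigID (mem [set M | eta * m%:R * q < sg * (quad w M - m%:R * q)])) /=.
  rewrite -[leLHS]addr0; apply: lerD; last by apply: sumr_ge0 => M _; exact: expR_ge0.
  apply: ler_sum => M; rewrite inE => hM; rewrite ler_expR /th /s.
  have -> : sg * eta / (32 * q) * (1 + sg * eta) * m%:R * q =
     eta / 32 / q * (sg * (m%:R * q) + sg ^+ 2 * (eta * m%:R * q)) by field.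
  rewrite sg2 mul1r.
  have -> : sg * eta / (32 * q) * quad w M = eta / 32 / q * (sg * quad w M) by field.
  apply: ler_wpM2l; first by rewrite !mulr_ge0 ?invr_ge0 // ltW.
  by move: hM; rewrite mulrBr; lra.
move/le_trans => /(_ _ h) => h2.
rewrite -(ler_pM2l (expR_gt0 th)); apply: le_trans h2 _.
rewrite [leRHS]mulrCA ler_pM2l ?exprn_gt0 // -expRD ler_expR /th -/q.
have -> : s * q = sg * eta / 32 by rewrite /s; field.
have -> : 16 * s ^+ 2 * q ^+ 2 = sg ^+ 2 * eta ^+ 2 / 64 by rewrite /s; field.
have -> : s * (1 + sg * eta) * m%:R * q = m%:R * (sg * eta / 32 + sg ^+ 2 * eta ^+ 2 / 32).
  by rewrite /s; field.
by rewrite sg2 le_eqVlt; apply/orP; left; apply/eqP; field.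
Qed.

Lemma quad_bad (eta : R) w : 0 <= eta <= 1 ->
  #|[set M | eta * m%:R * sqn w < `|quad w M - m%:R * sqn w|]|%:R <=
    2 * (2 ^+ (n * m) * expR (- (m%:R * eta ^+ 2 / 64))).
Proof.
move=> he.
have [q0|q0] := ltP 0 (sqn w); last first.
  have w0 i : w i = 0.
    apply/eqP; rewrite -sqrf_eq0 eq_le sqr_ge0 andbT.
    apply: le_trans q0; rewrite /sqn (bigD1 i) //= lerDl.
    by apply: sumr_ge0 => j _; exact: sqr_ge0.
  have qz : sqn w = 0 by rewrite /sqn big1 // => i _; rewrite w0 expr0n.
  rewrite (_ : [set M | _] = set0).
    by rewrite cards0 !mulr_ge0 ?expR_ge0 ?exprn_ge0.
  apply/setP => M; rewrite !inE qz !mulr0 subr0.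
  have -> : quad w M = 0.
    rewrite /quad big1 // => i _; rewrite /sgsum big1 ?expr0n // => j _.
    by rewrite w0 mulr0.
  by rewrite normr0 ltxx.
have h1 := @quad_tail 1 eta w (expr1n _ _) he q0.
have h2 := @quad_tail (-1) eta w (etrans (sqrrN 1) (expr1n _ _)) he q0.
set Y := 2 ^+ _ * _ in h1 h2 *; have -> : 2 * Y = Y + Y by ring.
apply: (le_trans _ (lerD h1 h2)).
rewrite -natrD ler_nat; apply: leq_trans (leq_card_setU _ _).
apply: subset_leq_card; apply/subsetP => M; rewrite !inE mul1r mulN1r.
by rewrite ltr_normr.
Qed.
End Signs.

(** * Restricted isometry on subtrees *)

(** Closure under parents stands in for connectedness: it is decidable, stable under unions, and
    true of the empty set, from which the iteration starts. *)
Definition tree_closed (c n : nat) (S : {set 'I_n}) : bool :=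
  [forall i, forall j, tree_parent c i j ==> (j \in S) ==> (i \in S)].

Lemma tree_closedP c n (S : {set 'I_n}) :
  reflect (forall i j, tree_parent c i j -> j \in S -> i \in S) (tree_closed c S).
Proof.
apply: (iffP forallP) => [h i j p jS|h i].
  by move/forallP: (h i) => /(_ j); rewrite p jS.
by apply/forallP => j; apply/implyP => p; apply/implyP; exact: h.
Qed.

Section Code.
Variables (c n k : nat).
Hypothesis c0 : (0 < c)%N.
Implicit Types S : {set 'I_n}.

Definition srank S (x : 'I_n) : nat := #|[set y in S | (y < x)%N]|.

Lemma srank_mono S (x y : 'I_n) : x \in S -> (x < y)%N -> (srank S x < srank S y)%N.
Proof.
move=> xS xy; apply: proper_card; apply/properP; split.
  by apply/subsetP => z; rewrite !inE => /andP[-> zx]; exact: ltn_trans xy.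
by exists x; rewrite !inE ?xS ?xy // ltnn andbF.
Qed.

Lemma srank_inj S : {in S &, injective (srank S)}.
Proof.
move=> x y xS yS e; apply: ord_inj; case: (ltngtP x y) => //.
  by move/(srank_mono xS); rewrite e ltnn.
by move/(srank_mono yS); rewrite e ltnn.
Qed.

Lemma srank_lt S x : x \in S -> (srank S x < #|S|)%N.
Proof.
move=> xS; apply: proper_card; apply/properP; split.
  by apply/subsetP => z; rewrite inE => /andP[].
by exists x; rewrite // inE ltnn andbF.
Qed.

(* A subtree is coded by saying, for its r-th node in breadth-first order, which
   of the c children it contains; hence at most 2^(ck+1) subtrees of size k. *)
Definition tree_code S : {ffun 'I_k * 'I_c -> bool} * bool :=
  ([ffun rj : 'I_k * 'I_c => [exists x, [&& x \in S, srank S x == rj.1 &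
      [exists y, (y \in S) && (nat_of_ord y == c * x + rj.2 + 1)%N]]]],
   [exists x, (x \in S) && (nat_of_ord x == 0%N)]).

(** When the two sets agree below [i], the parent of [i] lies in both and has the same rank in both,
    as ranks only count smaller nodes. So the same entry of the code decides about [i]; the root has
    a bit of its own. *)
Lemma tree_code_sub S S' : tree_closed c S -> tree_closed c S' ->
  (#|S| <= k)%N -> tree_code S = tree_code S' ->
  forall i : 'I_n, (forall j : 'I_n, (j < i)%N -> (j \in S) = (j \in S')) ->
  i \in S -> i \in S'.
Proof.
move=> /tree_closedP cS /tree_closedP cS' Sk [/ffunP eC eR] i IH iS.
case: (posnP i) => [i0|i0].
  have : [exists x, (x \in S) && (nat_of_ord x == 0%N)] by apply/existsP; exists i; rewrite iS i0 eqxx.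
  rewrite eR => /existsP[x /andP[xS /eqP x0]].
  by rewrite (_ : i = x) //; apply: ord_inj; rewrite x0.
have pn : (i.-1 %/ c < n)%N.
  by apply: leq_ltn_trans (leq_div _ _) _; apply: leq_ltn_trans (leq_pred _) _.
pose p := Ordinal pn.
have pi : tree_parent c p i by rewrite /tree_parent i0 /=.
have pS : p \in S by exact: cS pi iS.
have pltn : (p < i)%N by rewrite /=; apply: leq_ltn_trans (leq_div _ _) _; rewrite prednK.
have pS' : p \in S' by rewrite -IH.
have rk : srank S p = srank S' p.
  rewrite /srank; apply: eq_card => y; rewrite !inE.
  by case: ltnP => [yp|_]; rewrite ?andbT ?andbF // IH //; exact: ltn_trans pltn.
have rl : (srank S p < k)%N by apply: leq_trans Sk; exact: srank_lt.
have jl : (i.-1 %% c < c)%N by rewrite ltn_mod.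
have iE : (i = c * p + (i.-1 %% c) + 1 :> nat)%N.
  by rewrite /= mulnC -divn_eq addn1 prednK.
have := eC (Ordinal rl, Ordinal jl); rewrite !ffunE /=.
have -> : [exists x, [&& x \in S, srank S x == srank S p &
      [exists y, (y \in S) && (nat_of_ord y == c * x + i.-1 %% c + 1)%N]]].
  apply/existsP; exists p; rewrite pS eqxx /=.
  by apply/existsP; exists i; rewrite iS /= {1}iE.
move=> /esym /existsP[x /and3P[xS' /eqP rx /existsP[y /andP[yS' /eqP yE]]]].
have xp : x = p by apply: (srank_inj xS' pS'); rewrite rx rk.
by rewrite (_ : i = y) //; apply: ord_inj; rewrite yE xp -iE.
Qed.

Lemma tree_code_inj :
  {in [set S | tree_closed c S & (#|S| <= k)%N] &, injective tree_code}.
Proof.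
move=> S S'; rewrite !inE => /andP[cS Sk] /andP[cS' Sk'] e.
suff H N : forall i : 'I_n, (i < N)%N -> (i \in S) = (i \in S').
  by apply/setP => i; apply: (H n).
elim: N => // N IH i; rewrite ltnS leq_eqVlt => /orP[/eqP iN|]; last exact: IH.
have h (j : 'I_n) : (j < i)%N -> (j \in S) = (j \in S') by rewrite iN; exact: IH.
apply/idP/idP.
  exact: (tree_code_sub cS cS' Sk e h).
by apply: (tree_code_sub cS' cS Sk' (esym e)) => j /h ->.
Qed.

Lemma card_tree_closed :
  (#|[set S : {set 'I_n} | tree_closed c S & (#|S| <= k)%N]| <= 2 ^ (c * k + 1))%N.
Proof.
rewrite -(card_in_imset tree_code_inj); apply: leq_trans (max_card _) _.
by rewrite card_prod card_ffun card_bool card_prod !card_ord expnD expn1 mulnC (mulnC c) mulnC.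
Qed.
End Code.

(** * Counting integer vectors of small l1 norm *)

Section Net.
Variables (R : realType) (n B : nat).
(** A pair [(p, q)] stands for the integer [p - q], and [p + q] bounds its absolute value. *)
Let grid := {ffun 'I_n -> 'I_B * 'I_B}.
Implicit Types (f : grid) (S : {set 'I_n}).

Definition gsum f : nat := (\sum_i ((f i).1 + (f i).2))%N.
Definition gsupp S f : bool := [forall i, (i \notin S) ==> (((f i).1 + (f i).2)%N == 0%N)].

Lemma geo_sum_le : \sum_(p < B) (2^-1 : R) ^+ p <= 2.
Proof.
suff : \sum_(p < B) (2^-1 : R) ^+ p = 2 - 2 * 2^-1 ^+ B.
  move=> ->; have : 0 <= (2^-1 : R) ^+ B by rewrite exprn_ge0 // invr_ge0.
  lra.
elim: B => [|b IH]; first by rewrite big_ord0 expr0; lra.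
by rewrite big_ord_recr /= IH exprS; field.
Qed.

(** Give [f] the weight [2 ^ (- gsum f)]. A counted vector has weight at least [2 ^ (- T)], and the
    total weight factors over the coordinates: a coordinate in [S] contributes a product of two
    geometric sums, at most 4, any other coordinate at most 1. *)
Lemma card_grid S k T : (#|S| <= k)%N ->
  (#|[set f | gsupp S f & (gsum f <= T)%N]|%:R : R) <= 2 ^+ T * 4 ^+ k.
Proof.
move=> Sk.
pose g i (pq : 'I_B * 'I_B) : R := if i \in S then 2^-1 ^+ (pq.1 + pq.2)
  else ((pq.1 + pq.2)%N == 0%N)%:R.
have g0 i pq : 0 <= g i pq by rewrite /g; case: ifP => _; rewrite ?exprn_ge0 ?invr_ge0.
apply: (@le_trans _ _ (\sum_(f : {ffun 'I_n -> 'I_B * 'I_B}) 2 ^+ T * \prod_i g i (f i))).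
  rewrite -sum1_card natr_sum [leRHS](bigID (mem [set f | gsupp S f & (gsum f <= T)%N])) /=.
  rewrite -[leLHS]addr0; apply: lerD; last first.
    by apply: sumr_ge0 => f _; rewrite mulr_ge0 ?exprn_ge0 // prodr_ge0.
  apply: ler_sum => f; rewrite inE => /andP[/forallP sf lf].
  have -> : \prod_i g i (f i) = 2^-1 ^+ gsum f.
    rewrite /gsum -prodrXr; apply: eq_bigr => i _; rewrite /g; case: ifP => // iS.
    by have := sf i; rewrite iS /= => /eqP ->; rewrite eqxx expr0.
  rewrite exprVn ler_pdivlMr ?exprn_gt0 // mul1r.
  by rewrite ler_eXn2l // ltr1n.
rewrite -mulr_sumr; apply: ler_wpM2l; first by rewrite exprn_ge0.
rewrite -(bigA_distr_bigA g) /=.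
apply: (@le_trans _ _ (\prod_i (if i \in S then 4 else 1))); last first.
  rewrite -big_mkcond /= prodr_const; apply: ler_weXn2l => //; by rewrite ler1n.
apply: ler_prod => i _; apply/andP; split; first by apply: sumr_ge0.
rewrite /g; case: ifP => iS.
  rewrite -(pair_bigA _ (fun p q : 'I_B => 2^-1 ^+ (p + q))) /=.
  have -> : \sum_(p < B) \sum_(q < B) (2^-1 : R) ^+ (p + q) =
     (\sum_(p < B) 2^-1 ^+ p) * (\sum_(p < B) 2^-1 ^+ p).
    rewrite mulr_suml; apply: eq_bigr => p _; rewrite mulr_sumr.
    by apply: eq_bigr => q _; rewrite exprD.
  have h := geo_sum_le.
  have h0 : 0 <= \sum_(p < B) (2^-1 : R) ^+ p by apply: sumr_ge0 => p _; rewrite exprn_ge0 // invr_ge0.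
  nra.
rewrite -natr_sum -[X in _ <= X](mulr1n 1) ler_nat -big_mkcond /= sum1_card.
apply/card_le1_eqP => -[p q] [p' q'] H H'.
have {H}/eqP H : (p + q == 0)%N := H; have {H'}/eqP H' : (p' + q' == 0)%N := H'.
have [a b] : p = 0%N :> nat /\ q = 0%N :> nat by lia.
have [a' b'] : p' = 0%N :> nat /\ q' = 0%N :> nat by lia.
by congr pair; apply: ord_inj; rewrite /= ?a ?a' ?b ?b'.
Qed.
End Net.

Section Dot.
Variable R : realType.

Definition dot n (u v : 'cV[R]_n) : R := \sum_i u i 0 * v i 0.
Definition vsupp n (S : {set 'I_n}) (v : 'cV[R]_n) : Prop :=
  forall i, i \notin S -> v i 0 = 0.

Variable n : nat.
Implicit Types (u v w : 'cV[R]_n) (a : R).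

Lemma dotC u v : dot u v = dot v u.
Proof. by apply: eq_bigr => i _; rewrite mulrC. Qed.

Lemma dotDl u v w : dot (u + v) w = dot u w + dot v w.
Proof. by rewrite -big_split; apply: eq_bigr => i _; rewrite mxE mulrDl. Qed.

Lemma dotDr u v w : dot w (u + v) = dot w u + dot w v.
Proof. by rewrite dotC dotDl !(dotC w). Qed.

Lemma dotZl a u w : dot (a *: u) w = a * dot u w.
Proof. by rewrite mulr_sumr; apply: eq_bigr => i _; rewrite mxE mulrA. Qed.

Lemma dotZr a u w : dot w (a *: u) = a * dot w u.
Proof. by rewrite dotC dotZl dotC. Qed.

Lemma dotNl u w : dot (- u) w = - dot u w.
Proof. by rewrite -scaleN1r dotZl mulN1r. Qed.

Lemma dotNr u w : dot w (- u) = - dot w u.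
Proof. by rewrite dotC dotNl dotC. Qed.

Lemma dot0l w : dot 0 w = 0.
Proof. by rewrite /dot big1 // => i _; rewrite mxE mul0r. Qed.

Lemma dot0r w : dot w 0 = 0.
Proof. by rewrite dotC dot0l. Qed.

Definition dotE := (dotDl, dotDr, dotNl, dotNr, dotZl, dotZr, dot0l, dot0r).

Lemma dot_ge0 u : 0 <= dot u u.
Proof. by apply: sumr_ge0 => i _; rewrite -expr2 sqr_ge0. Qed.

Lemma dot_eq0 u : dot u u = 0 -> u = 0.
Proof.
move=> h; apply/colP => i; rewrite !mxE.
have /psumr_eq0P : \sum_i u i 0 * u i 0 = 0 by exact: h.
move=> /(_ (fun i _ => _)) h2; apply/eqP; rewrite -sqrf_eq0 expr2.
by apply/eqP; apply: h2 => // j; rewrite -expr2 sqr_ge0.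
Qed.

Lemma CauchySchwarz u v : dot u v ^+ 2 <= dot u u * dot v v.
Proof.
have [v0|v0] := eqVneq (dot v v) 0.
  by rewrite (dot_eq0 v0) !dot0r expr0n mulr0.
have vp : 0 < dot v v by rewrite lt0r v0 dot_ge0.
have := dot_ge0 (u - (dot u v / dot v v) *: v); rewrite !dotE (dotC v u).
set X := (X in 0 <= X); have -> : X = dot u u - dot u v ^+ 2 / dot v v.
  by rewrite /X; field.
by rewrite subr_ge0 ler_pdivrMr.
Qed.

Lemma vsuppS (S T : {set 'I_n}) v : S \subset T -> vsupp S v -> vsupp T v.
Proof. by move=> /subsetP ST h i iT; apply: h; apply: contra iT; exact: ST. Qed.

Lemma vsuppD (S : {set 'I_n}) u v : vsupp S u -> vsupp S v -> vsupp S (u + v).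
Proof. by move=> hu hv i iS; rewrite mxE hu // hv // addr0. Qed.

Lemma vsuppZ (S : {set 'I_n}) a v : vsupp S v -> vsupp S (a *: v).
Proof. by move=> hv i iS; rewrite mxE hv // mulr0. Qed.

Lemma vsuppN (S : {set 'I_n}) v : vsupp S v -> vsupp S (- v).
Proof. by move=> hv i iS; rewrite mxE hv // oppr0. Qed.

Lemma vsuppB (S : {set 'I_n}) u v : vsupp S u -> vsupp S v -> vsupp S (u - v).
Proof. by move=> hu hv; apply: vsuppD => //; exact: vsuppN. Qed.
End Dot.

Definition rip (R : realType) c n m k (A : 'M[R]_(m, n)) : Prop :=
  forall (S : {set 'I_n}) v, tree_closed c S -> (#|S| <= k)%N -> vsupp S v ->
  `|dot (A *m v) (A *m v) - m%:R * dot v v| <= 8^-1 * m%:R * dot v v.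

Lemma card_bigcup_le (I T : finType) (P : pred I) (F : I -> {set T}) :
  (#|\bigcup_(i | P i) F i| <= \sum_(i | P i) #|F i|)%N.
Proof.
elim/big_rec2: _ => [|i x y _ le]; first by rewrite cards0.
by apply: leq_trans (leq_card_setU _ _) _; rewrite leq_add2l.
Qed.

Section Exists.
Variables (R : realType) (c n k : nat).
Hypothesis c0 : (0 < c)%N.
(** [2 ^ L] is twice the size of the union bound: [2 ^ (c * k + 1)] subtrees, [2 ^ (64 * k) * 4 ^ k]
    grid vectors, two tails. At [eta = 1 / 16] a tail is [expR (- (m / 2 ^ 14))], hence the factor
    [2 ^ 14] in [m]; at least half of the sign matrices are then good. *)
Let L := (c * k + 66 * k + 3)%N.
Let m := (2 ^ 14 * L)%N.
Let B := (64 * k).+1.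
Let grid := {ffun 'I_n -> 'I_B * 'I_B}.

Definition gval (f : grid) (i : 'I_n) : R := (f i).1%:R - (f i).2%:R.

Definition gbad (f : grid) : {set {ffun 'I_m -> {ffun 'I_n -> bool}}} :=
  [set M | 16^-1 * m%:R * sqn (gval f) < `|quad (gval f) M - m%:R * sqn (gval f)|].

Lemma expR_pow2 (j : nat) : expR (- j%:R) * 2 ^+ j <= 1 :> R.
Proof.
rewrite expRN mulrC ler_pdivrMr ?expR_gt0 // mul1r.
have -> : expR j%:R = expR 1 ^+ j :> R by rewrite -expRM_natl mulr1.
by apply: lerXn2r; rewrite ?nnegrE ?expR_ge0 //; have := expR_ge1Dx (1 : R); lra.
Qed.

Lemma sign_matrix : exists M : {ffun 'I_m -> {ffun 'I_n -> bool}},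
  forall (S : {set 'I_n}) (f : grid), tree_closed c S -> (#|S| <= k)%N ->
    gsupp S f -> (gsum f <= 64 * k)%N -> M \notin gbad f.
Proof.
pose CS := [set S : {set 'I_n} | tree_closed c S & (#|S| <= k)%N].
pose NS (S : {set 'I_n}) := [set f : grid | gsupp S f & (gsum f <= 64 * k)%N].
case: (pickP [pred M | [forall S in CS, forall f in NS S, M \notin gbad f]]) => [M|no].
  move=> /forall_inP h; exists M => S f cS Sk sf gf.
  have SC : S \in CS by rewrite inE cS.
  by have /forall_inP := h S SC; apply; rewrite inE sf.
exfalso.
pose U := \bigcup_(S in CS) \bigcup_(f in NS S) gbad f.
have UT : U = setT.
  apply/setP => M; rewrite inE; apply/bigcupP.
  have := no M; rewrite /= => /negbT; rewrite negb_forall_in => /exists_inP[S SC].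
  rewrite negb_forall_in => /exists_inP[f fN]; rewrite negbK => Mf.
  by exists S => //; apply/bigcupP; exists f.
set X : R := 2 ^+ (n * m).
have cT : #|U|%:R = X.
  by rewrite UT cardsT !card_ffun card_bool !card_ord -expnM natrX.
set E : R := expR (- L%:R).
have E0 : 0 < E by exact: expR_gt0.
have X0 : 0 < X by rewrite exprn_gt0.
have bnd f : #|gbad f|%:R <= 2 * (X * E).
  have := @quad_bad R n m 16^-1 (gval f); rewrite invr_ge0 ler0n invf_le1 // ler1n /=.
  move=> /(_ isT) /le_trans; apply; rewrite ler_pM2l // ler_pM2l // ler_expR.
  by rewrite /m natrM natrX le_eqVlt; apply/orP; left; apply/eqP; field.
have : X <= 2 ^+ (c * k + 1) * (2 ^+ (64 * k) * 4 ^+ k * (2 * (X * E))).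
  rewrite -{1}cT.
  apply: (@le_trans _ _ (\sum_(S in CS) \sum_(f in NS S) #|gbad f|%:R)).
    under eq_bigr do rewrite -natr_sum.
    rewrite -natr_sum ler_nat.
    apply: leq_trans (card_bigcup_le _ _) _ .
    by apply: leq_sum => S _; exact: card_bigcup_le.
  apply: (@le_trans _ _ (\sum_(S in CS) (2 ^+ (64 * k) * 4 ^+ k * (2 * (X * E))))).
    apply: ler_sum => S; rewrite inE => /andP[_ Sk].
    apply: (@le_trans _ _ (\sum_(f in NS S) (2 * (X * E)))).
      by apply: ler_sum => f _; exact: bnd.
    rewrite sumr_const -[leLHS]mulr_natl; apply: ler_wpM2r.
      by rewrite !mulr_ge0 // ltW.
    exact: card_grid.
  rewrite sumr_const -[leLHS]mulr_natl; apply: ler_wpM2r.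
    by rewrite !mulr_ge0 ?exprn_ge0 // ltW.
  by rewrite -natrX ler_nat; exact: card_tree_closed.
have -> : 2 ^+ (c * k + 1) * (2 ^+ (64 * k) * 4 ^+ k * (2 * (X * E))) = X * (E * 2 ^+ L) / 2.
  have -> : (4 : R) = 2 ^+ 2 by rewrite expr2; lra.
  have -> : 2 ^+ L = 2 ^+ (c * k + 1) * 2 ^+ (64 * k) * 2 ^+ 2 ^+ k * 4 :> R.
    rewrite -exprM -!exprD (_ : 4 = 2 ^+ 2); last by rewrite expr2; lra.
    by rewrite -exprD; congr (_ ^+ _); rewrite /L; lia.
  by field.
have h := expR_pow2 L; rewrite -/E in h.
have : X * (E * 2 ^+ L) <= X * 1 by rewrite ler_pM2l.
lra.
Qed.
End Exists.

(** Rounding towards zero; [Num.truncn] is 0 on negative numbers, so one of [p] and [q] vanishes.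
    The last bound holds because a nonzero integer part is at least 1; it turns an l2 bound on a
    vector into an l1 bound on its rounding. *)
Lemma truncn_split (R : realType) (v : R) :
  let p : R := (Num.truncn v)%:R in let q : R := (Num.truncn (- v))%:R in
  [/\ `|v - (p - q)| <= 1, `|v + (p - q)| <= 2 * `|v|,
      (p - q) ^+ 2 <= v ^+ 2 & p + q <= v ^+ 2].
Proof.
wlog v0 : v / 0 <= v.
  move=> H p q; have [v0|v0] := leP 0 v; first exact: H.
  have nv : 0 <= - v by lra.
  have := H _ nv; rewrite /= opprK -/p -/q => -[h1 h2 h3 h4].
  split.
  - by rewrite -normrN (_ : - (v - (p - q)) = - v - (q - p)) //; ring.
  - by rewrite -normrN (_ : - (v + (p - q)) = - v + (q - p)) -?(normrN v) //; ring.
  - by rewrite -sqrrN opprB -(sqrrN v).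
  - by rewrite addrC -(sqrrN v).
move=> p q.
have q0 : q = 0 by rewrite /q (_ : Num.truncn _ = 0%N) //; apply/eqP; rewrite -leqn0 truncn_le_nat; lra.
have p0 : 0 <= p by rewrite /p.
have [pv vp] : p <= v /\ v < p + 1.
  by have := truncn_itv v0; rewrite -natr1 => /andP[].
rewrite q0 subr0 addr0 !ger0_norm; [|lra..].
split; [lra|lra|by rewrite ler_pXn2r|].
have [t0|t0] := posnP (Num.truncn v); first by rewrite /p t0 sqr_ge0.
have : 1 <= p by rewrite /p ler1n.
nra.
Qed.

(** * From integer vectors to real vectors *)

Section Bootstrap.
Variables (R : realType) (n m k : nat) (A : 'M[R]_(m, n)) (S : {set 'I_n}).
Hypothesis Sk : (#|S| <= k)%N.
Variable eta : R.

Let Q (v : 'cV[R]_n) : R := dot (A *m v) (A *m v) - m%:R * dot v v.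

Hypothesis grid_ok : forall (w : 'cV[R]_n), vsupp S w ->
  (exists p q : 'I_n -> nat, (forall i, w i 0 = (p i)%:R - (q i)%:R) /\
     (\sum_i (p i + q i) <= 64 * k)%N) ->
  `|Q w| <= eta * m%:R * dot w w.
Hypothesis eta0 : 0 <= eta.

(* Rounding v to an integer vector w, Q v - Q w = B (v - w, v + w) for the polar
   form B of Q, which is small because v is scaled so that |v|^2 = 64 k. *)
Lemma bootstrap_scaled rho v : 0 <= rho ->
  (forall v, vsupp S v -> `|Q v| <= rho * dot v v) ->
  vsupp S v -> dot v v = 64 * k%:R ->
  `|Q v| <= (eta * m%:R + rho / 4) * dot v v.
Proof.
move=> rho0 hrho sv dv.
pose p (i : 'I_n) := Num.truncn (v i 0); pose q (i : 'I_n) := Num.truncn (- v i 0).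
pose w : 'cV[R]_n := \col_i ((p i)%:R - (q i)%:R).
have tr i := truncn_split (v i 0).
have wE i : w i 0 = (p i)%:R - (q i)%:R by rewrite mxE.
have sw : vsupp S w.
  move=> i iS; have [_ _ h _] := tr i; rewrite -/(p i) -/(q i) -wE (sv i iS) expr0n /= in h.
  by apply/eqP; rewrite -sqrf_eq0 eq_le h sqr_ge0.
have dw : dot w w <= dot v v.
  by apply: ler_sum => i _; rewrite -!expr2 wE; have [] := tr i.
have da : dot (v - w) (v - w) <= k%:R.
  apply: (@le_trans _ _ (\sum_(i in S) 1)); last by rewrite sumr_const ler_nat.
  rewrite /dot (bigID (mem S)) /= [X in _ + X]big1 ?addr0; last first.
    by move=> i iS; rewrite !mxE (sv i iS) -(wE i) (sw i iS) subr0 mulr0.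
  apply: ler_sum => i _; have [h _ _ _] := tr i.
  rewrite !mxE -expr2 -real_normK ?num_real // -/(p i) -/(q i) in h *.
  by rewrite expr_le1.
have db : dot (v + w) (v + w) <= 4 * dot v v.
  rewrite mulr_sumr; apply: ler_sum => i _; have [_ h _ _] := tr i.
  rewrite !mxE -!expr2 -real_normK ?num_real // -/(p i) -/(q i) in h *.
  rewrite -(real_normK (num_real (v i 0))).
  have := normr_ge0 (v i 0); move: h.
  have := normr_ge0 (v i 0 + ((p i)%:R - (q i)%:R)).
  by move: `|v i 0 + _| `|v i 0| => x y; nra.
have Qw : `|Q w| <= eta * m%:R * dot v v.
  apply: (@le_trans _ _ (eta * m%:R * dot w w)); last by apply: ler_wpM2l => //; rewrite mulr_ge0.
  apply: grid_ok => //.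
  exists p, q; split=> //; rewrite -(ler_nat R) natr_sum natrM -dv.
  apply: ler_sum => i _; rewrite natrD -expr2; by have [] := tr i.
(* The weights 4 and [1 / 4] balance [v - w], of squared norm at most [k], against [v + w], of
   squared norm at most [256 * k]: both weighted terms are at most [16 * k], together half of
   [dot v v]. *)
have par (a b : 'cV[R]_n) : dot (4 *: a + 4^-1 *: b) (4 *: a + 4^-1 *: b)
    + dot (4 *: a - 4^-1 *: b) (4 *: a - 4^-1 *: b)
    = 2 * (16 * dot a a + 16^-1 * dot b b).
  by rewrite !dotE (dotC b a); field.
pose a := v - w; pose b := v + w.
have pol : Q v - Q w = 4^-1 * (Q (4 *: a + 4^-1 *: b) - Q (4 *: a - 4^-1 *: b)).
  rewrite /Q /a /b !(mulmxDr, mulmxBr, mulmxN) -!scalemxAr !(mulmxDr, mulmxBr, mulmxN).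
  rewrite !dotE (dotC (A *m w) (A *m v)) (dotC w v); by field.
have sa : vsupp S a by exact: vsuppB.
have sb : vsupp S b by exact: vsuppD.
have h1 := hrho _ (vsuppD (vsuppZ 4 sa) (vsuppZ 4^-1 sb)).
have h2 := hrho _ (vsuppB (vsuppZ 4 sa) (vsuppZ 4^-1 sb)).
have hs : `|Q v - Q w| <= rho / 4 * dot v v.
  rewrite pol normrM ger0_norm ?invr_ge0 //.
  apply: (@le_trans _ _ (4^-1 * (rho * (2 * (16 * dot a a + 16^-1 * dot b b))))).
    apply: ler_wpM2l; first by rewrite invr_ge0.
    apply: le_trans (ler_normB _ _) _.
    apply: le_trans (lerD h1 h2) _.
    rewrite -mulrDr; apply: ler_wpM2l => //.
    by rewrite par.
  have : rho * (16 * dot a a + 16^-1 * dot b b) <= rho * (2^-1 * dot v v).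
    by apply: ler_wpM2l => //; rewrite /a /b; lra.
  lra.
have := ler_normD (Q v - Q w) (Q w); rewrite subrK mulrDl; lra.
Qed.

Lemma bootstrap_step rho : (0 < k)%N -> 0 <= rho ->
  (forall v, vsupp S v -> `|Q v| <= rho * dot v v) ->
  forall v, vsupp S v -> `|Q v| <= (eta * m%:R + rho / 4) * dot v v.
Proof.
move=> k0 rho0 hrho v sv.
have [d0|d0] := eqVneq (dot v v) 0.
  by rewrite (dot_eq0 d0) /Q mulmx0 !dot0l !mulr0 subr0 normr0.
have dp : 0 < dot v v by rewrite lt0r d0 dot_ge0.
have kp : 0 < k%:R :> R by rewrite ltr0n.
pose t := Num.sqrt (64 * k%:R / dot v v).
have t2 : t ^+ 2 = 64 * k%:R / dot v v.
  by rewrite sqr_sqrtr // divr_ge0 ?dot_ge0 // mulr_ge0.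
have tp : 0 < t ^+ 2 by rewrite t2 divr_gt0 // mulr_gt0.
have QZ : Q (t *: v) = t ^+ 2 * Q v by rewrite /Q -scalemxAr !dotE; ring.
have dZ : dot (t *: v) (t *: v) = t ^+ 2 * dot v v by rewrite !dotE; ring.
have := bootstrap_scaled rho0 hrho (vsuppZ t sv).
rewrite {1}dZ {1}t2 mulfVK // => /(_ erefl).
by rewrite QZ dZ normrM (gtr0_norm tp) mulrCA ler_pM2l.
Qed.

(** [bootstrap_step] sends a bound [rho] to [eta * m + rho / 4]. Started at the Cauchy-Schwarz bound
    [r0] it converges to the fixed point [4 / 3 * (eta * m)], which for [eta = 1 / 16] is [m / 12],
    within the [m / 8] of [rip]. *)
Lemma bootstrap v : (0 < k)%N -> (forall i j, `|A i j| <= 1) -> vsupp S v ->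
  `|Q v| <= 4 / 3 * (eta * m%:R) * dot v v.
Proof.
move=> k0 A1 sv; set r0 : R := m%:R * (n%:R + 1).
have r00 : 0 <= r0 by rewrite mulr_ge0 // addr_ge0.
have base w : vsupp S w -> `|Q w| <= r0 * dot w w.
  move=> _; apply: le_trans (ler_normB _ _) _.
  rewrite !ger0_norm ?mulr_ge0 ?dot_ge0 // /r0 mulrDr mulr1 mulrDl lerD2r.
  rewrite -mulrA mulr_natl -[X in _ *+ X]card_ord -sumr_const.
  apply: ler_sum => i _; rewrite -expr2 mxE.
  have -> : \sum_j A i j * w j 0 = dot (\col_j A i j) w.
    by apply: eq_bigr => j _; rewrite mxE.
  apply: le_trans (CauchySchwarz _ _) _; apply: ler_wpM2r; first exact: dot_ge0.
  rewrite -[X in _ <= X%:R]card_ord -sumr_const; apply: ler_sum => j _.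
  by rewrite mxE -expr2 -real_normK ?num_real // expr_le1.
have it j w : vsupp S w ->
    `|Q w| <= (4 / 3 * (eta * m%:R) + r0 / 4 ^+ j) * dot w w.
  elim: j w => [|j IH] w sw.
    apply: le_trans (base w sw) _; apply: ler_wpM2r; first exact: dot_ge0.
    by rewrite expr0 divr1 lerDr; apply: mulr_ge0; [lra | exact: mulr_ge0].
  apply: le_trans (@bootstrap_step (4 / 3 * (eta * m%:R) + r0 / 4 ^+ j) k0 _ IH w sw) _.
    by apply: addr_ge0; [apply: mulr_ge0; [lra | exact: mulr_ge0] | rewrite divr_ge0 ?exprn_ge0].
  apply: ler_wpM2r; first exact: dot_ge0.
  have p4 : 4 ^+ j != 0 :> R by rewrite expf_neq0 // pnatr_eq0.
  rewrite exprS le_eqVlt; apply/orP; left; apply/eqP; field.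
  by [].
apply/ler_addgt0Pr => e e0.
pose x := r0 * dot v v / e.
have x0 : 0 <= x by apply: divr_ge0; [apply: mulr_ge0 => //; exact: dot_ge0 | exact: ltW].
have := archi_boundP x0; set j := Num.Def.archi_bound x => xj.
apply: le_trans (it j v sv) _; rewrite mulrDl lerD2l mulrAC ler_pdivrMr ?exprn_gt0 //.
have : x * e = r0 * dot v v by rewrite /x mulfVK ?gt_eqF.
move=> <-; rewrite mulrC ler_pM2l //; apply: ltW; apply: lt_le_trans xj _.
by rewrite -natrX ler_nat ltnW // ltn_expl.
Qed.
End Bootstrap.

Theorem rip_exists (R : realType) (c n k : nat) : (0 < c)%N -> (0 < k)%N ->
  exists A : 'M[R]_(2 ^ 14 * (c * k + 66 * k + 3), n),
    rip c k A /\ forall i j, A i j ^+ 2 = 1 /\ A i j \is a Num.int.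
Proof.
move=> c0 k0; have [M HM] := @sign_matrix R c n k c0.
set m := (2 ^ 14 * _)%N in M HM *.
exists (\matrix_(i, j) (-1) ^+ M i j); set A := \matrix_(i, j) _.
have A1 i j : A i j ^+ 2 = 1 by rewrite mxE sqrr_sign.
split; last first.
  move=> i j; split=> //; rewrite mxE; case: (M i j); rewrite ?expr0 ?expr1 ?rpredN.
    exact: rpred1.
  exact: rpred1.
move=> S v cS Sk sv.
have E (w : 'cV[R]_n) : dot (A *m w) (A *m w) = quad (fun j => w j 0) M.
  apply: eq_bigr => i _; rewrite -expr2 mxE; congr (_ ^+ 2).
  by apply: eq_bigr => j _; rewrite mxE.
have D (w : 'cV[R]_n) : dot w w = sqn (fun j => w j 0).
  by apply: eq_bigr => i _; rewrite expr2.
apply: le_trans (@bootstrap R n m k A S Sk 16^-1 _ _ v k0 _ sv) _.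
- move=> w sw [p [q [wE pq]]].
  have le i : (p i + q i <= 64 * k)%N by apply: leq_trans pq; rewrite (bigD1 i) //= leq_addr.
  have lp i : (p i < (64 * k).+1)%N by rewrite ltnS; apply: leq_trans (le i); exact: leq_addr.
  have lq i : (q i < (64 * k).+1)%N by rewrite ltnS; apply: leq_trans (le i); exact: leq_addl.
  pose f0 := [ffun i : 'I_n => if i \in S then (Ordinal (lp i), Ordinal (lq i)) else (ord0, ord0)].
  have := HM S f0 cS Sk _ _; rewrite /gbad inE -leNgt.
  have gE : gval R f0 = (fun j => w j 0).
    apply/funext => i; rewrite /gval ffunE; case: ifP => iS /=; first by rewrite wE.
    by rewrite subrr sw // iS.
  rewrite gE E D; apply.
    by apply/forallP => i; apply/implyP => /negbTE iS; rewrite ffunE iS.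
  apply: leq_trans pq; apply: leq_sum => i _; rewrite ffunE.
  by case: ifP.
- by rewrite invr_ge0.
- move=> i j; have := A1 i j; rewrite -real_normK ?num_real // => /eqP.
  by rewrite sqrf_eq1 => /orP[/eqP->|/eqP->] //; lra.
- apply: ler_wpM2r; first exact: dot_ge0.
  have : 0 <= m%:R :> R by [].
  lra.
Qed.

(** * Iterative hard thresholding *)

Section Norm.
Variables (R : realType) (n : nat).
Implicit Types (u v w : 'cV[R]_n) (a : R).

Definition nrm k (u : 'cV[R]_k) : R := Num.sqrt (dot u u).

Lemma nrm_ge0 u : 0 <= nrm u. Proof. exact: sqrtr_ge0. Qed.

Lemma nrm_sqr u : nrm u ^+ 2 = dot u u.
Proof. by rewrite sqr_sqrtr // dot_ge0. Qed.

Lemma nrm_le u (b : R) : 0 <= b -> (nrm u <= b) = (dot u u <= b ^+ 2).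
Proof. by move=> b0; rewrite -nrm_sqr ler_pXn2r ?nnegrE ?nrm_ge0. Qed.

Lemma dot_le u v : `|dot u v| <= nrm u * nrm v.
Proof.
rewrite -(@ler_pXn2r _ 2) ?nnegrE ?mulr_ge0 ?nrm_ge0 //.
by rewrite real_normK ?num_real // exprMn !nrm_sqr CauchySchwarz.
Qed.

Lemma nrmD u v : nrm (u + v) <= nrm u + nrm v.
Proof.
rewrite nrm_le ?addr_ge0 ?nrm_ge0 // !dotE (dotC v u) sqrrD !nrm_sqr.
have := dot_le u v; have := ler_norm (dot u v); move: (nrm u * nrm v) => x.
rewrite mulr2n; lra.
Qed.

Lemma nrmN u : nrm (- u) = nrm u.
Proof. by rewrite /nrm !dotE opprK. Qed.

Lemma nrmBC u v : nrm (u - v) = nrm (v - u).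
Proof. by rewrite -nrmN opprB. Qed.

Definition restr (S : {set 'I_n}) v : 'cV[R]_n := \col_i (if i \in S then v i 0 else 0).

Lemma restr_supp S v : vsupp S (restr S v).
Proof. by move=> i iS; rewrite mxE (negbTE iS). Qed.

Lemma dot_restr S u v : dot (restr S u) v = dot (restr S u) (restr S v).
Proof. by apply: eq_bigr => i _; rewrite !mxE; case: ifP; rewrite ?mul0r. Qed.
End Norm.

Lemma dot_adj (R : realType) m n (A : 'M[R]_(m, n)) u v :
  dot (A *m u) v = dot u (A^T *m v).
Proof.
rewrite /dot; under eq_bigr do rewrite mxE mulr_suml.
rewrite exchange_big /=; apply: eq_bigr => j _; rewrite mxE mulr_sumr.
by apply: eq_bigr => i _; rewrite mxE; ring.
Qed.

Section IHT.
Variables (R : realType) (c m n K1 : nat) (A : 'M[R]_(m, n)) (y : 'cV[R]_m).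
Implicit Types (u v w z : 'cV[R]_n) (S T U : {set 'I_n}).

Definition grad z : 'cV[R]_n := z + m%:R^-1 *: (A^T *m (y - A *m z)).

Definition best_tree v T : Prop :=
  [/\ tree_closed c T, (#|T| <= K1)%N & forall S, tree_closed c S -> (#|S| <= K1)%N ->
    dot (restr S v) (restr S v) <= dot (restr T v) (restr T v)].

(** A relation, because the best subtree need not be unique and the program breaks ties in its own
    way. *)
Inductive iht : nat -> 'cV[R]_n -> {set 'I_n} -> Prop :=
  | iht0 : iht 0 0 set0
  | ihtS k z Z T : iht k z Z -> best_tree (grad z) T -> iht k.+1 (restr T (grad z)) T.

(** The normal equations on [T]. This is the form that orthogonalisation delivers, and it makes
    sense for dependent columns as well. *)
Definition least_squares T w : Prop :=
  vsupp T w /\ forall j, j \in T -> (A^T *m (y - A *m w)) j 0 = 0.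

(** Pythagoras: [w - u] is supported on [T], so its image is orthogonal to the residual of [w]. *)
Lemma least_squares_min T w u : least_squares T w -> vsupp T u ->
  dot (y - A *m w) (y - A *m w) <= dot (y - A *m u) (y - A *m u).
Proof.
move=> [sw ow] su.
have -> : y - A *m u = (y - A *m w) + A *m (w - u).
  by rewrite mulmxBr addrA subrK.
have ex (r a : 'cV[R]_m) : dot (r + a) (r + a) = dot r r + 2 * dot r a + dot a a.
  by rewrite !dotE (dotC a r); ring.
set r := y - A *m w; set a := A *m (w - u).
have ra : dot r a = 0.
  rewrite dotC /a dot_adj /dot big1 // => j _.
  have [jT|jT] := boolP (j \in T); first by rewrite ow // mulr0.
  by rewrite !mxE sw // su // subrr mul0r.
rewrite ex ra; have := dot_ge0 a; lra.
Qed.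

Lemma tree_closed0 : tree_closed c (set0 : {set 'I_n}).
Proof. by apply/tree_closedP => i j _; rewrite inE. Qed.

Lemma tree_closedU S T : tree_closed c S -> tree_closed c T -> tree_closed c (S :|: T).
Proof.
move=> /tree_closedP hS /tree_closedP hT; apply/tree_closedP => i j p.
by rewrite !inE => /orP[/(hS _ _ p)->|/(hT _ _ p)->] //; rewrite orbT.
Qed.

Lemma iht_supp k z T : iht k z T -> [/\ vsupp T z, tree_closed c T & (#|T| <= K1)%N].
Proof.
case=> [|{}k {}z Z {}T _ [cT Tk _]].
  by split; [move=> i _; rewrite mxE | exact: tree_closed0 | rewrite cards0].
by split=> //; exact: restr_supp.
Qed.

Hypothesis m0 : (0 < m)%N.
Hypothesis ripA : rip c (3 * K1) A.
Let s := Num.sqrt (m%:R : R).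

Lemma sgt0 : 0 < s. Proof. by rewrite sqrtr_gt0 ltr0n. Qed.
Lemma ssqr : s ^+ 2 = m%:R. Proof. by rewrite sqr_sqrtr. Qed.

(** [17 / 16] is a rational upper bound for the square root of [1 + 1 / 8]. *)
Lemma rip_upper S v : tree_closed c S -> (#|S| <= 3 * K1)%N -> vsupp S v ->
  nrm (A *m v) <= 17 / 16 * s * nrm v.
Proof.
move=> cS Sk sv; have := ripA cS Sk sv; rewrite ler_norml => /andP[_ h].
rewrite nrm_le; last first.
  by apply: mulr_ge0; rewrite ?nrm_ge0 //; apply: mulr_ge0; [lra | exact: ltW sgt0].
rewrite !exprMn nrm_sqr ssqr.
have : 0 <= m%:R * dot v v by rewrite mulr_ge0 // dot_ge0.
move: (dot v v) (dot _ _) h => a b h; nra.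
Qed.

(** [15 / 14] is a rational upper bound for the inverse square root of [1 - 1 / 8]. *)
Lemma rip_lower S v : tree_closed c S -> (#|S| <= 3 * K1)%N -> vsupp S v ->
  s * nrm v <= 15 / 14 * nrm (A *m v).
Proof.
move=> cS Sk sv; have := ripA cS Sk sv; rewrite ler_norml => /andP[h _].
have p1 : 0 <= s * nrm v by apply: mulr_ge0; [exact: ltW sgt0 | exact: nrm_ge0].
have p2 : 0 <= 15 / 14 * nrm (A *m v) by have := nrm_ge0 (A *m v); lra.
rewrite -(@ler_pXn2r _ 2) // !exprMn !nrm_sqr ssqr.
have : 0 <= dot (A *m v) (A *m v) by exact: dot_ge0.
move: (dot v v) (dot _ _) h => a b h; nra.
Qed.

(** Polarisation of [rip]. The vectors are first rescaled to [nrm v *: u] and [nrm u *: v], which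
    have equal norms; this yields the product of the norms where plain polarisation yields the sum
    of their squares. *)
Lemma rip_bilinear S u v : tree_closed c S -> (#|S| <= 3 * K1)%N ->
  vsupp S u -> vsupp S v ->
  `|dot (A *m u) (A *m v) - m%:R * dot u v| <= 8^-1 * m%:R * (nrm u * nrm v).
Proof.
move=> cS Sk su sv; set B := _ - _; set a := nrm u; set b := nrm v.
have a0 : 0 <= a by exact: nrm_ge0.
have b0 : 0 <= b by exact: nrm_ge0.
have [z|ab0] := eqVneq (a * b) 0.
  have : u = 0 \/ v = 0.
    move/eqP: z; rewrite mulf_eq0 => /orP[/eqP h|/eqP h]; [left|right];
    by apply: dot_eq0; rewrite -nrm_sqr -/a -/b h expr0n.
  by move=> [e|e]; rewrite /B e mulmx0 !dotE mulr0 subrr normr0 z mulr0.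
have ab : 0 < a * b by rewrite lt0r ab0 mulr_ge0.
have h1 := ripA cS Sk (vsuppD (vsuppZ b su) (vsuppZ a sv)).
have h2 := ripA cS Sk (vsuppB (vsuppZ b su) (vsuppZ a sv)).
set Q1 := (X in `|X|) in h1; set Q2 := (X in `|X|) in h2.
have E : a * b * B = 4^-1 * (Q1 - Q2).
  rewrite /Q1 /Q2 /B !(mulmxDr, mulmxBr, mulmxN) -!scalemxAr.
  by rewrite !dotE (dotC (A *m v) (A *m u)) (dotC v u); field.
rewrite -(ler_pM2l ab) -[X in X * `|_|](gtr0_norm ab) -normrM E normrM.
rewrite ger0_norm ?invr_ge0 //.
have h : `|Q1 - Q2| <= 8^-1 * m%:R * (4 * (a * b) ^+ 2).
  apply: le_trans (ler_normB _ _) _; apply: le_trans (lerD h1 h2) _.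
  rewrite -mulrDr; apply: ler_wpM2l; first by rewrite mulr_ge0 // invr_ge0.
  rewrite !dotE (dotC v u) exprMn /a /b !nrm_sqr.
  rewrite le_eqVlt; apply/orP; left; apply/eqP.
  rewrite -[nrm u * _]mulrC; ring: (nrm_sqr u) (nrm_sqr v).
lra.
Qed.

(** On [P], the error [g] of the gradient step is the isometry defect of [z - u], with factor
    [1 / 8], plus noise; thresholding costs a factor 2. The proof works on the union [W] of three
    subtrees with [K1] nodes, whence the [3 * K1] in [ripA]. *)
Lemma iht_step z Z T u U : tree_closed c Z -> (#|Z| <= K1)%N -> vsupp Z z ->
  tree_closed c U -> (#|U| <= K1)%N -> vsupp U u -> best_tree (grad z) T ->
  nrm (restr T (grad z) - u) <=
    4^-1 * nrm (z - u) + 17 / 8 * (nrm (y - A *m u) / s).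
Proof.
move=> cZ Zk sz cU Uk su [cT Tk bT]; set v := grad z; set z' := restr T v.
set P := T :|: U; set g := restr P (v - u).
have sgt := sgt0.
(* By optimality of [T], the energy of [v] on [P] discarded by [T] is at most the energy discarded
   by [U]; as [u] vanishes off [U], the latter is part of the energy of [g]. *)
have near : nrm (restr P v - z') <= nrm g.
  have -> : g = restr P v - u.
    apply/colP => i; rewrite !mxE; case: ifP => // /negbT.
    by rewrite inE negb_or => /andP[_ /su ->]; rewrite subr0.
  rewrite nrm_le ?nrm_ge0 // nrm_sqr.
  apply: (@le_trans _ _ (dot (restr P v) (restr P v) - dot z' z')).
    rewrite -sumrB; apply: ler_sum => i _; rewrite !mxE !inE.
    by case: (i \in T) => /=; case: (i \in U) => /=; rewrite ?subrr ?mulr0 ?subr0 ?mul0r.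
  apply: (@le_trans _ _ (dot (restr P v) (restr P v) - dot (restr U v) (restr U v))).
    by rewrite lerD2l lerN2; exact: bT.
  rewrite -sumrB; apply: ler_sum => i _; rewrite !mxE !inE.
  have [iU|iU] := boolP (i \in U); first by rewrite orbT subrr -expr2 sqr_ge0.
  by rewrite (su i iU) mulr0 !subr0.
have zg : nrm (z' - u) <= 2 * nrm g.
  have -> : z' - u = (z' - restr P v) + g.
    apply/colP => i; rewrite !mxE !inE.
    have [iU|iU] := boolP (i \in U); first by rewrite orbT; ring.
    by rewrite (su i iU) orbF; case: ifP => _; ring.
  apply: le_trans (nrmD _ _) _; rewrite nrmBC; lra.
pose W := P :|: Z.
have cW : tree_closed c W by do 2 apply: tree_closedU => //.
have Wk : (#|W| <= 3 * K1)%N.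
  apply: leq_trans (leq_card_setU _ _) _.
  rewrite mulSn addnC leq_add //; apply: leq_trans (leq_card_setU _ _) _.
  by rewrite mul2n -addnn leq_add.
have sg : vsupp W g by apply: vsuppS (subsetUl _ _) _; exact: restr_supp.
have szu : vsupp W (z - u).
  apply: vsuppB; first by apply: vsuppS sz; exact: subsetUr.
  by apply: vsuppS su; rewrite /W /P setUAC; exact: subsetUr.
set e := y - A *m u.
have gE : dot g g = (dot g (z - u) - m%:R^-1 * dot (A *m g) (A *m (z - u)))
     + m%:R^-1 * dot (A *m g) e.
  have -> : dot g g = dot g (v - u) by rewrite [RHS]dot_restr.
  have -> : v - u = (z - u) + m%:R^-1 *: (A^T *m (y - A *m z)).
    by rewrite /v /grad addrAC.
  have -> : y - A *m z = e - A *m (z - u).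
    by rewrite /e mulmxBr opprB addrA subrK.
  rewrite (dotDr (z - u)) dotZr -dot_adj (dotDr e) dotNr; ring.
have mp : 0 < m%:R :> R by rewrite ltr0n.
have h1 : dot g (z - u) - m%:R^-1 * dot (A *m g) (A *m (z - u)) <= 8^-1 * (nrm g * nrm (z - u)).
  have := rip_bilinear cW Wk sg szu; set B := dot (A *m g) _; set C := dot g _.
  rewrite ler_norml => /andP[hB _].
  rewrite -(ler_pM2l mp) mulrBr mulrA mulfV ?gt_eqF // mul1r.
  lra.
have h2 : m%:R^-1 * dot (A *m g) e <= nrm g * (17 / 16 * (nrm e / s)).
  have := dot_le (A *m g) e; have := ler_norm (dot (A *m g) e).
  have := rip_upper cW Wk sg => b1 b2 b3.
  rewrite mulrC ler_pdivrMr //.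
  have -> : nrm g * (17 / 16 * (nrm e / s)) * m%:R = 17 / 16 * s * nrm g * nrm e.
    by rewrite -ssqr; field; rewrite gt_eqF.
  apply: le_trans b2 _; apply: le_trans b3 _.
  by apply: ler_wpM2r => //; exact: nrm_ge0.
have g0 := nrm_ge0 g.
have hg : nrm g <= 8^-1 * nrm (z - u) + 17 / 16 * (nrm e / s).
  have [gz|gnz] := eqVneq (nrm g) 0.
    have := nrm_ge0 (z - u); have : 0 <= nrm e / s by rewrite divr_ge0 ?nrm_ge0 // ltW.
    by rewrite gz; lra.
  have gp : 0 < nrm g by rewrite lt0r gnz.
  rewrite -(ler_pM2l gp) -expr2 nrm_sqr gE mulrDr; apply: lerD => //.
  by rewrite mulrCA.
lra.
Qed.

(** The factor 3 exceeds the limit [(17 / 8) / (1 - 1 / 4)] of the geometric series. *)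
Lemma iht_error k z T u U : iht k z T ->
  tree_closed c U -> (#|U| <= K1)%N -> vsupp U u ->
  nrm (z - u) <= nrm u / 4 ^+ k + 3 * (nrm (y - A *m u) / s).
Proof.
move=> it cU Uk su.
have e0 : 0 <= nrm (y - A *m u) / s by rewrite divr_ge0 ?nrm_ge0 // ltW // sgt0.
elim: it => [|{}k {}z Z {}T /iht_supp[sz cZ Zk] IH bT].
  rewrite sub0r nrmN expr0 divr1; lra.
apply: le_trans (iht_step cZ Zk sz cU Uk su bT) _.
have -> : nrm u / 4 ^+ k.+1 = 4^-1 * (nrm u / 4 ^+ k).
  by rewrite exprS invfM mulrCA.
lra.
Qed.

(** The test says [nrm y / 4 ^+ N < nrm r / 4]. The error that [N] steps leave is then a fraction of
    the residual itself and can be absorbed in the left side, so the test certifies [r] against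
    every competitor [u] although the size of the tail of the signal is unknown. *)
Lemma iht_stop N z T w u U : iht N z T -> least_squares T w ->
  tree_closed c U -> (#|U| <= K1)%N -> vsupp U u ->
  let r := y - A *m w in
  dot r r = 0 \/ 16 * dot y y < 16 ^+ N * dot r r ->
  nrm r <= 16 * nrm (y - A *m u).
Proof.
move=> it ls cU Uk su r stop; set e := y - A *m u.
have e0 := nrm_ge0 e; have r0 := nrm_ge0 r.
case: stop => [rz|st].
  by rewrite /nrm rz sqrtr0 mulr_ge0 ?nrm_ge0.
have [sz cT Tk] := iht_supp it.
have sgt := sgt0.
have le_r : nrm r <= nrm (y - A *m z).
  by rewrite nrm_le ?nrm_ge0 // nrm_sqr; exact: least_squares_min ls sz.
have cTU := tree_closedU cT cU.
have TUk : (#|T :|: U| <= 3 * K1)%N.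
  by apply: leq_trans (leq_card_setU _ _) _; lia.
have szu : vsupp (T :|: U) (u - z).
  by apply: vsuppB; [apply: vsuppS su; exact: subsetUr | apply: vsuppS sz; exact: subsetUl].
have b1 := rip_upper cTU TUk szu.
have b2 := iht_error it cU Uk su; rewrite nrmBC -/e in b2.
have Uk3 : (#|U| <= 3 * K1)%N by lia.
have b3 := rip_lower cU Uk3 su.
have b4 : nrm (A *m u) <= nrm y + nrm e.
  have -> : A *m u = y - e by rewrite /e opprB addrC subrK.
  by apply: le_trans (nrmD _ _) _; rewrite nrmN.
have b5 : nrm (y - A *m z) <= nrm e + nrm (A *m (u - z)).
  have -> : y - A *m z = e + A *m (u - z) by rewrite mulmxBr /e addrA subrK.
  exact: nrmD.
set q := (4 : R) ^+ N; have q1 : 1 <= q by rewrite exprn_ege1 // ler1n.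
have q0 : 0 < q by lra.
have st2 : 4 * nrm y <= q * nrm r.
  rewrite -(@ler_pXn2r _ 2) ?nnegrE ?mulr_ge0 ?nrm_ge0 // ?(ltW q0) //.
  rewrite !exprMn !nrm_sqr /q -exprM mulnC exprM ltW //.
  by move: st; rewrite (_ : 4 ^+ 2 = 16) //; rewrite expr2; lra.
have b6 : nrm y / q <= nrm r / 4.
  by rewrite ler_pdivrMr //; lra.
have b7 : s * nrm (u - z) <= s * nrm u / q + 3 * nrm e.
  have -> : s * nrm u / q + 3 * nrm e = s * (nrm u / q + 3 * (nrm e / s)).
    by field; rewrite !gt_eqF.
  by rewrite ler_pM2l.
have b8 : s * nrm u / q <= 15 / 14 * (nrm y / q + nrm e).
  rewrite ler_pdivrMr //.
  have -> : 15 / 14 * (nrm y / q + nrm e) * q = 15 / 14 * (nrm y + nrm e * q).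
    by field; rewrite gt_eqF.
  nra.
move: b1; rewrite -mulrA; move: b7 b8 b6 b5 b2 le_r; lra.
Qed.
End IHT.

(** * From least-squares residuals to the l1 guarantee *)

Section L1.
Variables (R : realType) (n : nat).
Implicit Types (u v e : 'cV[R]_n) (S T : {set 'I_n}).

Definition csupp v : {set 'I_n} := [set i | v i 0 != 0].

Lemma csupp_supp v : vsupp (csupp v) v.
Proof. by move=> i; rewrite inE negbK => /eqP. Qed.

Lemma l1norm_ge0 v : 0 <= l1norm v.
Proof. by apply: sumr_ge0. Qed.

Lemma l1normD u v : l1norm (u + v) <= l1norm u + l1norm v.
Proof. by rewrite -big_split; apply: ler_sum => i _; rewrite mxE ler_normD. Qed.

Lemma l1norm_nrm S v : vsupp S v -> l1norm v <= Num.sqrt #|S|%:R * nrm v.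
Proof.
move=> sv.
have -> : l1norm v = dot (\col_i (i \in S)%:R) (\col_i `|v i 0|).
  apply: eq_bigr => i _; rewrite !mxE; case: (boolP (i \in S)) => iS; first by rewrite mul1r.
  by rewrite sv // normr0 mulr0.
apply: le_trans (ler_norm _) _; apply: le_trans (dot_le _ _) _.
rewrite le_eqVlt; apply/orP; left; apply/eqP; congr (_ * _); rewrite /nrm; congr Num.sqrt.
  rewrite -sum1_card natr_sum big_mkcond /=; apply: eq_bigr => i _.
  by rewrite mxE; case: (i \in S); rewrite ?mul1r ?mul0r.
by apply: eq_bigr => i _; rewrite mxE -expr2 real_normK ?num_real // expr2.
Qed.

Lemma nrm_sup S v (M : R) : 0 <= M -> vsupp S v -> (forall i, `|v i 0| <= M) ->
  nrm v <= Num.sqrt #|S|%:R * M.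
Proof.
move=> M0 sv hM; rewrite nrm_le ?mulr_ge0 ?sqrtr_ge0 // exprMn sqr_sqrtr //.
rewrite /dot (bigID (mem S)) /= [X in _ + X]big1 ?addr0; last first.
  by move=> i iS; rewrite sv // mulr0.
rewrite mulr_natl -sumr_const; apply: ler_sum => i _.
by rewrite -expr2 -real_normK ?num_real // ler_pXn2r ?nnegrE.
Qed.

Lemma top_set (f : 'I_n -> R) (X : {set 'I_n}) s : (s <= #|X|)%N ->
  exists T : {set 'I_n}, [/\ T \subset X, #|T| = s &
    forall i j, i \in T -> j \in X -> j \notin T -> f j <= f i].
Proof.
elim: s => [_|s IH sX].
  by exists set0; split; [exact: sub0set | exact: cards0 | move=> i j; rewrite inE].
have [T [TX cT hT]] := IH (ltnW sX).
have /card_gt0P[x0 x0XT] : (0 < #|X :\: T|)%N.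
  by rewrite cardsD (setIidPr TX) cT subn_gt0.
have [x xXT xmax] := @arg_maxP _ R _ x0 [pred x | x \in X :\: T] f x0XT.
move: xXT; rewrite /= inE => /andP[xT xX].
exists (x |: T); split.
- by rewrite subUset TX sub1set xX.
- by rewrite cardsU1 xT cT.
- move=> i j; rewrite !inE negb_or => /orP[/eqP->|iT] jX /andP[jx jT].
    by apply: xmax; rewrite /= inE jT.
  exact: hT.
Qed.

(* Blocks of decreasing magnitude: the l2 norm of a block is controlled by the
   l1 norm of the previous one. *)
Lemma block_bound m (A : 'M[R]_(m, n)) (a : R) s e (M : R) :
  (0 < s)%N -> 0 <= a -> 0 <= M ->
  (forall v, (#|csupp v| <= s)%N -> nrm (A *m v) <= a * nrm v) ->
  (forall i, `|e i 0| <= M) ->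
  nrm (A *m e) <= a * (Num.sqrt s%:R * M + l1norm e / Num.sqrt s%:R).
Proof.
move=> s0 a0 M0 hA; have sp : 0 < Num.sqrt (s%:R : R) by rewrite sqrtr_gt0 ltr0n.
have [k] := ubnP #|csupp e|; elim: k e M M0 => // k IH e M M0; rewrite ltnS => ck hM.
have small v (N : R) : 0 <= N -> (#|csupp v| <= s)%N -> (forall i, `|v i 0| <= N) ->
    nrm (A *m v) <= a * (Num.sqrt s%:R * N).
  move=> N0 cs hv; apply: le_trans (hA _ cs) _; apply: ler_wpM2l => //.
  apply: le_trans (nrm_sup N0 (@csupp_supp v) hv) _; apply: ler_wpM2r => //.
  by rewrite ler_wsqrtr // ler_nat.
have [cs|cs] := leqP #|csupp e| s.
  apply: le_trans (small e M M0 cs hM) _; apply: ler_wpM2l => //.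
  by rewrite lerDl divr_ge0 ?l1norm_ge0 // ltW.
have [T [TX cT hT]] := top_set (fun i => `|e i 0|) (ltnW cs).
have /card_gt0P[x0 x0T] : (0 < #|T|)%N by rewrite cT.
have [x /= xT xmin] := @arg_minP _ R _ x0 [pred x | x \in T] (fun i => `|e i 0|) x0T.
set M' := `|e x 0| in xmin.
pose e1 := restr T e; pose e2 := e - e1.
have e2E i : e2 i 0 = if i \in T then 0 else e i 0.
  by rewrite !mxE; case: ifP; rewrite ?subrr ?subr0.
have h1 : nrm (A *m e1) <= a * (Num.sqrt s%:R * M).
  apply: small => //.
    rewrite -cT; apply: subset_leq_card; apply/subsetP => i; rewrite inE mxE.
    by case: ifP => //; rewrite eqxx.
  by move=> i; rewrite mxE; case: ifP => // _; rewrite normr0.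
have h2 : nrm (A *m e2) <= a * (Num.sqrt s%:R * M' + l1norm e2 / Num.sqrt s%:R).
  apply: IH; first exact: normr_ge0.
    apply: leq_trans ck; apply: proper_card; apply/properP; split.
      apply/subsetP => i; rewrite !inE e2E; case: ifP => //; by rewrite eqxx.
    by exists x; [exact: (subsetP TX) | rewrite inE e2E xT eqxx].
  move=> i; rewrite e2E; case: ifP => [_|/negbT iT]; first by rewrite normr0 normr_ge0.
  have [iX|iX] := boolP (i \in csupp e); first exact: hT.
  by rewrite (csupp_supp iX) normr0 normr_ge0.
have l1E : l1norm e = (\sum_(i in T) `|e i 0|) + l1norm e2.
  rewrite /l1norm (bigID (mem T)) /=; congr (_ + _).
  rewrite [RHS](bigID (mem T)) /= [X in _ = X + _]big1 ?add0r; last first.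
    by move=> i iT; rewrite e2E iT normr0.
  by apply: eq_bigr => i /negbTE iT; rewrite e2E iT.
have sM : Num.sqrt s%:R * M' <= (\sum_(i in T) `|e i 0|) / Num.sqrt s%:R.
  rewrite ler_pdivlMr // mulrAC -expr2 sqr_sqrtr // mulr_natl -cT -sumr_const.
  by apply: ler_sum => i iT; exact: xmin.
have -> : A *m e = A *m e1 + A *m e2 by rewrite -mulmxDr addrC subrK.
apply: le_trans (nrmD _ _) _; apply: le_trans (lerD h1 h2) _.
rewrite -mulrDr; apply: ler_wpM2l => //.
rewrite l1E mulrDl; lra.
Qed.
End L1.

Section Ancestors.
Variables (c n K lam : nat).
Hypotheses (c2 : (2 <= c)%N) (nK : (n < K * 2 ^ lam.+1)%N).

Lemma opar_proof (i : 'I_n) : (i.-1 %/ c < n)%N.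
Proof. by apply: leq_ltn_trans (leq_div _ _) _; apply: leq_ltn_trans (leq_pred _) _. Qed.
Definition opar (i : 'I_n) : 'I_n := Ordinal (opar_proof i).

Lemma tree_parentE (i j : 'I_n) : tree_parent c i j = (0 < j)%N && (opar j == i).
Proof. by []. Qed.

(** Since [c >= 2], the index of a parent is at most half that of its child. *)
Lemma iter_opar j (i : 'I_n) : (iter j opar i * 2 ^ j <= i)%N.
Proof.
elim: j => [|j IH] /=; first by rewrite expn0 muln1.
apply: leq_trans IH; rewrite expnS mulnA leq_mul2r; apply/orP; right.
set x := nat_of_ord (iter j opar i).
apply: (@leq_trans (x.-1 %/ c * c)); first by rewrite leq_mul2l c2 orbT.
by apply: leq_trans (leq_divM _ _) (leq_pred _).
Qed.

(** In breadth-first order the nodes below [K] form a subtree, and by [iter_opar] every node enters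
    it within [lam.+1] steps upwards. Only the first [lam.+1] nodes on the path from each element of
    [H] have to be added. *)
Lemma ancestors_closed (H : {set 'I_n}) : exists U : {set 'I_n},
  [/\ tree_closed c U, H \subset U & (#|U| <= K + #|H| * lam.+1)%N].
Proof.
pose V := [set iter (val p.2) opar p.1 | p in setX H [set: 'I_lam.+1]].
pose L := [set i : 'I_n | (i < K)%N].
exists (L :|: V); split.
- apply/tree_closedP => i j; rewrite tree_parentE => /andP[j0 /eqP <-].
  have par_lt : (opar j < j)%N.
    by rewrite /=; apply: leq_ltn_trans (leq_div _ _) _; rewrite prednK.
  rewrite !inE => /orP[jK|/imsetP[[h q] /= ]]; first by rewrite (ltn_trans par_lt jK).
  rewrite inE => /andP[/= hH _] jE.
  have [ql|ql] := ltnP q.+1 lam.+1.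
    apply/orP; right; apply/imsetP; exists (h, Ordinal ql); first by rewrite !inE hH.
    by rewrite /= jE.
  apply/orP; left.
  have qE : val q = lam by have := ltn_ord q; rewrite /=; lia.
  have := iter_opar lam.+1 h; rewrite /= -qE -jE qE => le.
  have := ltn_ord h => hn; have lt := leq_ltn_trans le (ltn_trans hn nK).
  by rewrite ltn_pmul2r // expn_gt0 in lt.
- apply/subsetP => h hH; rewrite inE; apply/orP; right; apply/imsetP.
  by exists (h, ord0); rewrite ?inE ?hH.
- apply: leq_trans (leq_card_setU _ _) _; apply: leq_add; last first.
    by apply: leq_trans (leq_imset_card _ _) _; rewrite cardsX cardsT card_ord.
  have [Kn|Kn] := leqP n K; first by apply: leq_trans (max_card _) _; rewrite card_ord.
  apply: (@leq_trans #|[set widen_ord (ltnW Kn) j | j : 'I_K]|).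
    apply: subset_leq_card; apply/subsetP => i; rewrite inE => iK.
    by apply/imsetP; exists (Ordinal iK) => //; apply: ord_inj.
  by apply: leq_trans (leq_imset_card _ _) _; rewrite card_ord.
Qed.
End Ancestors.

Lemma lamP (n K : nat) : (0 < K)%N -> (K + K < n)%N ->
  let lam := trunc_log 2 (n %/ K) in
  [/\ (0 < lam)%N, (K * 2 ^ lam <= n)%N & (n < K * 2 ^ lam.+1)%N].
Proof.
move=> K0 Kn lam; have q2 : (2 <= n %/ K)%N by rewrite leq_divRL // mul2n -addnn ltnW.
split; first by rewrite /lam trunc_log_gt0.
  rewrite mulnC -leq_divRL //; apply: trunc_logP => //; lia.
by rewrite mulnC -ltn_divLR //; apply: trunc_log_ltn.
Qed.

(** The passage from binary to natural logarithms uses no more than [expR (1 / 2) <= 2]. *)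
Lemma ln_ge (R : realType) (n K lam : nat) : (0 < K)%N -> (K * 2 ^ lam <= n)%N ->
  lam%:R <= 2 * ln (n%:R / K%:R) :> R.
Proof.
move=> K0 le; have K0' : 0 < K%:R :> R by rewrite ltr0n.
have h : expR (lam%:R / 2) <= n%:R / K%:R :> R.
  rewrite ler_pdivlMr //.
  apply: (@le_trans _ _ (2 ^+ lam * K%:R)); last first.
    by rewrite -natrX -natrM ler_nat mulnC.
  apply: ler_wpM2r; first exact: ltW.
  rewrite expRM_natl; apply: lerXn2r; rewrite ?nnegrE ?expR_ge0 //.
  have := expR_ge1Dx (- 2^-1 : R); rewrite expRN => h.
  have p := @expR_gt0 R 2^-1.
  have : 2^-1 <= (expR 2^-1)^-1 :> R by lra.
  by rewrite lef_pV2 ?posrE.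
have p : 0 < n%:R / K%:R :> R by apply: lt_le_trans h; exact: expR_gt0.
suff : lam%:R / 2 <= ln (n%:R / K%:R) :> R by lra.
by rewrite -(ler_expR (lam%:R / 2)) lnK // posrE.
Qed.

(** * The l1 error bound *)

Section Guarantee.
Variables (R : realType) (c m n K : nat) (A : 'M[R]_(m, n)) (x w : 'cV[R]_n).
Variables (S0 Tw : {set 'I_n}).
Hypotheses (c2 : (2 <= c)%N) (K0 : (0 < K)%N) (Kn : (K + K < n)%N) (m0 : (0 < m)%N).
Hypotheses (ripA : rip c (3 * (3 * K)) A) (A1 : forall i j, A i j ^+ 2 = 1).
Hypotheses (cT : tree_closed c Tw) (Tk : (#|Tw| <= 3 * K)%N) (sw : vsupp Tw w).
Hypothesis near : forall u U, tree_closed c U -> (#|U| <= 3 * K)%N -> vsupp U u ->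
  nrm (A *m x - A *m w) <= 16 * nrm (A *m x - A *m u).
Hypotheses (cS : tree_closed c S0) (Sk : (#|S0| <= K)%N).

Let d : R := \sum_(i | i \notin S0) `|x i 0|.
Let lam := trunc_log 2 (n %/ K).
(** The sparsity at which the ancestor closure of any set has at most [2 * K] nodes. It is 0 when
    [K] is small compared with the logarithm, and [s'] repairs this case. *)
Let s := (K %/ lam.+1)%N.
Let s' := maxn s 1.
Let g := Num.sqrt (m%:R : R).

(** If [s = 0], the vector has at most one nonzero entry, and a column with entries of square 1 has
    norm exactly [g]. Otherwise the support lies in a subtree with [2 * K] nodes, where [ripA]
    applies. *)
Lemma sparse_upper v : (#|csupp v| <= s')%N -> nrm (A *m v) <= 17 / 16 * g * nrm v.
Proof.
move=> cv; have [l0 l1 l2] := lamP K0 Kn; rewrite -/lam in l0 l1 l2.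
have g0 : 0 <= g by exact: sqrtr_ge0.
have g2 : g ^+ 2 = m%:R by rewrite sqr_sqrtr.
have [s0|s0] := posnP s.
  have b0 : 0 <= 17 / 16 * g * nrm v by have := nrm_ge0 v; nra.
  rewrite nrm_le // !exprMn nrm_sqr g2.
  have : (#|csupp v| <= 1)%N by move: cv; rewrite /s' s0.
  move=> /card_le1_eqP h1.
  have [v0|[i vi]] : csupp v = set0 \/ exists i, i \in csupp v.
    by case: (set_0Vmem (csupp v)) => [->|[i ?]]; [left|right; exists i].
    have -> : v = 0 by apply/colP => j; rewrite mxE (csupp_supp (i := j)) // v0 inE.
    by rewrite mulmx0 !dot0l mulr0.
  have vj j : j != i -> v j 0 = 0.
    move=> ji; apply: csupp_supp; apply: contra ji => jv; apply/eqP; exact: h1.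
  have dvv : dot v v = v i 0 ^+ 2.
    by rewrite /dot (bigD1 i) //= big1 ?addr0 ?expr2 // => j ji; rewrite vj // mulr0.
  have -> : dot (A *m v) (A *m v) = m%:R * dot v v.
    rewrite dvv -[X in X%:R]card_ord mulr_natl -sumr_const; apply: eq_bigr => k _.
    rewrite -expr2 mxE (bigD1 i) //= big1 ?addr0 ?exprMn ?A1 ?mul1r // => j ji.
    by rewrite vj // mulr0.
  have : 0 <= m%:R * dot v v by rewrite mulr_ge0 ?dot_ge0.
  lra.
have [U [cU HU Uk]] := ancestors_closed c2 l2 (csupp v).
apply: (rip_upper m0 ripA cU _ (vsuppS HU (@csupp_supp _ _ v))).
apply: leq_trans Uk _.
have : (#|csupp v| * lam.+1 <= K)%N.
  apply: (@leq_trans (s * lam.+1)); last exact: leq_divM.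
  by rewrite leq_mul2r; apply/orP; right; move: cv; rewrite /s'; lia.
lia.
Qed.

(** [K] is below [(s + 1) * (lam + 1)], where [s + 1 <= 2 * s'] and [lam + 1 <= 2 * lam]. *)
Lemma s'K : (K <= 4 * lam * s')%N.
Proof.
have [l0 _ _] := lamP K0 Kn; rewrite -/lam in l0.
have := divn_eq K lam.+1; rewrite -/s; have := ltn_pmod K (ltn0Sn lam).
rewrite /s'; move: (K %% _)%N => r; nia.
Qed.

(** The entries off the best subtree that exceed [d / s], of which there are at most [s]. In this
    product form [H] is empty when [s = 0]. *)
Let H : {set 'I_n} := [set i | (i \notin S0) && (d < s%:R * `|x i 0|)].

Lemma head_card : (#|H| <= s)%N.
Proof.
have d0 : 0 <= d by apply: sumr_ge0.
have [->|H0] := eqVneq H set0; first by rewrite cards0.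
have hd : #|H|%:R * d < s%:R * d.
  apply: (@lt_le_trans _ _ (\sum_(i in H) s%:R * `|x i 0|)).
    rewrite mulr_natl -sumr_const; case/set0Pn: H0 => i iH.
    rewrite (bigD1 i) //= [ltRHS](bigD1 i) //=; apply: ltr_leD.
      by move: iH; rewrite inE => /andP[].
    by apply: ler_sum => j /andP[]; rewrite inE => /andP[_ /ltW].
  rewrite -mulr_sumr; apply: ler_wpM2l => //.
  rewrite /d [leRHS](bigID (mem H)) /=.
  apply: (@le_trans _ _ (\sum_(i | (i \notin S0) && (i \in H)) `|x i 0|)).
    rewrite le_eqVlt; apply/orP; left; apply/eqP; apply: eq_bigl => i.
    by rewrite inE; case: (i \in S0).
  by rewrite lerDl; apply: sumr_ge0.
have [dz|dn] := eqVneq d 0; first by move: hd; rewrite dz !mulr0 ltxx.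
by rewrite ltr_pM2r ?lt0r ?dn // ltr_nat in hd; exact: ltnW.
Qed.

(** The competitor [u] is [x] on the best subtree together with a closure of [H]. Every entry of the
    tail [e] is then at most [d / s'], so that the first block of [block_bound] costs no more than
    the others together. The logarithm is the ratio of the [6 * K] nodes carrying [w - u] to
    [s']. *)
Lemma l1_guarantee : l1norm (x - w) <= 1000 * Num.sqrt (ln (n%:R / K%:R)) * d.
Proof.
have [l0 l1 l2] := lamP K0 Kn; rewrite -/lam in l0 l1 l2.
have d0 : 0 <= d by apply: sumr_ge0.
have Hs : (#|H| <= s)%N := head_card.
have [U' [cU' HU' Uk']] := ancestors_closed c2 l2 H.
pose U := S0 :|: U'.
have cU : tree_closed c U by exact: tree_closedU.
have Uk : (#|U| <= 3 * K)%N.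
  apply: leq_trans (leq_card_setU _ _) _.
  have h1 : (#|H| * lam.+1 <= K)%N.
    by apply: (@leq_trans (s * lam.+1)); [rewrite leq_mul2r Hs orbT | exact: leq_divM].
  apply: (@leq_trans (K + (K + K))); last by lia.
  by rewrite leq_add //; apply: leq_trans Uk' _; rewrite leq_add2l.
pose u := restr U x; pose e := x - u.
have eE i : e i 0 = if i \in U then 0 else x i 0.
  by rewrite !mxE; case: ifP; rewrite ?subrr ?subr0.
have l1e : l1norm e <= d.
  rewrite /d big_mkcond /=; apply: ler_sum => i _; rewrite eE /U inE.
  by case: (i \in S0) => //=; case: (i \in U') => //=; rewrite normr0.
have s'0 : (0 < s')%N by rewrite leq_max orbT.
have s'p : 0 < s'%:R :> R by rewrite ltr0n.
have eM i : `|e i 0| <= d / s'%:R.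
  rewrite eE; case: ifP => [_|]; first by rewrite normr0 divr_ge0.
  rewrite /U inE => /negbT; rewrite negb_or => /andP[iS iU'].
  have iH : i \notin H by apply: contra iU'; exact: (subsetP HU').
  rewrite ler_pdivlMr //; have [s0|s0] := posnP s.
    rewrite /s' s0 mulr1 /d (bigD1 i) //= lerDl; by apply: sumr_ge0.
  have -> : s' = s by apply/maxn_idPl.
  by move: iH; rewrite inE iS /= -leNgt mulrC.
set q := Num.sqrt (s'%:R : R).
have q0 : 0 < q by rewrite sqrtr_gt0.
have q2 : q ^+ 2 = s'%:R by rewrite sqr_sqrtr.
have g0 : 0 < g by rewrite sqrtr_gt0 ltr0n.
have Ae : nrm (A *m e) <= 17 / 16 * g * (2 * (d / q)).
  have a0 : 0 <= 17 / 16 * g by lra.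
  have M0 : 0 <= d / s'%:R by rewrite divr_ge0.
  apply: le_trans (block_bound s'0 a0 M0 sparse_upper eM) _.
  apply: ler_wpM2l => //; rewrite -/q -q2.
  have -> : q * (d / q ^+ 2) = d / q by field; rewrite gt_eqF.
  have : l1norm e / q <= d / q by rewrite ler_pM2r // invr_gt0.
  lra.
have AxE : A *m x - A *m u = A *m e by rewrite -mulmxBr.
have nr := near cU Uk (@restr_supp _ _ U x); rewrite -/u AxE in nr.
have Awu : nrm (A *m (w - u)) <= 17 * nrm (A *m e).
  have -> : A *m (w - u) = A *m e - (A *m x - A *m w).
    by rewrite -!mulmxBr; congr (A *m _); apply/colP => i; rewrite /e !mxE; ring.
  apply: le_trans (nrmD _ _) _; rewrite nrmN; lra.
have cTU := tree_closedU cT cU.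
have TUk : (#|Tw :|: U| <= 6 * K)%N.
  by apply: leq_trans (leq_card_setU _ _) _; rewrite -[6%N]/(3 + 3)%N mulnDl leq_add.
have swu : vsupp (Tw :|: U) (w - u).
  by apply: vsuppB; [apply: vsuppS sw; exact: subsetUl | apply: vsuppS (@restr_supp _ _ U x); exact: subsetUr].
have TUk9 : (#|Tw :|: U| <= 3 * (3 * K))%N by apply: leq_trans TUk _; rewrite mulnA leq_mul2r orbT.
have low := rip_lower m0 ripA cTU TUk9 swu; rewrite -/g in low.
(* 40 exceeds [15 / 14 * 17 * (17 / 8)]. *)
have wu2 : nrm (w - u) <= 40 * (d / q).
  rewrite -(ler_pM2l g0).
  have dq : 0 <= d / q by rewrite divr_ge0 // ltW.
  have : 0 <= g * (d / q) by rewrite mulr_ge0 // ltW.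
  move: low Awu Ae; have -> : 17 / 16 * g * (2 * (d / q)) = 17 / 8 * (g * (d / q)) by field; rewrite gt_eqF.
  lra.
set t := Num.sqrt (ln (n%:R / K%:R) : R).
have lnl := @ln_ge R n K lam K0 l1.
have lam1 : 1 <= lam%:R :> R by rewrite ler1n.
have t2 : t ^+ 2 = ln (n%:R / K%:R) by rewrite sqr_sqrtr //; lra.
have t0 : 0 <= t by exact: sqrtr_ge0.
have wu1 : l1norm (w - u) <= 280 * t * d.
  apply: le_trans (l1norm_nrm swu) _.
  apply: (@le_trans _ _ (Num.sqrt (6 * K)%:R * (40 * (d / q)))).
    apply: ler_pM; rewrite ?sqrtr_ge0 ?nrm_ge0 //.
    by rewrite ler_wsqrtr // ler_nat.
  (* Squared, [49] has to beat [6 * 4 * 2], the factors 4 and 2 coming from [s'K] and [ln_ge]. *)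
  have h : Num.sqrt (6 * K)%:R <= 7 * t * q :> R.
    have b0 : 0 <= 7 * t * q by rewrite !mulr_ge0 // ltW.
    rewrite -(@ler_pXn2r _ 2) ?nnegrE ?sqrtr_ge0 //.
    rewrite sqr_sqrtr // !exprMn t2 q2 natrM.
    have : K%:R <= 4 * lam%:R * s'%:R :> R by rewrite -!natrM ler_nat; exact: s'K.
    have : lam%:R * s'%:R <= 2 * ln (n%:R / K%:R) * s'%:R :> R by rewrite ler_wpM2r.
    have : 0 <= lam%:R * s'%:R :> R by rewrite mulr_ge0.
    move: (ln _) => a; lra.
  apply: (@le_trans _ _ (7 * t * q * (40 * (d / q)))).
    by apply: ler_wpM2r => //; rewrite mulr_ge0 // divr_ge0 // ltW.
  by rewrite le_eqVlt; apply/orP; left; apply/eqP; field; rewrite gt_eqF.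
have t1 : 1 <= 2 * t.
  rewrite -(@ler_pXn2r _ 2) ?nnegrE ?mulr_ge0 // exprMn t2 expr1n; lra.
have -> : x - w = e + (u - w) by rewrite /e addrA subrK.
apply: le_trans (l1normD _ _) _.
have -> : l1norm (u - w) = l1norm (w - u).
  by apply: eq_bigr => i _; rewrite !mxE distrC.
have : 1 * d <= 2 * t * d by rewrite ler_wpM2r.
move: l1e wu1; move: (l1norm e) (l1norm _) => a b; lra.
Qed.
End Guarantee.

(** * Residual gaps *)

Section Gap.
Variables (R : realType) (m n : nat) (A : 'M[R]_(m, n)) (y : 'cV[R]_m).

Let rr (w : 'cV[R]_n) := dot (y - A *m w) (y - A *m w).

(* All least-squares solutions on T have the same residual, so that only
   finitely many residuals occur. *)
Lemma residual_gap : exists2 ep : R, 0 < ep &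
  forall T w, least_squares A y T w -> rr w = 0 \/ ep <= rr w.
Proof.
have H (T : {set 'I_n}) : exists ep : R, 0 < ep /\
    forall w, least_squares A y T w -> rr w = 0 \/ ep <= rr w.
  have [[w [lw nz]]|no] := pselect (exists w, least_squares A y T w /\ rr w != 0).
    exists (rr w); split; first by rewrite lt0r nz dot_ge0.
    move=> w' lw'; right; apply: least_squares_min lw _; exact: lw'.1.
  exists 1; split=> // w lw; left; apply/eqP; apply: contrapT => nz.
  by apply: no; exists w; split=> //; apply/negP.
have [f Hf] := fin_all_exists H.
(* A positive number below every [f T]; the summand 1 makes the sum positive. *)
exists (1 + \sum_T (f T)^-1)^-1.
  by rewrite invr_gt0 ltr_pwDl // sumr_ge0 // => T _; rewrite invr_ge0 ltW //; case: (Hf T).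
move=> T w lw; have [fp /(_ w lw)[->|h]] := Hf T; [by left|right].
apply: le_trans h; rewrite -[leRHS]invrK lef_pV2 ?posrE ?invr_gt0 //; last first.
  by rewrite ltr_pwDl // sumr_ge0 // => T' _; rewrite invr_ge0 ltW //; case: (Hf T').
rewrite (bigD1 T) //= addrA [leRHS]addrAC lerDr addr_ge0 // sumr_ge0 // => T' _.
by rewrite invr_ge0 ltW //; case: (Hf T').
Qed.

Lemma det_int k (G : 'M[R]_k) : (forall i j, G i j \is a Num.int) -> \det G \is a Num.int.
Proof.
move=> hG; apply: rpred_sum => s _; apply: rpredM; last by apply: rpred_prod.
by case: (odd_perm s); rewrite ?expr0 ?expr1 ?rpredN rpred1.
Qed.

Lemma det_bound k (G : 'M[R]_k) (b : nat) : (forall i j, `|G i j| <= b%:R) ->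
  `|\det G| <= ((k * b) ^ k)%:R.
Proof.
move=> hG; apply: le_trans (ler_norm_sum _ _ _) _.
apply: (@le_trans _ _ (\sum_(s : 'S_k) ((b ^ k)%:R : R))).
  apply: ler_sum => s _; rewrite normrM normr_sign mul1r normr_prod natrX.
  rewrite -[X in _ ^+ X]card_ord -prodr_const; apply: ler_prod => i _.
  by rewrite normr_ge0 hG.
rewrite sumr_const -[leLHS]mulr_natr -natrM ler_nat card_Sn.
rewrite expnMn mulnC leq_mul2r; apply/orP; right.
elim: k {hG G} => // k IH; rewrite factS expnS leq_mul2l /=.
by apply: leq_trans IH _; case: k => // k; rewrite leq_exp2r.
Qed.
End Gap.

(** Cramer's rule. Let [D] be the Gram determinant of the columns in [T]. Then [D *: r] has integer
    entries, so a nonzero [dot r r] is at least the inverse of [D ^+ 2], and the Leibniz formula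
    bounds [D]. *)
Lemma residual_gap_int (R : realType) (c m n K1 : nat) (A : 'M[R]_(m, n)) (y : 'cV[R]_m) T w :
  (0 < m)%N -> (0 < K1)%N -> rip c K1 A ->
  (forall i j, A i j ^+ 2 = 1 /\ A i j \is a Num.int) ->
  (forall i, y i 0 \is a Num.int) ->
  tree_closed c T -> (#|T| <= K1)%N -> least_squares A y T w ->
  let r := y - A *m w in
  dot r r = 0 \/ 1 <= ((K1 * m) ^ K1)%:R ^+ 2 * dot r r.
Proof.
move=> m0 K0 ripA A1 yi cT Tk [sw ow] r.
set k := #|T|.
pose B : 'M[R]_(m, k) := \matrix_(i, l) A i (enum_val l).
pose wT : 'cV[R]_k := \col_l w (enum_val l) 0.
have sumT (F : 'I_n -> R) : (forall i, i \notin T -> F i = 0) ->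
    \sum_i F i = \sum_(l < k) F (enum_val l).
  move=> F0; rewrite -(big_enum_val (fun i => F i)) (bigID (mem T)) /=.
  by rewrite [X in _ + X]big1 ?addr0.
have AB : A *m w = B *m wT.
  apply/colP => i; rewrite !mxE sumT; last by move=> j jT; rewrite sw // mulr0.
  by apply: eq_bigr => l _; rewrite !mxE.
have Br : B^T *m r = 0.
  apply/colP => l; have := ow (enum_val l) (enum_valP l); rewrite !mxE => h.
  by rewrite -[RHS]h; apply: eq_bigr => i _; rewrite !mxE.
pose G := B^T *m B.
have GE : G *m wT = B^T *m y.
  by apply/eqP; rewrite -subr_eq0 -mulmxA -AB -mulmxBr -opprB mulmxN oppr_eq0; apply/eqP.
have Bi i l : B i l \is a Num.int by rewrite mxE; have [] := A1 i (enum_val l).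
have mul_int p q (X : 'M[R]_(p, k)) (Y : 'M[R]_(k, q)) :
    (forall i j, X i j \is a Num.int) -> (forall i j, Y i j \is a Num.int) ->
    forall i j, (X *m Y) i j \is a Num.int.
  by move=> hX hY i j; rewrite mxE; apply: rpred_sum => l _; apply: rpredM.
have Gi i j : G i j \is a Num.int.
  by rewrite mxE; apply: rpred_sum => l _; apply: rpredM; [rewrite mxE|]; exact: Bi.
have byi i j : (B^T *m y) i j \is a Num.int.
  rewrite mxE; apply: rpred_sum => l _; apply: rpredM; last by rewrite ord1.
  by rewrite !mxE; have [] := A1 l (enum_val i).
set D := \det G.
have Di : D \is a Num.int by exact: det_int.
(* A kernel vector of the Gram matrix would give a nonzero vector on [T] with image 0, against
   [ripA]. *)
have Dn : D != 0.
  apply/negP => /det0P[v vn vG].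
  pose u : 'cV[R]_n := \col_i \sum_(l < k) v 0 l * (i == enum_val l)%:R.
  have ul l : u (enum_val l) 0 = v 0 l.
    rewrite mxE (bigD1 l) //= eqxx mulr1 big1 ?addr0 // => l' ll'.
    by rewrite (inj_eq enum_val_inj) eq_sym (negbTE ll') mulr0.
  have su : vsupp T u.
    move=> i iT; rewrite mxE big1 // => l _; case: eqP => [e|_]; last by rewrite mulr0.
    by move: iT; rewrite e enum_valP.
  have Au : A *m u = B *m v^T.
    apply/colP => i; rewrite !mxE sumT; last by move=> j jT; rewrite su // mulr0.
    by apply: eq_bigr => l _; rewrite ul !mxE.
  have : dot (A *m u) (A *m u) = 0.
    rewrite Au dot_adj mulmxA.
    have -> : B^T *m B *m v^T = 0.
      apply: trmx_inj; rewrite !trmx_mul !trmxK trmx0 -/G.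
      by rewrite -vG /G.
    by rewrite dot0r.
  move=> Au0; have := ripA T u cT Tk su; rewrite Au0 sub0r normrN.
  have mp : 0 < m%:R :> R by rewrite ltr0n.
  rewrite ger0_norm ?mulr_ge0 ?dot_ge0 // => le.
  have uu : dot u u = 0.
    by apply/eqP; rewrite eq_le dot_ge0 andbT; have := dot_ge0 u; nra.
  move/eqP: vn; apply; apply/rowP => l; rewrite mxE -ul (dot_eq0 uu) mxE //.
have DwT : D *: wT = \adj G *m (B^T *m y).
  by rewrite -GE mulmxA mul_adj_mx mul_scalar_mx.
have Dri i : (D *: r) i 0 \is a Num.int.
  have -> : D *: r = D *: y - B *m (D *: wT).
    by rewrite /r AB scalerBr -scalemxAr.
  rewrite !mxE; apply: rpredB; first exact: rpredM.
  apply: rpred_sum => l _; apply: rpredM => //; rewrite DwT.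
  apply: mul_int => // a b; rewrite mxE /cofactor; apply: rpredM.
    by apply: rpredX; rewrite rpredN rpred1.
  by apply: det_int => a' b'; rewrite mxE mxE; exact: Gi.
have [rz|rn] := eqVneq (dot r r) 0; [by left|right].
have Drr : dot (D *: r) (D *: r) = D ^+ 2 * dot r r by rewrite dotZl dotZr; ring.
have : 1 <= `|dot (D *: r) (D *: r)|.
  apply: norm_intr_ge1; first by apply: rpred_sum => i _; apply: rpredM.
  by rewrite Drr mulf_neq0 // expf_neq0.
rewrite ger0_norm ?dot_ge0 // Drr => /le_trans; apply.
apply: ler_wpM2r; first exact: dot_ge0.
rewrite -real_normK ?num_real //.
have Gb i j : `|G i j| <= m%:R.
  rewrite mxE; apply: le_trans (ler_norm_sum _ _ _) _.
  rewrite -[X in _ <= X%:R]card_ord -sumr_const; apply: ler_sum => l _.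
  rewrite normrM !mxE.
  have n1 a : `|A l a| = 1.
    apply/eqP; rewrite -(@eqrXn2 _ 2) ?normr_ge0 // expr1n -normrX.
    by have [-> _] := A1 l a; rewrite normr1.
  by rewrite !n1 mulr1.
have le1 : `|D| <= ((K1 * m) ^ K1)%:R.
  apply: le_trans (det_bound Gb) _; rewrite ler_nat.
  apply: (@leq_trans ((K1 * m) ^ k)).
    have [k0|k0] := posnP k; first by rewrite k0 !expn0.
    by rewrite leq_exp2r // leq_mul2r Tk orbT.
  by rewrite leq_pexp2l // muln_gt0 K0.
by rewrite ler_pXn2r ?nnegrE.
Qed.

(** * Preorder numbering *)

Section Preorder.
Variables (c l : nat).
Hypothesis c2 : (2 <= c)%N.

Fixpoint geo (h : nat) : nat := if h is h'.+1 then (1 + c * geo h')%N else 0%N.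

Lemma geoE h : geo h = ((c ^ h - 1) %/ (c - 1))%N.
Proof.
have e : (geo h * (c - 1) + 1 = c ^ h)%N.
  elim: h => [|h IH] /=; first by rewrite expn0.
  rewrite expnS -IH; nia.
by rewrite -e addnK mulnK //; lia.
Qed.

Let n := geo l.

(* Position of node i in preorder, and size of its subtree. *)
Fixpoint possz (f i : nat) : nat * nat :=
  if f is f'.+1 then
    if i is i'.+1 then
      let ps := possz f' (i' %/ c) in
      (ps.1 + 1 + (i' - c * (i' %/ c)) * ((ps.2 - 1) %/ c), (ps.2 - 1) %/ c)%N
    else (0%N, n)
  else (0%N, n).

Definition pos i := (possz i i).1.
Definition tsz i := (possz i i).2.

Lemma possz_fuel f i : (i <= f)%N -> possz f i = possz i i.
Proof.
elim/ltn_ind: f i => -[|f] IH [|i] //= le.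
rewrite (IH f) //; last by apply: leq_trans (leq_div _ _) _.
by rewrite (IH i _ (i %/ c)%N) //; exact: leq_div.
Qed.

Lemma pos0 : pos 0 = 0%N. Proof. by []. Qed.
Lemma tsz0 : tsz 0 = n. Proof. by []. Qed.

Lemma tszS i : tsz i.+1 = ((tsz (i %/ c) - 1) %/ c)%N.
Proof. by rewrite /tsz /= possz_fuel // leq_div. Qed.

Lemma posS i : pos i.+1 = (pos (i %/ c) + 1 + (i - c * (i %/ c)) * tsz i.+1)%N.
Proof. by rewrite tszS /pos /tsz /= possz_fuel // leq_div. Qed.

(** A subtree with [h.+1] levels hangs at level [l - h.+1], whose first index is [geo (l - h.+1)].
    Keeping track of this bound shows that a node with a child in range is not a leaf, so that
    dividing its size by [c] stays exact. *)
Lemma tsz_geo i : (i < n)%N -> exists2 h, tsz i = geo h.+1 & (geo (l - h.+1) <= i)%N /\ (h < l)%N.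
Proof.
elim/ltn_ind: i => -[|i] IH lt.
  rewrite tsz0 /n; move: lt; rewrite /n; case: (l) => // l' _; exists l' => //.
  by rewrite subnn.
have pl : (i %/ c < i.+1)%N by rewrite ltnS leq_div.
have [h hE [gi hl]] := IH _ pl (ltn_trans pl lt).
have gp : (geo (l - h) <= i.+1)%N.
  have -> : (l - h = (l - h.+1).+1)%N by lia.
  rewrite /= add1n ltnS mulnC; apply: leq_trans (leq_divM i c).
  by rewrite leq_mul2r gi orbT.
have h0 : (0 < h)%N.
  case: (posnP h) => // hz; move: gp; rewrite hz subn0 -/n; lia.
exists h.-1; rewrite prednK //; last by split=> //; lia.
by rewrite tszS hE /= add1n subn1 /= mulKn //; lia.
Qed.

Lemma tsz_gt0 i : (i < n)%N -> (0 < tsz i)%N.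
Proof. by move=> /tsz_geo[h -> _]. Qed.

Lemma pos_child i : (i.+1 < n)%N ->
  (pos (i %/ c) < pos i.+1)%N /\
  (pos i.+1 + tsz i.+1 <= pos (i %/ c) + tsz (i %/ c))%N.
Proof.
move=> lt; have pl : (i %/ c < n)%N by apply: leq_ltn_trans (leq_div _ _) (ltnW lt).
have t0 := tsz_gt0 pl; rewrite posS tszS; set p := (i %/ c)%N in t0 *.
set z := ((tsz p - 1) %/ c)%N.
have h1 : (z * c <= tsz p - 1)%N by exact: leq_divM.
have h2 : (i - c * p < c)%N.
  by rewrite /p mulnC {1}(divn_eq i c) addKn ltn_mod; lia.
split; first by lia.
have : ((i - c * p).+1 * z <= z * c)%N by rewrite mulnC leq_mul2l h2 orbT.
rewrite mulSn; move: ((i - c * p) * z)%N (z * c)%N h1 => u w; lia.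
Qed.

Definition tpar i := (i.-1 %/ c)%N.

Lemma tpar_lt i : (0 < i)%N -> (tpar i < i)%N.
Proof. by case: i => // i _; rewrite /tpar /= ltnS leq_div. Qed.

Inductive anc (p : nat) : nat -> Prop :=
  | anc_refl : anc p p
  | anc_step i : (0 < i)%N -> anc p (tpar i) -> anc p i.

Lemma anc_le p i : anc p i -> (p <= i)%N.
Proof.
elim=> // j j0 _ le; apply: ltnW; apply: leq_ltn_trans le _; exact: tpar_lt.
Qed.

Lemma anc_pos p i : anc p i -> (i < n)%N ->
  (pos p <= pos i)%N /\ (pos i + tsz i <= pos p + tsz p)%N /\ (i <> p -> (pos p < pos i)%N).
Proof.
elim=> [//|j j0 _ IH jn].
case: j j0 IH jn => // j _ IH jn.
have jp : (j %/ c < n)%N by apply: leq_ltn_trans (leq_div _ _) (ltnW jn).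
have [h1 [h2 _]] := IH jp; rewrite /tpar /= in h1 h2.
have [g1 g2] := pos_child jn; split; [lia|split; [lia|]] => _; lia.
Qed.

Definition disj p i := (pos p + tsz p <= pos i)%N \/ (pos i + tsz i <= pos p)%N.

(* Two subtrees are disjoint or nested: going up from the larger index, the only
   new case is that of two children of the same node. *)
Lemma laminar p i : (p < n)%N -> (i < n)%N -> [\/ disj p i, anc p i | anc i p].
Proof.
have [k] := ubnP (p + i); elim: k p i => // k IH p i; rewrite ltnS => le pn iN.
wlog pi : p i le pn iN / (p <= i)%N.
  move=> H; case: (leqP p i) => [|/ltnW] h; first exact: H.
  case: (H i p) => //; first by rewrite addnC.
  - by move=> [d|d]; constructor 1; [right|left].
  - by constructor 3.
  - by constructor 2.
case: (eqVneq p i) => [->|pni]; first by constructor 2; constructor.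
case: i le iN pi pni => [|i] le iN pi pni; first by move: pi pni; rewrite leqn0 => ->.
have qn : (i %/ c < n)%N by apply: leq_ltn_trans (leq_div _ _) (ltnW iN).
have [g1 g2] := pos_child iN.
have lt : (p + i %/ c < k)%N by have := leq_div i c; lia.
case: (IH p (i %/ c)%N lt pn qn) => [[d|d]|a|a].
- by constructor 1; left; lia.
- by constructor 1; right; lia.
- by constructor 2; constructor.
- have pi' : (p < i.+1)%N by rewrite ltn_neqAle pni.
  case: a le pn pi pni lt pi' => [_ _ _ _ _ _|{}p p0 a le pn pi pni lt pi'].
    by constructor 2; constructor => //; constructor.
  case: p p0 a le pn pi pni lt pi' => // p _ a le pn pi pni lt pi'.
  have aq := anc_le a; rewrite /tpar /= in a aq.
  have pq : (p %/ c <= i %/ c)%N by apply: leq_div2r; lia.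
  have e : (p %/ c = i %/ c)%N by lia.
  constructor 1; left; rewrite !posS !tszS e.
  have h : (p - c * (i %/ c) < i - c * (i %/ c))%N.
    have := leq_divM p c; rewrite e mulnC; lia.
  have : ((p - c * (i %/ c)).+1 * ((tsz (i %/ c) - 1) %/ c) <=
          (i - c * (i %/ c)) * ((tsz (i %/ c) - 1) %/ c))%N by rewrite leq_mul2r h orbT.
  by rewrite mulSn; move: ((p - _) * _)%N ((i - _) * _)%N => u w; lia.
Qed.

Lemma pos_inside p i : (p < n)%N -> (i < n)%N ->
  (pos p <= pos i < pos p + tsz p)%N -> anc p i.
Proof.
move=> pn iN /andP[h1 h2]; have ti := tsz_gt0 iN; have tp := tsz_gt0 pn.
case: (laminar pn iN) => // [[d|d]|a]; [lia|lia|].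
have [_ [_ h]] := anc_pos a pn.
case: (eqVneq p i) => [->|/eqP ne]; [by constructor | by have := h ne; lia].
Qed.

Lemma pos_inj i j : (i < n)%N -> (j < n)%N -> pos i = pos j -> i = j.
Proof.
move=> iN jN e; have ti := tsz_gt0 iN.
have a : anc i j by apply: pos_inside => //; rewrite e leqnn /=; lia.
have [_ [_ h]] := anc_pos a jN.
by case: (eqVneq j i) => [->//|/eqP /h]; lia.
Qed.

Lemma anc0 i : anc 0 i.
Proof.
elim/ltn_ind: i => -[|i] IH; first by constructor.
by constructor => //; apply: IH; exact: tpar_lt.
Qed.

Lemma pos_lt i : (i < n)%N -> (pos i + tsz i <= n)%N /\ (pos i < n)%N.
Proof.
move=> iN; have [_ [h _]] := anc_pos (anc0 i) iN.
have := tsz_gt0 iN; rewrite pos0 tsz0 in h; lia.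
Qed.

Definition nord t := find (fun i => pos i == t) (iota 0 n).

(** [pos] is an injection of the [n] nodes into the [n] positions, hence a bijection. *)
Lemma nordP t : (t < n)%N -> (nord t < n)%N /\ pos (nord t) = t.
Proof.
move=> tn; pose f (i : 'I_n) : 'I_n := Ordinal (proj2 (pos_lt (ltn_ord i))).
have fi : injective f by move=> i j [/pos_inj e]; apply: ord_inj; apply: e.
have h : has (fun i => pos i == t) (iota 0 n).
  apply/hasP; exists (nat_of_ord (invF fi (Ordinal tn))).
    by rewrite mem_iota add0n ltn_ord.
  by have := f_invF fi (Ordinal tn) => /(congr1 (@nat_of_ord n)) /= ->.
have lt : (nord t < n)%N by move: h; rewrite has_find size_iota.
split=> //; have /eqP := nth_find 0%N h; rewrite -/(nord t) nth_iota //.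
Qed.

Lemma nord_pos i : (i < n)%N -> nord (pos i) = i.
Proof.
move=> iN; have [_ h] := pos_lt iN; have [h1 h2] := nordP h.
exact: pos_inj.
Qed.

Definition psz t := tsz (nord t).

Lemma psz_pos i : (i < n)%N -> psz (pos i) = tsz i.
Proof. by move=> iN; rewrite /psz nord_pos. Qed.

Lemma psz_gt0 t : (t < n)%N -> (0 < psz t)%N.
Proof. by move=> tn; have [h _] := nordP tn; exact: tsz_gt0. Qed.

Lemma psz_le t : (t < n)%N -> (t + psz t <= n)%N.
Proof. by move=> tn; have [h e] := nordP tn; have [] := pos_lt h; rewrite e. Qed.

Lemma psz_nested t t' : (t < n)%N -> (t <= t' < t + psz t)%N ->
  (t' + psz t' <= t + psz t)%N.
Proof.
move=> tn h; have t'n : (t' < n)%N by have := psz_le tn; lia.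
have [a ea] := nordP tn; have [b eb] := nordP t'n.
have an : anc (nord t) (nord t').
  by apply: pos_inside => //; rewrite ea eb.
by have [_ [g _]] := anc_pos an b; rewrite ea eb in g.
Qed.

Lemma pos_parent i : (0 < i)%N -> (i < n)%N ->
  (pos (tpar i) < pos i < pos (tpar i) + tsz (tpar i))%N.
Proof.
case: i => // i _ iN; have [h1 h2] := pos_child iN; have := tsz_gt0 iN.
rewrite /tpar /=; lia.
Qed.

Lemma closed_anc (S : {set 'I_n}) : tree_closed c S ->
  forall p i : 'I_n, anc p i -> i \in S -> p \in S.
Proof.
move=> /tree_closedP cS p i.
suff H k : anc p k -> forall j : 'I_n, k = j -> j \in S -> p \in S by move=> a; exact: (H i a).
elim=> [j e|j j0 _ IH i' e iS]; first by rewrite (_ : p = j) //; apply: ord_inj.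
have pn : (tpar j < n)%N by apply: ltn_trans (tpar_lt j0) _; rewrite e.
apply: (IH (Ordinal pn)) => //; apply: cS iS.
by rewrite /tree_parent -e j0 /= eqxx.
Qed.

(** The descendants of the node at position [t] fill the interval of length [psz t] from [t] on.
    Rejecting a node therefore means jumping to [t + psz t], the second branch of the dynamic
    program. *)
Lemma closed_skip (S : {set 'I_n}) t (i j : 'I_n) : tree_closed c S ->
  pos i = t -> i \notin S -> (t <= pos j < t + psz t)%N -> j \notin S.
Proof.
move=> cS et iS h; apply: contra iS => jS.
apply: closed_anc jS => //; apply: pos_inside => //.
by rewrite et; move: h; rewrite -et psz_pos.
Qed.
End Preorder.

(** * Exact projection onto subtrees by dynamic programming *)

Section DP.
Variables (R : realType) (c l K1 : nat) (v : nat -> R) (F : nat -> nat -> R).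
Hypotheses (c2 : (2 <= c)%N) (K10 : (0 < K1)%N) (v0 : forall i, 0 <= v i).
Let n := geo c l.
Let po := pos c l.
Let ps := psz c l.
Let no := nord c l.
(** [F t k] is the best weight of at most [k] nodes at positions from [t] on. It is kept abstract
    because it will be the content of the memory, known only through this recurrence. *)
Hypothesis Fn : forall k, (k <= K1)%N -> F n k = 0.
Hypothesis F0 : forall t, (t < n)%N -> F t 0 = 0.
Hypothesis FS : forall t k, (t < n)%N -> (k < K1)%N ->
  F t k.+1 = if F (t + ps t) k.+1 < v (no t) + F t.+1 k then v (no t) + F t.+1 k
             else F (t + ps t) k.+1.

Lemma dp_upper (S : {set 'I_n}) t k : tree_closed c S -> (t <= n)%N -> (k <= K1)%N ->
  (#|[set i in S | (t <= po i)%N]| <= k)%N ->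
  \sum_(i in S | (t <= po i)%N) v i <= F t k.
Proof.
move=> cS; have [j] := ubnP (n - t); elim: j t k => // j IH t k; rewrite ltnS => le tn kK ck.
move: tn; rewrite leq_eqVlt => /orP[/eqP tn|tn].
  rewrite tn Fn // big1 // => i /andP[_ h].
  by have [_ lt] := pos_lt c2 (ltn_ord i); move: h; rewrite /po leqNgt lt.
have [on pt] := nordP c2 tn; rewrite -/no in on pt; pose i := Ordinal on.
have sp := psz_gt0 c2 tn; have sl := psz_le c2 tn; rewrite -/ps in sp sl.
case: k kK ck => [|k] kK ck.
  rewrite F0 // big1 // => i' h'; move: ck; rewrite leqn0 cards_eq0 => /eqP/setP/(_ i').
  by rewrite !inE h'.
rewrite FS //; have [iS|iS] := boolP (i \in S); last first.
  have E (i' : 'I_n) : i' \in S -> (t <= po i')%N = (t + ps t <= po i')%N.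
    move=> i'S; apply/idP/idP; last by apply: leq_trans; exact: leq_addr.
    move=> ti; rewrite leqNgt; apply: contraL i'S => lt.
    by apply: (closed_skip c2 cS _ iS); [exact: pt | rewrite ti].
  have {}IH : \sum_(i in S | (t <= po i)%N) v i <= F (t + ps t) k.+1.
    have -> : \sum_(i in S | (t <= po i)%N) v i = \sum_(i in S | (t + ps t <= po i)%N) v i.
      by apply: eq_bigl => i'; case: (boolP (i' \in S)) => // /E ->.
    apply: IH => //; first by lia.
    apply: leq_trans ck; apply: subset_leq_card; apply/subsetP => i'; rewrite !inE.
    by case: (boolP (i' \in S)) => // /E ->.
  by apply: le_trans IH _; case: ifP => // /ltW.
have E (i' : 'I_n) : (t <= po i')%N && (i' != i) = (t.+1 <= po i')%N.
  rewrite ltn_neqAle andbC; congr (_ && _); apply/idP/idP; apply: contraNneq.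
    move=> e; apply/eqP; apply: ord_inj; apply: (pos_inj c2 (ltn_ord i') on).
    by rewrite -[LHS]e; exact: (esym pt).
  by move=> ->; rewrite -[t]pt.
have {}IH : \sum_(i in S | (t <= po i)%N) v i <= v (no t) + F t.+1 k.
  rewrite (bigD1 i) /=; last by rewrite iS /po [pos _ _ _]pt leqnn.
  rewrite lerD2l.
  have -> : \sum_(i' | (i' \in S) && (t <= po i')%N && (i' != i)) v i' =
            \sum_(i' in S | (t.+1 <= po i')%N) v i'.
    by apply: eq_bigl => i'; rewrite -andbA E.
  apply: IH; [lia|by []|exact: ltnW|].
  rewrite -ltnS; apply: leq_trans ck; apply: proper_card; apply/properP; split.
    by apply/subsetP => i'; rewrite !inE => /andP[-> /ltnW].
  exists i; rewrite !inE iS /= /po [pos _ _ _]pt ?leqnn ?ltnn //.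
by apply: le_trans IH _; case: ltP.
Qed.

(** Backtracking after [i] iterations, at position [t] with [q] nodes taken. [bt_prog] makes [n]
    iterations sufficient; [bt_sum] says that the optimum is still reachable; [bt_skip] says that a
    position passed was either taken or has its whole subtree behind, so that a node met at [t]
    always has its parent among those taken. *)
Record btinv (i t q : nat) (sel : nat -> nat) : Prop := Btinv {
  bt_t : (t <= n)%N;
  bt_q : (q <= K1)%N;
  bt_prog : (i <= t)%N \/ q = K1;
  bt_sel : forall k, (k < q)%N -> (sel k < n)%N /\ (po (sel k) < t)%N;
  bt_inj : forall k k', (k < q)%N -> (k' < q)%N -> sel k = sel k' -> k = k';
  bt_sum : \sum_(k < q) v (sel k) + F t (K1 - q) = F 0%N K1;
  bt_skip : forall p, (p < t)%N -> (exists2 k, (k < q)%N & sel k = no p) \/ (p + ps p <= t)%N;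
  bt_par : forall k, (k < q)%N -> (0 < sel k)%N ->
    exists2 k', (k' < q)%N & sel k' = tpar c (sel k) }.

Lemma btinv0 sel : btinv 0 0 0 sel.
Proof. by split=> //; [left | rewrite big_ord0 add0r subn0]. Qed.

Lemma btinv_take i t q sel : btinv i t q sel -> (t < n)%N -> (q < K1)%N ->
  F (t + ps t) (K1 - q) < v (no t) + F t.+1 (K1 - q - 1) ->
  btinv i.+1 t.+1 q.+1 (upd sel q (no t)).
Proof.
move=> [bt bq bp bs bi bS bk bpa] tn qK lt.
have [on pt] := nordP c2 tn; rewrite -/no -/po in on pt.
have uE k : (k < q)%N -> upd sel q (no t) k = sel k.
  by move=> kq; rewrite /upd; case: eqP => // e; lia.
have uq : upd sel q (no t) q = no t by rewrite /upd eqxx.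
split=> //.
- by left; case: bp => [|e]; [|lia].
- move=> k; rewrite ltnS leq_eqVlt => /orP[/eqP->|kq]; first by rewrite uq pt.
  by rewrite uE //; have [h1 h2] := bs k kq; split=> //; lia.
- move=> k k' k1 k1'.
  have cs j : (j < q.+1)%N -> j = q \/ (j < q)%N by lia.
  case: (cs k k1) (cs k' k1') => [->|kq] [->|kq'] //.
  + rewrite uq uE // => e; have [_ h] := bs k' kq'; move: h; rewrite -e pt; lia.
  + rewrite uq uE // => e; have [_ h] := bs k kq; move: h; rewrite e pt; lia.
  + rewrite !uE //; exact: bi.
- rewrite big_ord_recr /= uq; have e : (K1 - q = (K1 - q.+1).+1)%N by lia.
  rewrite (eq_bigr (fun k : 'I_q => v (sel k))); last by move=> k _; rewrite uE.
  rewrite -bS e FS // -?e; last by lia.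
  by rewrite subn1 e /= in lt; rewrite e lt addrA.
- move=> p; rewrite ltnS leq_eqVlt => /orP[/eqP->|pt'].
    by left; exists q; rewrite ?uq.
  case: (bk p pt') => [[k kq e]|h]; last by right; lia.
  by left; exists k; rewrite ?uE //; lia.
- move=> k; rewrite ltnS leq_eqVlt => /orP[/eqP->|kq].
    rewrite uq => o0; have pp := pos_parent c2 o0 on; rewrite -/po pt in pp.
    have pn : (tpar c (no t) < n)%N by apply: ltn_trans (tpar_lt c o0) on.
    have pt' : (po (tpar c (no t)) < t)%N by case/andP: pp.
    case: (bk _ pt') => [[k' kq' e]|h].
      by exists k'; rewrite ?uE ?e //; [lia | rewrite /no /po nord_pos].
    by move: h; rewrite /ps /po psz_pos //; case/andP: pp => _; rewrite ltnNge => /negP.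
  rewrite uE // => s0; have [k' kq' e] := bpa k kq s0.
  by exists k'; rewrite ?uE //; lia.
Qed.

Lemma btinv_skip i t q sel : btinv i t q sel -> (t < n)%N -> (q < K1)%N ->
  ~~ (F (t + ps t) (K1 - q) < v (no t) + F t.+1 (K1 - q - 1)) ->
  btinv i.+1 (t + ps t) q sel.
Proof.
move=> [bt bq bp bs bi bS bk bpa] tn qK nlt.
have sp := psz_gt0 c2 tn; have sl := psz_le c2 tn; rewrite -/ps in sp sl.
split=> //.
- by left; case: bp => [|e]; lia.
- by move=> k kq; have [h1 h2] := bs k kq; split=> //; lia.
- have e : (K1 - q = (K1 - q.+1).+1)%N by lia.
  rewrite -bS [in RHS]e FS //; last by lia.
  by rewrite subn1 e /= in nlt; rewrite (negbTE nlt) -e.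
- move=> p pl; have [pt'|pt'] := ltnP p t.
    by case: (bk p pt') => [h|h]; [left|right; lia].
  by right; apply: psz_nested => //; rewrite pt' pl.
Qed.

(** The loop has a fixed length [n]: it idles once the positions or the budget are exhausted. *)
Lemma btinv_done i t q sel : btinv i t q sel -> (i < n)%N ->
  ((n - t) * (K1 - q) = 0)%N -> btinv i.+1 t q sel.
Proof.
move=> [bt bq bp bs bi bS bk bpa] iN /eqP; rewrite muln_eq0 => h.
split=> //; case/orP: h => /eqP h; [left|right]; lia.
Qed.

Lemma btinv_final t q sel : btinv n t q sel ->
  (forall k, (q <= k < K1)%N -> sel k = 0%N) -> (0 < n)%N ->
  let T := [set i : 'I_n | [exists k : 'I_K1, sel k == i]] in
  [/\ tree_closed c T, (#|T| <= K1)%N & forall S : {set 'I_n}, tree_closed c S ->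
    (#|S| <= K1)%N -> \sum_(i in S) v i <= \sum_(i in T) v i].
Proof.
move=> [bt bq bp bs bi bS bk bpa] z n0 T.
have selT k : (k < q)%N -> forall i : 'I_n, sel k = i -> i \in T.
  move=> kq i e; rewrite inE; apply/existsP; have kK := leq_trans kq bq.
  by exists (Ordinal kK); rewrite /= e.
have seln k : (k < K1)%N -> (sel k < n)%N.
  move=> kK; have [kq|kq] := ltnP k q; first by have [] := bs k kq.
  by rewrite z // kq.
split.
- apply/tree_closedP => i j /andP[j0 /eqP pj]; rewrite inE => /existsP[k /eqP e].
  have kq : (k < q)%N.
    by rewrite ltnNge; apply/negP => kq; move: j0; rewrite -e z ?kq ?ltn_ord.
  have s0 : (0 < sel k)%N by rewrite e.
  have [k' kq' e'] := bpa k kq s0.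
  by apply: selT kq' _ _; rewrite e' e /tpar pj.
- pose f (k : 'I_K1) : 'I_n := Ordinal (seln k (ltn_ord k)).
  apply: (@leq_trans #|[set f k | k : 'I_K1]|).
    apply: subset_leq_card; apply/subsetP => i; rewrite inE => /existsP[k /eqP e].
    by apply/imsetP; exists k => //; apply: ord_inj; rewrite /= e.
  by apply: leq_trans (leq_imset_card _ _) _; rewrite card_ord.
- move=> S cS Sk.
  have h : \sum_(i in S) v i <= F 0%N K1.
    have := @dp_upper S 0 K1 cS isT (leqnn _).
    have -> : \sum_(i in S | (0 <= po i)%N) v i = \sum_(i in S) v i.
      by apply: eq_bigl => i; rewrite andbT.
    apply; apply: leq_trans Sk; apply: subset_leq_card; apply/subsetP => i.
    by rewrite inE => /andP[].
  apply: le_trans h _; rewrite -bS.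
  have -> : F t (K1 - q) = 0.
    move: bt; rewrite leq_eqVlt => /orP[/eqP->|tn]; first by rewrite Fn //; lia.
    by case: bp => [|->]; [lia | rewrite subnn F0].
  rewrite addr0.
  pose f (k : 'I_q) : 'I_n := Ordinal (seln k (leq_trans (ltn_ord k) bq)).
  have fi : injective f.
    by move=> k k' [e]; apply: ord_inj; exact: bi e.
  have -> : \sum_(k < q) v (sel k) = \sum_(i in [set f k | k : 'I_q]) v i.
    by rewrite big_imset /=; [|move=> ? ? _ _; exact: fi]; apply: eq_bigl => k; rewrite inE.
  have sub : [set f k | k : 'I_q] \subset T.
    by apply/subsetP => _ /imsetP[k _ ->]; exact: (selT k (ltn_ord k)).
  rewrite [leRHS](bigID (mem [set f k | k : 'I_q])) /=.
  have -> : \sum_(i in T | i \in [set f k | k : 'I_q]) v i = \sum_(i in [set f k | k : 'I_q]) v i.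
    apply: eq_bigl => i; case: (boolP (i \in [set f k | k : 'I_q])); rewrite ?andbF ?andbT //.
    by move/(subsetP sub) ->.
  by rewrite lerDl; apply: sumr_ge0.
Qed.
End DP.

(** * The recovery program *)

Declare Scope hl_scope.
Delimit Scope hl_scope with H.
Notation "a + b" := (EBin OAdd a b) : hl_scope.
Notation "a - b" := (EBin OSub a b) : hl_scope.
Notation "a * b" := (EBin OMul a b) : hl_scope.
Notation "a / b" := (EBin ODiv a b) : hl_scope.
Declare Scope hx_scope.
Delimit Scope hx_scope with X.
Notation "a + b" := (XBin OAdd a b) : hx_scope.
Notation "a - b" := (XBin OSub a b) : hx_scope.
Notation "a * b" := (XBin OMul a b) : hx_scope.
Notation "a / b" := (XBin ODiv a b) : hx_scope.
Notation "p ;; q" := (SSeq p q) (at level 60, right associativity).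

(* Registers 0, 2, 3, 4, 5 hold c, K, m, n and the number N of iterations. *)
Notation vc := (EVar 0).
Notation vK := (EVar 2).
Notation vm := (EVar 3).
Notation vn := (EVar 4).
Notation vN := (EVar 5).
Notation vi := (EVar 6).
Notation vj := (EVar 7).
Notation vk := (EVar 8).
Notation vt := (EVar 9).
Notation va := (EVar 10).
Notation vq := (EVar 13).
Notation e0 := (ECst 0).
Notation e1 := (ECst 1).
Notation x0 := (XNat e0).
Notation x1 := (XNat e1).
Notation eK1 := (vK + vK + vK)%H.

(* Index memory: pos, then subtree size and node by position, then selection. *)
Definition iP (e : iexp) := EMem e.
Definition iS (e : iexp) := EMem (vn + e)%H.
Definition iO (e : iexp) := EMem (vn + vn + e)%H.
Definition iL (e : iexp) := EMem (vn + vn + vn + e)%H.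

(* Real memory: A, y, the iterate z (also the output), its gradient step, the
   residual, a scalar, K1 + 1 slots of length m + n, the programming table. *)
Definition aA (i j : iexp) := (i * vn + j)%H.
Definition aY (i : iexp) := (vm * vn + i)%H.
Definition aZ (j : iexp) := (vm * vn + vm + j)%H.
Definition aV (j : iexp) := (vm * vn + vm + vn + j)%H.
Definition aR (i : iexp) := (vm * vn + vm + vn + vn + i)%H.
Definition aC := (vm * vn + vm + vn + vn + vm)%H.
Definition aX (s a : iexp) := (aC + e1 + (s * (vm + vn) + a))%H.
Definition aF (t k : iexp) :=
  (aC + e1 + (eK1 + e1) * (vm + vn) + (t * (eK1 + e1) + k))%H.

(** Iteration [i] treats node [i + 1], whose parent [i / c] has been treated before. *)
Definition pTab : stmt :=
  SIst e0 e0 ;; SIst (vn + e0)%H vn ;; SIst (vn + vn + e0)%H e0 ;;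
  SFor 6 (vn - e1)%H
    (SIst (vi + e1)%H (iP (vi / vc)%H + e1 +
        (vi - vc * (vi / vc)) * ((iS (iP (vi / vc)%H) - e1) / vc))%H ;;
     SIst (vn + iP (vi + e1)%H)%H ((iS (iP (vi / vc)%H) - e1) / vc)%H ;;
     SIst (vn + vn + iP (vi + e1)%H)%H (vi + e1)%H).

Definition pZero : stmt := SFor 7 vn (SRst (aZ vj) x0).

Definition pRes : stmt := SFor 6 vm (SRst (aR vi)
  (XMem (aY vi) - XSum 7 vn (XMem (aA vi vj) * XMem (aZ vj)))%X).

Definition pGrad : stmt := SFor 7 vn (SRst (aV vj)
  (XMem (aZ vj) + XSum 6 vm (XMem (aA vi vj) * XMem (aR vi)) / XNat vm)%X).

Definition xw (e : iexp) : rexp := (XMem (aV (iO e)) * XMem (aV (iO e)))%X.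
Definition xmax (x y : rexp) : rexp := XIte x y y x.

(** Positions are visited downwards, because row [t] refers to the rows [t + 1] and [t + psz t]. *)
Definition pTable : stmt :=
  SFor 8 (eK1 + e1)%H (SRst (aF vn vk) x0) ;;
  SFor 6 vn (SSet 9 (vn - e1 - vi)%H ;; SRst (aF vt e0) x0 ;;
    SFor 8 eK1 (SRst (aF vt (vk + e1)%H)
      (xmax (XMem (aF (vt + iS vt)%H (vk + e1)%H))
            (xw vt + XMem (aF (vt + e1)%H vk))%X))).

(** Conditionals compare reals only; [t < n] and [q < K1] are tested at once by the sign of a
    product of truncated differences. *)
Definition pBack : stmt :=
  SFor 8 eK1 (SIst (vn + vn + vn + vk)%H e0) ;; SSet 9 e0 ;; SSet 13 e0 ;;
  SFor 6 vn (SIf x0 (XNat ((vn - vt) * (eK1 - vq))%H)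
    (SIf (XMem (aF (vt + iS vt)%H (eK1 - vq)%H))
         (xw vt + XMem (aF (vt + e1)%H (eK1 - vq - e1)%H))%X
       (SIst (vn + vn + vn + vq)%H (iO vt) ;; SSet 9 (vt + e1)%H ;; SSet 13 (vq + e1)%H)
       (SSet 9 (vt + iS vt)%H))
    SSkip).

Definition pKeep : stmt :=
  pZero ;; SFor 8 eK1 (SRst (aZ (iL vk)) (XMem (aV (iL vk)))).

Definition pIter : stmt := SFor 11 vN (pRes ;; pGrad ;; pTable ;; pBack ;; pKeep).

(** A slot pairs a vector with its coefficients: the column of the [k]-th selected node with a unit
    vector or, for [k = K1], the measurements with 0. The index compared with 1 is 0 exactly when
    [a] is the selected node and [k < K1]. *)
Definition pLoad : stmt :=
  SFor 10 vm (SRst (aX vk va)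
    (XIte (XNat vk) (XNat eK1) (XMem (aA va (iL vk))) (XMem (aY va)))) ;;
  SFor 10 vn (SRst (aX vk (vm + va)%H)
    (XIte (XNat ((va - iL vk) + (iL vk - va) + (vk + e1 - eK1))%H) x1 x1 x0)).

Definition xdot (s s' : iexp) : rexp :=
  XSum 10 vm (XMem (aX s va) * XMem (aX s' va))%X.

(** Modified Gram-Schmidt on whole slots. A repeated or dependent column is reduced to 0; later
    divisions by its squared norm give 0 by convention, so it is passed over. *)
Definition pOrth : stmt :=
  SFor 6 eK1 (SIf (XNat vi) (XNat vk)
    (SRst aC (xdot vk vi / xdot vi vi)%X ;;
     SFor 10 (vm + vn)%H
       (SRst (aX vk va) (XMem (aX vk va) - XMem aC * XMem (aX vi va))%X))
    SSkip).

Definition pLS : stmt := SFor 8 (eK1 + e1)%H (pLoad ;; pOrth).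

(** The last slot ends as [y + A *m p] with coefficients [p]: the residual of the fit and minus the
    fit itself. *)
Definition pOut : stmt :=
  SFor 7 vn (SRst (aZ vj) (x0 - XMem (aX eK1 (vm + vj)%H))%X).

(** Register 12 is what the loop of [recover] compares with [K]: the value [K] stops the loop, 0
    continues it. *)
Definition pTest : stmt :=
  SRst aC x1 ;; SFor 11 vN (SRst aC (XMem aC * XNat (ECst 16))%X) ;;
  SSet 12 vK ;;
  SIf x0 (xdot eK1 eK1)
    (SIf (XNat (ECst 16) * XSum 10 vm (XMem (aY va) * XMem (aY va)))%X
         (XMem aC * xdot eK1 eK1)%X SSkip (SSet 12 e0))
    SSkip.

Definition pRound : stmt :=
  pTab ;; pZero ;; pIter ;; pLS ;; pOut ;; pTest.

(** Every round starts afresh with twice as many iterations, so the iteration costs of all rounds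
    add up to a constant times those of the last. *)
Definition recover : cmd :=
  Seq (Do (IConst 5 1)) (While (ILt 12 2) (Seq (Do (IAdd 5 5 5)) (compS pRound nvar))).

Lemma pRound_wf : wfS pRound. Proof. by []. Qed.

(** * Meaning of the stages of the program *)

Section Generic.
Variable R : realType.
Implicit Type s : state R.

Definition wrm (f : nat -> R) (b N : nat) (g : nat -> R) : nat -> R :=
  fun ad => if (b <= ad < b + N)%N then g (ad - b)%N else f ad.

Lemma wrm_in f b N g i : (i < N)%N -> wrm f b N g (b + i) = g i.
Proof. by move=> iN; rewrite /wrm leq_addr ltn_add2l iN addKn. Qed.

Lemma wrm_out f b N g ad : ~~ (b <= ad < b + N)%N -> wrm f b N g ad = f ad.
Proof. by rewrite /wrm => /negbTE ->. Qed.

Lemma wrmS f b N g : upd (wrm f b N g) (b + N) (g N) = wrm f b N.+1 g.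
Proof.
apply/funext => ad; rewrite /upd /wrm; case: eqP => [->|ne].
  by rewrite leq_addr ltn_add2l ltnSn addKn.
by case: ifP => h; case: ifP => h' //; lia.
Qed.

Lemma den_for r e p s N (Inv : nat -> state R -> Prop) :
  evI s e = N -> Inv 0%N s ->
  (forall i s', (i < N)%N -> Inv i s' -> Inv i.+1 (den p (set_ireg s' r i))) ->
  Inv N (den (SFor r e p) s).
Proof.
move=> eN I0 IS; rewrite /= eN.
suff H k : (k <= N)%N -> Inv k (iteri k (fun i s' => den p (set_ireg s' r i)) s) by exact: H.
by elim: k => //= k IH kN; apply: IS => //; apply: IH; exact: ltnW.
Qed.

(** For loops that fill an interval. The values [f] are fixed beforehand, so the hypothesis includes
    that cells already written do not disturb the later ones. *)
Lemma den_vec r e a x s N b (f : nat -> R) :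
  evI s e = N ->
  (forall i g, (i < N)%N -> (forall q, q != r -> g q = ireg s q) -> g r = i ->
     let s' := State g (imem s) (rreg s) (wrm (rmem s) b i f) in
     evI s' a = (b + i)%N /\ evX x s' = f i) ->
  exists2 g, (forall q, q != r -> g q = ireg s q) &
    den (SFor r e (SRst a x)) s = State g (imem s) (rreg s) (wrm (rmem s) b N f).
Proof.
move=> eN H.
apply: (@den_for r e _ s N (fun i s' => exists2 g, (forall q, q != r -> g q = ireg s q) &
   s' = State g (imem s) (rreg s) (wrm (rmem s) b i f))) => //.
  exists (ireg s) => //; case: s {eN H} => g im rr rm /=; congr State.
  by apply/funext => ad; rewrite wrm_out // addn0; lia.
move=> i _ iN [g gE ->]; exists (upd g r i).
  by move=> q qr; rewrite /upd (negbTE qr) gE.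
have [||h1 h2] := H i (upd g r i) iN.
- by move=> q qr; rewrite /upd (negbTE qr) gE.
- by rewrite /upd eqxx.
by rewrite /= -/(set_ireg _ _ _) [set_ireg _ _ _]/set_ireg /= h1 h2 /set_rmem /= wrmS.
Qed.
End Generic.

Fixpoint norst (p : stmt) : bool :=
  match p with
  | SRst _ _ => false
  | SSeq p q | SIf _ _ p q => norst p && norst q
  | SFor _ _ p => norst p
  | _ => true
  end.

Fixpoint noist (p : stmt) : bool :=
  match p with
  | SIst _ _ => false
  | SSeq p q | SIf _ _ p q => noist p && noist q
  | SFor _ _ p => noist p
  | _ => true
  end.

Lemma den_rmem (R : realType) p (s : state R) : norst p -> rmem (den p s) = rmem s.
Proof.
elim: p s => //=.
- by move=> p IHp q IHq s /andP[/IHp e /IHq ->].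
- by move=> x y p IHp q IHq s /andP[/IHp e /IHq e']; case: ifP.
- move=> r e p IH s /IH {}IH; by elim: (evI s e) => //= i IHi; rewrite IH /= IHi.
Qed.

Lemma den_imem (R : realType) p (s : state R) : noist p -> imem (den p s) = imem s.
Proof.
elim: p s => //=.
- by move=> p IHp q IHq s /andP[/IHp e /IHq ->].
- by move=> x y p IHp q IHq s /andP[/IHp e /IHq e']; case: ifP.
- move=> r e p IH s /IH {}IH; by elim: (evI s e) => //= i IHi; rewrite IH /= IHi.
Qed.

(** Every index stored by the program is at most [n] or [K1], hence at most [m * n]: the cap changes
    nothing. *)
Lemma evI_clampE (R : realType) (s : state R) e :
  (evI s e <= ireg s 3 * ireg s 4)%N -> evI s (eclamp e) = evI s e.
Proof. by move=> h; rewrite /= -[RHS]subn0; congr (_ - _)%N; apply/eqP. Qed.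

Lemma den_SIst (R : realType) (s : state R) a e :
  (evI s e <= ireg s 3 * ireg s 4)%N -> den (SIst a e) s = set_imem s (evI s a) (evI s e).
Proof. by move=> h; rewrite -(evI_clampE h). Qed.

Lemma den_SSet (R : realType) (s : state R) r e :
  (evI s e <= ireg s 3 * ireg s 4)%N -> den (SSet r e) s = set_ireg s r (evI s e).
Proof. by move=> h; rewrite -(evI_clampE h). Qed.

Lemma den_seq (R : realType) (s : state R) p q : den (p ;; q) s = den q (den p s).
Proof. by []. Qed.

Lemma den_SRst (R : realType) (s : state R) a x :
  den (SRst a x) s = set_rmem s (evI s a) (evX x s).
Proof. by []. Qed.

Lemma den_SIf (R : realType) (s : state R) x y p q :
  den (SIf x y p q) s = if evX x s < evX y s then den p s else den q s.
Proof. by []. Qed.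

Lemma den_SSkip (R : realType) (s : state R) : den SSkip s = s.
Proof. by []. Qed.

Arguments den : simpl never.

Section Stages.
Variables (R : realType) (c l K m N : nat).
Let n := geo c l.
Hypotheses (c2 : (2 <= c)%N) (K0 : (0 < K)%N) (m0 : (0 < m)%N) (n0 : (0 < n)%N).
Let K1 := (K + K + K)%N.
Hypothesis K1m : (K1 <= m)%N.
Implicit Type s : state R.

Definition par s : Prop :=
  [/\ ireg s 0 = c, ireg s 2 = K, ireg s 3 = m, ireg s 4 = n & ireg s 5 = N].

Lemma par_den p s : wfS p -> par s -> par (den p s).
Proof. by move=> wp [h0 h2 h3 h4 h5]; split; rewrite den_par. Qed.

Lemma par_set s r v : isvar r -> par s -> par (set_ireg s r v).
Proof. by move=> vr [h0 h2 h3 h4 h5]; split; rewrite set_ireg_par. Qed.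

Definition tab s : Prop := forall t, (t < n)%N ->
  imem s (n + t) = psz c l t /\ imem s (n + n + t) = nord c l t.

Lemma n_le_mn : (n <= m * n)%N.
Proof. by rewrite leq_pmull. Qed.

Lemma pTab_ok s : par s -> tab (den pTab s).
Proof.
move=> ps; have nm := n_le_mn.
pose Inv i s' := par s' /\ forall j, (j <= i)%N -> (j < n)%N ->
  [/\ imem s' j = pos c l j, imem s' (n + pos c l j) = tsz c l j &
      imem s' (n + n + pos c l j) = j].
suff [_ H] : Inv (n - 1)%N (den pTab s).
  move=> t tn; have [on pt] := nordP c2 tn.
  have [|h1 h2 h3] := H _ _ on; first by move: on; rewrite /n; lia.
  by rewrite pt in h2 h3.
have [h0 h2 h3 h4 h5] := ps.
have eE : evI s vn = n by rewrite /= h4.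
rewrite /pTab den_seq den_SIst //; set t1 := set_imem s _ _.
rewrite den_seq den_SIst; last by rewrite /= h3 h4.
set t2 := set_imem t1 _ _; rewrite den_seq den_SIst //; set s1 := set_imem t2 _ _.
have ps1 : par s1 by split.
have E1 : [/\ imem s1 0 = 0%N, imem s1 n = n & imem s1 (n + n) = 0%N].
  rewrite /s1 /t2 /t1 /= !h4 !addn0 /upd !eqxx.
  have -> : (0 == n + n)%N = false by lia.
  have -> : (0 == n)%N = false by lia.
  by have -> : (n == n + n)%N = false by lia.
apply: (@den_for _ 6 (vn - e1)%H _ s1 (n - 1)%N Inv).
- by rewrite /= h4.
- split=> // j; rewrite leqn0 => /eqP-> _; have [a1 a2 a3] := E1.
  by rewrite pos0 tsz0 !addn0.
move=> i s' iN [ps' IH].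
have pn : (i %/ c < n)%N by have := leq_div i c; lia.
have [q1 q2 _] := IH (i %/ c)%N (leq_div _ _) pn.
have i1n : (i.+1 < n)%N by lia.
have [_ plt] := pos_lt c2 i1n.
have tle : (tsz c l i.+1 <= n)%N by have [] := pos_lt c2 i1n; lia.
have [g0 g2 g3 g4 g5] := @par_set s' 6 i isT ps'.
set s2 := set_ireg s' 6 i in g0 g2 g3 g4 g5 *.
have im2 : imem s2 = imem s' by [].
have r6 : ireg s2 6 = i by [].
clearbody s2.
have S2 : evI s2 ((iS (iP (vi / vc)%H) - e1) / vc)%H = tsz c l i.+1.
  by rewrite [evI _ _]/= g0 g4 r6 im2 q1 q2 tszS.
have P2 : evI s2 (iP (vi / vc)%H + e1 + (vi - vc * (vi / vc)) * ((iS (iP (vi / vc)%H) - e1) / vc))%H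
     = pos c l i.+1.
  by rewrite posS -S2 /= g0 g4 r6 im2 q1.
rewrite den_seq den_SIst; last by rewrite P2 g3 g4; lia.
rewrite P2.
have A2 : evI s2 (vi + e1)%H = i.+1 by rewrite /= r6 addn1.
rewrite A2; set s3 := set_imem s2 i.+1 _.
have [k0 k2 k3 k4 k5] : par s3 by split.
have q1' : imem s3 (i %/ c) = pos c l (i %/ c).
  by rewrite /s3 /= /upd; case: eqP => [e|_]; [have := leq_div i c; lia | rewrite im2 q1].
have q2' : imem s3 (n + pos c l (i %/ c)) = tsz c l (i %/ c).
  by rewrite /s3 /= /upd; case: eqP => [e|_]; [lia | rewrite im2 q2].
have r63 : ireg s3 6 = i by [].
have i3 : imem s3 i.+1 = pos c l i.+1 by rewrite /s3 /= /upd eqxx.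
have im3 ad : imem s3 ad = if ad == i.+1 then pos c l i.+1 else imem s' ad.
  by rewrite /s3 /= im2.
clearbody s3.
have S3 : evI s3 ((iS (iP (vi / vc)%H) - e1) / vc)%H = tsz c l i.+1.
  by rewrite [evI _ _]/= k0 k4 r63 q1' q2' tszS.
have A3 : evI s3 (vn + iP (vi + e1)%H)%H = (n + pos c l i.+1)%N.
  by rewrite /= k4 r63 addn1 i3.
rewrite den_seq (den_SIst (s := s3)); last by rewrite S3 k3 k4; lia.
rewrite S3 A3; set s4 := set_imem s3 _ _.
have [l0 l2 l3 l4 l5] : par s4 by split.
have A4 : evI s4 (vn + vn + iP (vi + e1)%H)%H = (n + n + pos c l i.+1)%N.
  rewrite [LHS]/= k4 r63 addn1; congr (_ + _)%N.
  by rewrite /upd; case: eqP => [|_ //]; lia.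
have V4 : evI s4 (vi + e1)%H = i.+1 by rewrite /= r63 addn1.
rewrite den_SIst; last by rewrite V4 l3 l4; lia.
rewrite A4 V4; split; first by split.
move=> j ji jn; have [pj1 pj2] := pos_lt c2 jn.
rewrite /= /upd /= !im3.
have [->|jne] := eqVneq j i.+1.
  by rewrite ?eqxx; split; repeat (case: eqP => [|_]; first by lia).
have jl : (j <= i)%N by lia.
have [b1 b2 b3] := IH j jl jn.
have pne : pos c l j <> pos c l i.+1.
  by move=> e; have := pos_inj c2 jn i1n e; lia.
by split; repeat (case: eqP => [e|_]; first by (lia || (exfalso; apply: pne; lia))).
Qed.

Local Notation o := (m * n + m)%N.
Local Notation cb := (m * n + m + n + n + m)%N.
Local Notation W := (m + n)%N.
Local Notation fb := (m * n + m + n + n + m + 1 + (K1 + 1) * (m + n))%N.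

Lemma row_lt i j : (i < m)%N -> (j < n)%N -> (i * n + j < m * n)%N.
Proof.
move=> im jn; apply: (@leq_trans (i.+1 * n)); first by rewrite mulSn; lia.
by rewrite leq_mul2r im orbT.
Qed.

Lemma pZero_ok s : par s -> rmem (den pZero s) = wrm (rmem s) o n (fun=> 0).
Proof.
move=> [h0 h2 h3 h4 h5].
have [||g gE ->//] := @den_vec R 7 vn (aZ vj) x0 s n o (fun=> 0).
  by rewrite /= h4.
by move=> i g iN gE gr /=; rewrite gr !gE // h3 h4.
Qed.

Lemma pRes_ok s : par s -> rmem (den pRes s) = wrm (rmem s) (o + n + n) m
  (fun i => rmem s (m * n + i) - \sum_(j < n) rmem s (i * n + j) * rmem s (o + j)).
Proof.
move=> [h0 h2 h3 h4 h5]; set f := (fun i => _ - _).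
have [||g gE ->//] := @den_vec R 6 vm (aR vi)
  (XMem (aY vi) - XSum 7 vn (XMem (aA vi vj) * XMem (aZ vj)))%X s m (o + n + n)%N f.
  by rewrite /= h3.
move=> i g im gE gr /=; rewrite gr !gE // h3 h4; split=> //.
rewrite /f wrm_out; last by lia.
congr (_ - _); apply: eq_bigr => j _; rewrite /upd /= gr !gE // h3 h4.
have lt := row_lt im (ltn_ord j); have jn := ltn_ord j.
by rewrite !wrm_out //; lia.
Qed.

Lemma pGrad_ok s : par s -> rmem (den pGrad s) = wrm (rmem s) (o + n) n
  (fun j => rmem s (o + j) +
     (\sum_(i < m) rmem s (i * n + j) * rmem s (o + n + n + i)) / m%:R).
Proof.
move=> [h0 h2 h3 h4 h5]; set f := (fun j => _ + _).
have [||g gE ->//] := @den_vec R 7 vn (aV vj)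
  (XMem (aZ vj) + XSum 6 vm (XMem (aA vi vj) * XMem (aR vi)) / XNat vm)%X s n (o + n)%N f.
  by rewrite /= h4.
move=> j g jn gE gr /=; rewrite gr !gE // h3 h4; split=> //.
rewrite /f wrm_out; last by lia.
congr (_ + _ / _); apply: eq_bigr => i _; rewrite /upd /= gr !gE // h3 h4.
have lt := row_lt (ltn_ord i) jn; have im := ltn_ord i.
by rewrite !wrm_out //; lia.
Qed.

Definition Fm s t k : R := rmem s (fb + (t * (K1 + 1) + k)).

Lemma row_sep t t' k k' : (t < t')%N -> (k <= K1)%N ->
  (t * (K1 + 1) + k < t' * (K1 + 1) + k')%N.
Proof.
move=> tt kK; have : (t.+1 * (K1 + 1) <= t' * (K1 + 1))%N by rewrite leq_mul2r tt orbT.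
rewrite mulSn; move: (t * _)%N (t' * _)%N => a b; lia.
Qed.

Definition wgt s (i : nat) : R := rmem s (o + n + i) * rmem s (o + n + i).

(** Two states, because the weights refer to the memory before the table is filled and the entries
    to the memory afterwards. *)
Definition Frow s s' t : Prop :=
  Fm s' t 0 = 0 /\ forall k, (k < K1)%N -> Fm s' t k.+1 =
    if Fm s' (t + psz c l t) k.+1 < wgt s (nord c l t) + Fm s' t.+1 k
    then wgt s (nord c l t) + Fm s' t.+1 k else Fm s' (t + psz c l t) k.+1.

Lemma pTable_ok s : par s -> tab s -> let s' := den pTable s in
  [/\ forall ad, (ad < fb)%N -> rmem s' ad = rmem s ad,
      forall k, (k <= K1)%N -> Fm s' n k = 0 &
      forall t, (t < n)%N -> Frow s s' t].
Proof.
move=> ps ts.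
pose Inv i s' := [/\ par s', imem s' = imem s,
  forall ad, (ad < fb)%N -> rmem s' ad = rmem s ad,
  forall k, (k <= K1)%N -> Fm s' n k = 0 &
  forall t, (n - i <= t)%N -> (t < n)%N -> Frow s s' t].
suff [_ _ a3 a4 a5] : Inv n (den pTable s).
  by split=> // t tn; apply: a5 => //; rewrite subnn.
rewrite /pTable den_seq.
have [h0 h2 h3 h4 h5] := ps; have nm := n_le_mn.
have [||g gE ->] := @den_vec R 8 (eK1 + e1)%H (aF vn vk) x0 s (K1 + 1)%N
    (fb + n * (K1 + 1))%N (fun=> 0).
- by rewrite /= h2.
- move=> k g kK gE gr /=; rewrite gr !gE // h2 h3 h4; split=> //; lia.
set s1 := State _ _ _ _.
have ps1 : par s1 by split; rewrite /= gE.
apply: (@den_for _ 6 vn _ s1 n Inv).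
- by rewrite /= gE.
- split=> //.
  + by move=> ad lt; rewrite /= wrm_out //; lia.
  + by move=> k kK; rewrite /Fm /= addnA wrm_in //; lia.
  + by move=> t; rewrite subn0; lia.
move=> i s' iN [ps' im' lo' Fn' Fr'].
have [g0 g2 g3 g4 g5] := @par_set s' 6 i isT ps'.
set s2 := set_ireg s' 6 i in g0 g2 g3 g4 g5 *.
have [im2 rm2 r6] : [/\ imem s2 = imem s, rmem s2 = rmem s' & ireg s2 6 = i] by [].
clearbody s2.
set t := (n - 1 - i)%N; have tn : (t < n)%N by rewrite /t; lia.
have eT : evI s2 (vn - e1 - vi)%H = t by rewrite /= g4 r6.
rewrite den_seq den_SSet; last by rewrite eT g3 g4; lia.
rewrite eT; set s3 := set_ireg s2 9 t.
have [k0 k2 k3 k4 k5] := @par_set s2 9 t isT (And5 g0 g2 g3 g4 g5).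
have [im3 rm3 r9] : [/\ imem s3 = imem s, rmem s3 = rmem s' & ireg s3 9 = t] by [].
rewrite -/s3 in k0 k2 k3 k4 k5; clearbody s3.
rewrite den_seq den_SRst.
have eA : evI s3 (aF vt e0) = (fb + t * (K1 + 1))%N.
  by rewrite [LHS]/= k3 k4 k2 r9 addn0.
rewrite eA [evX x0 s3]/=; set s4 := set_rmem s3 _ _.
have rm4 ad : rmem s4 ad = if ad == (fb + t * (K1 + 1))%N then 0 else rmem s' ad.
  by rewrite /s4 /= rm3.
have [im4 ir4] : imem s4 = imem s /\ ireg s4 = ireg s3 by [].
rewrite -ir4 in k0 k2 k3 k4 k5 r9; clearbody s4.
have [on _] := nordP c2 tn; have sp := psz_gt0 c2 tn; have sl := psz_le c2 tn.
have [t1 t2] := ts t tn.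
pose f k := if Fm s' (t + psz c l t) k.+1 < wgt s (nord c l t) + Fm s' t.+1 k
    then wgt s (nord c l t) + Fm s' t.+1 k else Fm s' (t + psz c l t) k.+1.
have [||g' gE' ->] := @den_vec R 8 eK1 (aF vt (vk + e1)%H)
   (xmax (XMem (aF (vt + iS vt)%H (vk + e1)%H)) (xw vt + XMem (aF (vt + e1)%H vk))%X)
   s4 K1 (fb + t * (K1 + 1) + 1)%N f.
- by rewrite /= k2.
- move=> k g' kK gE' gr'.
  have q2 : g' 2 = K by rewrite gE'.
  have q3 : g' 3 = m by rewrite gE'.
  have q4 : g' 4 = n by rewrite gE'.
  have q9 : g' 9 = t by rewrite gE'.
  move=> s5; split.
    rewrite [LHS]/= gr' q2 q3 q4 q9; lia.
  (* Rows after [t] are complete and lie at higher addresses than the cells written now. *)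
  have R1 t' k' : (t < t')%N -> rmem s5 (fb + (t' * (K1 + 1) + k')) = Fm s' t' k'.
    move=> tt; have h1 := @row_sep t t' k k' tt (ltnW kK).
    have h00 := @row_sep t t' 0 k' tt (leq0n _).
    rewrite /s5 [rmem _]/= wrm_out; last by lia.
    by rewrite rm4; case: eqP => // e; lia.
  have R2 : rmem s5 (o + n + nord c l t) = rmem s (o + n + nord c l t).
    rewrite /s5 [rmem _]/= wrm_out; last by lia.
    rewrite rm4; case: eqP => [|_]; first by lia.
    by rewrite lo' //; lia.
  have F1 : evX (XMem (aF (vt + iS vt)%H (vk + e1)%H)) s5 = Fm s' (t + psz c l t) k.+1.
    rewrite -[k.+1]addn1 -R1; last by lia.
    by rewrite [LHS]/= gr' q2 q3 q4 q9 im4 t1.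
  have F2 : evX (xw vt + XMem (aF (vt + e1)%H vk))%X s5 = wgt s (nord c l t) + Fm s' t.+1 k.
    rewrite -R1 // -[t.+1]addn1 [LHS]/= gr' q2 q3 q4 q9 im4 t2 /wgt -R2.
    by [].
  by rewrite /xmax /f -F1 -F2.
set s6 := State _ _ _ _.
have rm6 t' k' : (t < t')%N -> Fm s6 t' k' = Fm s' t' k'.
  move=> tt; have h1 := @row_sep t t' K1 k' tt (leqnn _).
  have h0' := @row_sep t t' 0 k' tt (leq0n _).
  rewrite /Fm /s6 [rmem _]/= wrm_out; last by lia.
  by rewrite rm4; case: eqP => // e; lia.
split=> //.
- by split; rewrite /s6 /= gE'.
- move=> ad lt; rewrite /s6 [rmem _]/= wrm_out; last by lia.
  by rewrite rm4; case: eqP => [|_]; [lia | exact: lo'].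
- by move=> k kK; rewrite rm6 // Fn'.
move=> t' le t'n.
have [->|ne] := eqVneq t' t.
  split.
    rewrite /Fm /s6 [rmem _]/= wrm_out; last by lia.
    by rewrite rm4 addn0 eqxx.
  have lt1 : (t < t + psz c l t)%N by lia.
  move=> k kK; rewrite (rm6 t.+1 k) // !(rm6 _ k.+1 lt1).
  have -> : Fm s6 t k.+1 = f k.
    rewrite /Fm /s6 [rmem _]/=.
    have -> : (fb + (t * (K1 + 1) + k.+1) = fb + t * (K1 + 1) + 1 + k)%N by lia.
    by rewrite wrm_in.
  by [].
have tt : (t < t')%N by rewrite /t in ne *; lia.
have le' : (n - i <= t')%N by rewrite /t in tt; lia.
have [e1' e2'] := Fr' t' le' t'n.
have sp' := psz_gt0 c2 t'n.
split; first by rewrite rm6.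
by move=> k kK; rewrite !rm6 //; [exact: e2' | lia | lia].
Qed.
End Stages.

Section Iteration.
Variables (R : realType) (c l K m N : nat).
Let n := geo c l.
Hypotheses (c2 : (2 <= c)%N) (K0 : (0 < K)%N) (m0 : (0 < m)%N) (n0 : (0 < n)%N).
Let K1 := (K + K + K)%N.
Hypothesis K1m : (K1 <= m)%N.
Implicit Type s : state R.
Local Notation parS := (@par R c l K m N).
Local Notation o := (m * n + m)%N.
Local Notation cb := (m * n + m + n + n + m)%N.
Local Notation fb := (m * n + m + n + n + m + 1 + (K1 + 1) * (m + n))%N.

Definition sel s (k : nat) : nat := imem s (n + n + n + k).
Definition selset s : {set 'I_n} := [set i : 'I_n | [exists k : 'I_K1, sel s k == i]].

Lemma sel_imem s s' : imem s = imem s' -> sel s = sel s'.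
Proof. by move=> e; rewrite /sel e. Qed.

Lemma pBack_ok s0 s : parS s -> tab c l s ->
  (forall i, (i < n)%N -> wgt c l m s i = wgt c l m s0 i) ->
  (forall k, (k <= K1)%N -> Fm c l K m s n k = 0) ->
  (forall t, (t < n)%N -> Frow c l K m s0 s t) ->
  let s' := den pBack s in
  [/\ forall ad, (ad < n + n + n)%N -> imem s' ad = imem s ad,
      forall k, (k < K1)%N -> (sel s' k < n)%N,
      tree_closed c (selset s'), (#|selset s'| <= K1)%N &
      forall S : {set 'I_n}, tree_closed c S -> (#|S| <= K1)%N ->
        \sum_(i in S) wgt c l m s i <= \sum_(i in selset s') wgt c l m s i].
Proof.
move=> ps ts wE Fn Fr; have nm := n_le_mn c l m0; rewrite -/n in nm.
have mm : (m <= m * n)%N by rewrite leq_pmulr.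
pose v := wgt c l m s; pose F := Fm c l K m s.
have v0 i : 0 <= v i by rewrite /v /wgt -expr2 sqr_ge0.
have F0 t : (t < n)%N -> F t 0%N = 0 by move=> /Fr[].
have FS t k : (t < n)%N -> (k < K1)%N ->
  F t k.+1 = if F (t + psz c l t)%N k.+1 < v (nord c l t) + F t.+1 k
    then v (nord c l t) + F t.+1 k else F (t + psz c l t)%N k.+1.
  by move=> tn kK; have [on _] := nordP c2 tn; have [_ /(_ k kK)] := Fr t tn; rewrite -!wE.
have K10 : (0 < K1)%N by rewrite /K1; lia.
pose Inv i s' := [/\ parS s', rmem s' = rmem s,
  forall ad, (ad < n + n + n)%N -> imem s' ad = imem s ad,
  btinv c l K1 v F i (ireg s' 9) (ireg s' 13) (sel s') &
  forall k, (ireg s' 13 <= k < K1)%N -> sel s' k = 0%N].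
suff [_ _ lo bt z] : Inv n (den pBack s).
  have [h1 h2 h3] := btinv_final c2 K10 v0 Fn F0 FS bt z n0.
  split=> // k kK; have [kq|kq] := ltnP k (ireg (den pBack s) 13).
    by have [] := bt_sel bt kq.
  by rewrite z ?kq.
have [h0 h2 h3 h4 h5] := ps.
rewrite /pBack den_seq.
set s1 := den (SFor 8 _ _) s.
have [ps1 rm1 lo1 z1] : [/\ parS s1, rmem s1 = rmem s,
    forall ad, (ad < n + n + n)%N -> imem s1 ad = imem s ad &
    forall k, (k < K1)%N -> sel s1 k = 0%N].
  pose I i s' := [/\ parS s', rmem s' = rmem s,
    forall ad, (ad < n + n + n)%N -> imem s' ad = imem s ad &
    forall k, (k < i)%N -> sel s' k = 0%N].
  apply: (@den_for _ 8 eK1 _ s K1 I); [by rewrite /= h2 | by split |].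
  move=> i s' iK [p' r' l' z'].
  have [g0 g2 g3 g4 g5] := @par_set _ _ _ _ _ _ s' 8 i isT p'.
  rewrite den_SIst //.
  have eA : evI (set_ireg s' 8 i) (vn + vn + vn + vk)%H = (n + n + n + i)%N.
    by have [_ _ _ q4 _] := p'; rewrite [LHS]/= /upd /= q4.
  rewrite eA; split=> //.
  + move=> ad lt /=; rewrite /upd; case: eqP => [|_]; [lia | exact: l'].
  + move=> k ki; rewrite /sel /= /upd; case: eqP => // ne; apply: z'; lia.
clearbody s1.
have [a0 a2 a3 a4 a5] := ps1.
rewrite den_seq den_SSet //; set s2 := set_ireg s1 9 _.
rewrite den_seq den_SSet //; set s3 := set_ireg s2 13 _.
apply: (@den_for _ 6 vn _ s3 n Inv).
- exact: a4.
- split=> //; exact: btinv0.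
move=> i s' iN [p' r' l' b' z'].
have [g0 g2 g3 g4 g5] := @par_set _ _ _ _ _ _ s' 6 i isT p'.
set u := set_ireg s' 6 i in g0 g2 g3 g4 g5 *.
have [imu rmu r9 r13] : [/\ imem u = imem s', rmem u = rmem s,
  ireg u 9 = ireg s' 9 & ireg u 13 = ireg s' 13] by [].
have pu : parS u by [].
clearbody u.
set t := ireg s' 9 in b' r9; set q := ireg s' 13 in b' z' r13.
have tn' := bt_t b'; have qK' := bt_q b'; rewrite -/n in tn'.
rewrite den_SIf.
have -> : (evX x0 u < evX (XNat ((vn - vt) * (eK1 - vq))%H) u) = (0 < (n - t) * (K1 - q))%N.
  by rewrite [evX x0 u]/= [evX _ u]/= ltr_nat g4 g2 r9 r13.
case: (posnP ((n - t) * (K1 - q))%N) => [z|nz].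
  rewrite den_SSkip; split=> //.
  + by move=> ad lt; rewrite imu l'.
  + rewrite r9 r13 (_ : sel u = sel s'); last by rewrite /sel imu.
    exact: btinv_done.
  + by move=> k; rewrite r13 /sel imu; exact: z'.
have tn : (t < n)%N by move: nz; rewrite muln_gt0 subn_gt0 => /andP[].
have qK : (q < K1)%N by move: nz; rewrite muln_gt0 !subn_gt0 => /andP[].
have [on pt] := nordP c2 tn; have sp := psz_gt0 c2 tn; have sl := psz_le c2 tn.
rewrite -/n in on sl.
have [t1 t2] := ts t tn.
have imt : imem s' (n + t) = psz c l t by rewrite l' //; lia.
have imo : imem s' (n + n + t) = nord c l t by rewrite l' //; lia.
rewrite den_SIf.
have -> : evX (XMem (aF (vt + iS vt)%H (eK1 - vq)%H)) u = F (t + psz c l t)%N (K1 - q)%N.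
  by rewrite [LHS]/= g2 g3 g4 r9 r13 imu imt rmu.
have -> : evX (xw vt + XMem (aF (vt + e1)%H (eK1 - vq - e1)%H))%X u =
    v (nord c l t) + F t.+1 (K1 - q - 1)%N.
  by rewrite -[t.+1]addn1 [LHS]/= g2 g3 g4 r9 r13 imu imo rmu.
case: ifP => lt; last first.
  have eT : evI u (vt + iS vt)%H = (t + psz c l t)%N.
    by rewrite [LHS]/= g4 r9 imu imt.
  rewrite den_SSet; last by rewrite eT g3 g4; lia.
  rewrite eT; split=> //=.
  + by move=> ad lt'; rewrite imu l'.
  + rewrite /upd /= r13 (_ : sel _ = sel s'); last by rewrite /sel /= imu.
    by apply: btinv_skip => //; rewrite lt.
  + by move=> k; rewrite /upd /= r13 /sel /= imu; exact: z'.
rewrite den_seq.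
have eO : evI u (iO vt) = nord c l t by rewrite [LHS]/= g4 r9 imu imo.
have eA : evI u (vn + vn + vn + vq)%H = (n + n + n + q)%N by rewrite [LHS]/= g4 r13.
rewrite (den_SIst (s := u)); last by rewrite eO g3 g4; lia.
rewrite eO eA; set u2 := set_imem u _ _.
rewrite den_seq (den_SSet (s := u2)); last by rewrite /= r9 g3 g4; lia.
have -> : evI u2 (vt + e1)%H = t.+1 by rewrite /= r9 addn1.
set u3 := set_ireg u2 9 _.
rewrite den_SSet; last by rewrite /= /upd /= r13 g3 g4; lia.
have -> : evI u3 (vq + e1)%H = q.+1 by rewrite /= /upd /= r13 addn1.
split=> //.
- by move=> ad lt'; rewrite /= /upd; case: eqP => [|_]; [lia | rewrite imu l'].
- rewrite /= /upd /=.
  have -> : sel (set_ireg u3 13 q.+1) = upd (sel s') q (nord c l t).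
    apply/funext => k; rewrite /sel /= /upd eqn_add2l; case: eqP => // _.
    by rewrite imu.
  exact: btinv_take.
- move=> k; rewrite /= /upd /= /sel /= => /andP[k1 k2].
  rewrite eqn_add2l; case: eqP => [|_]; first by lia.
  by rewrite imu; apply: z'; rewrite (ltnW k1).
Qed.

Lemma pKeep_ok s : parS s -> (forall k, (k < K1)%N -> (sel s k < n)%N) ->
  let s' := den pKeep s in
  (forall ad, (ad < o)%N -> rmem s' ad = rmem s ad) /\
  (forall i : 'I_n, rmem s' (o + i) = if i \in selset s then rmem s (o + n + i) else 0).
Proof.
move=> ps sn; rewrite /pKeep den_seq.
pose Inv k s' := [/\ parS s', imem s' = imem s,
  forall ad, ~~ (o <= ad < o + n)%N -> rmem s' ad = rmem s ad &
  forall i : 'I_n, rmem s' (o + i) =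
    if [exists k' : 'I_K1, (k' < k)%N && (sel s k' == i)] then rmem s (o + n + i) else 0].
suff [_ _ a1 a2] : Inv K1 (den (SFor 8 eK1 (SRst (aZ (iL vk)) (XMem (aV (iL vk))))) (den pZero s)).
  split; first by move=> ad lt; apply: a1; lia.
  move=> i; rewrite a2 inE; congr (if _ then _ else _); apply: eq_existsb => k.
  by rewrite ltn_ord.
have rz := pZero_ok ps; have iz : imem (den pZero s) = imem s by exact: den_imem.
have pz : parS (den pZero s) by exact: par_den.
set s1 := den pZero s in rz iz pz *; clearbody s1.
apply: (@den_for _ 8 eK1 _ s1 K1 Inv).
- by have [_ h2 _ _ _] := pz; rewrite /= h2.
- split=> //.
  + by move=> ad h; rewrite rz wrm_out.
  + move=> i; rewrite rz wrm_in //; case: existsP => // -[k' /andP[]]; by rewrite ltn0.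
move=> k s' kK [p' i' l' z'].
have [g0 g2 g3 g4 g5] := @par_set _ _ _ _ _ _ s' 8 k isT p'.
have pu := @par_set _ _ _ _ _ _ s' 8 k isT p'.
set u := set_ireg s' 8 k in g0 g2 g3 g4 g5 pu *.
have [imu rmu r8] : [/\ imem u = imem s, rmem u = rmem s' & ireg u 8 = k] by [].
clearbody u.
have eL : evI u (iL vk) = sel s k by rewrite /= g4 r8 imu.
have skn := sn k kK.
rewrite den_SRst.
have -> : evI u (aZ (iL vk)) = (o + sel s k)%N by rewrite [LHS]/= g3 g4 r8 imu.
have -> : evX (XMem (aV (iL vk))) u = rmem s (o + n + sel s k).
  by rewrite [LHS]/= g3 g4 r8 imu rmu l' //; rewrite /sel; move: skn; rewrite /sel; lia.
split=> //.
- move=> ad h; rewrite /= /upd rmu; case: eqP => [e|_]; first by move: h; rewrite e; lia.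
  exact: l'.
- move=> i; rewrite /= /upd eqn_add2l rmu z'.
  case: (eqVneq (i : nat) (sel s k)) => [e|ne].
    rewrite ifT -?e //; apply/existsP; exists (Ordinal kK); rewrite /= ltnSn e /=.
    exact: eqxx.
  congr (if _ then _ else _); apply: eq_existsb => k'.
  case: (eqVneq (k' : nat) k) => [e|e]; first by rewrite e [sel s k == _]eq_sym (negbTE ne) !andbF.
  by congr (_ && _); lia.
Qed.
End Iteration.

Section Loop.
Variables (R : realType) (c l K m N : nat).
Let n := geo c l.
Hypotheses (c2 : (2 <= c)%N) (K0 : (0 < K)%N) (m0 : (0 < m)%N) (n0 : (0 < n)%N).
Let K1 := (K + K + K)%N.
Hypothesis K1m : (K1 <= m)%N.
Variable mem0 : nat -> R.
Implicit Type s : state R.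
Local Notation parS := (@par R c l K m N).
Local Notation o := (m * n + m)%N.

Definition memA : 'M[R]_(m, n) := \matrix_(i, j) mem0 (i * n + j).
Definition memy : 'cV[R]_m := \col_i mem0 (m * n + i).
Definition low s : Prop := forall ad, (ad < o)%N -> rmem s ad = mem0 ad.
Definition zvec s : 'cV[R]_n := \col_j rmem s (o + j).

Lemma body_ok s : parS s -> tab c l s -> low s ->
  let s' := den (pRes ;; pGrad ;; pTable ;; pBack ;; pKeep) s in
  [/\ parS s', tab c l s', low s', forall k, (k < K1)%N -> (sel c l s' k < n)%N &
      zvec s' = restr (selset c l K s') (grad memA memy (zvec s)) /\
      best_tree c K1 (grad memA memy (zvec s)) (selset c l K s')].
Proof.
move=> ps ts ls; rewrite 4!den_seq.
set v := grad memA memy (zvec s).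
have r1 := pRes_ok c2 K0 m0 n0 K1m ps.
have i1 : imem (den pRes s) = imem s by exact: den_imem.
have p1 : parS (den pRes s) by exact: par_den.
set s1 := den pRes s in r1 i1 p1 *; clearbody s1.
have r2 := pGrad_ok c2 K0 m0 n0 K1m p1.
have i2 : imem (den pGrad s1) = imem s by rewrite den_imem.
have p2 : parS (den pGrad s1) by exact: par_den.
set s2 := den pGrad s1 in r2 i2 p2 *; clearbody s2.
have t2 : tab c l s2 by rewrite /tab i2.
have l2 ad : (ad < o + n)%N -> rmem s2 ad = rmem s ad.
  move=> lt; rewrite r2 wrm_out; last by rewrite -/n; lia.
  by rewrite r1 wrm_out //; rewrite -/n; lia.
have v2 (j : 'I_n) : rmem s2 (o + n + j) = v j 0.
  rewrite r2 wrm_in //; have jn := ltn_ord j.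
  rewrite /v /grad !mxE r1 wrm_out; last by rewrite -/n; lia.
  congr (_ + _); rewrite [RHS]mulrC; congr (_ / _); apply: eq_bigr => i _.
  have lt := row_lt c2 K0 m0 n0 K1m (ltn_ord i) jn; rewrite -/n in lt.
  have im := ltn_ord i.
  rewrite wrm_out; last by rewrite -/n; lia.
  rewrite wrm_in // !mxE -!ls; [|lia|lia].
  congr (_ * (_ - _)); apply: eq_bigr => j' _; rewrite !mxE -ls //.
  by have := row_lt c2 K0 m0 n0 K1m im (ltn_ord j'); rewrite -/n; lia.
clearbody v.
have [lo3 Fn3 Fr3] := pTable_ok c2 K0 m0 n0 K1m p2 t2.
have i3 : imem (den pTable s2) = imem s2 by exact: den_imem.
have p3 : parS (den pTable s2) by exact: par_den.
set s3 := den pTable s2 in lo3 Fn3 Fr3 i3 p3 *; clearbody s3.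
have t3 : tab c l s3 by rewrite /tab i3.
have w3 i : (i < n)%N -> rmem s3 (o + n + i) = rmem s2 (o + n + i).
  by move=> iN; rewrite lo3 //; rewrite -/n; lia.
have w4 i : (i < n)%N -> wgt c l m s3 i = wgt c l m s2 i by move=> iN; rewrite /wgt w3.
have [lo4 sn4 cT Tk bT] := pBack_ok c2 K0 m0 n0 K1m p3 t3 w4 Fn3 Fr3.
have r4 : rmem (den pBack s3) = rmem s3 by exact: den_rmem.
have p4 : parS (den pBack s3) by exact: par_den.
set s4 := den pBack s3 in lo4 sn4 cT Tk bT r4 p4 *; clearbody s4.
have [lo5 z5] := pKeep_ok c2 K0 m0 n0 K1m p4 sn4.
have i5 : imem (den pKeep s4) = imem s4 by exact: den_imem.
have p5 : parS (den pKeep s4) by exact: par_den.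
set s5 := den pKeep s4 in lo5 z5 i5 p5 *; clearbody s5.
have selE : sel c l s5 = sel c l s4 by rewrite /sel i5.
have ssE : selset c l K s5 = selset c l K s4 by rewrite /selset selE.
have wE (S : {set 'I_n}) : \sum_(i in S) wgt c l m s3 i = dot (restr S v) (restr S v).
  rewrite big_mkcond /=; apply: eq_bigr => i _; rewrite !mxE; case: ifP => _; last by rewrite mul0r.
  by rewrite /wgt w3 // v2.
split=> //.
- by move=> t tn; rewrite i5 !lo4 ?i3; [exact: t2 | rewrite -/n; lia | rewrite -/n; lia].
- move=> ad lt; rewrite lo5 // r4 lo3; last by rewrite -/n; lia.
  by rewrite l2 ?ls //; lia.
- by move=> k kK; rewrite selE; exact: sn4.
rewrite ssE; split.
  apply/colP => i; rewrite !mxE z5 r4 w3 // v2.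
  by case: ifP.
by split=> // S cS Sk; rewrite -!wE; exact: bT.
Qed.

Lemma pIter_ok s : (0 < N)%N -> parS s -> tab c l s -> low s -> zvec s = 0 ->
  let s' := den pIter s in
  [/\ parS s', low s', forall k, (k < K1)%N -> (sel c l s' k < n)%N &
      exists z, iht c K1 memA memy N z (selset c l K s')].
Proof.
move=> N0 ps ts ls z0.
(* Before the first iteration the selection in memory means nothing, hence the guard [0 < i]. *)
pose Inv i s' := [/\ parS s', tab c l s', low s' &
  exists2 T, iht c K1 memA memy i (zvec s') T &
    (0 < i)%N -> T = selset c l K s' /\ forall k, (k < K1)%N -> (sel c l s' k < n)%N].
suff [p' t' l' [T it /(_ N0)[e sn]]] : Inv N (den pIter s).
  by split=> //; exists (zvec (den pIter s)); rewrite -e.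
apply: (@den_for _ 11 vN _ s N Inv).
- by have [_ _ _ _ h5] := ps; rewrite /= h5.
- by split=> //; exists set0 => //; rewrite z0; exact: iht0.
move=> i s' iN [p' t' l' [T it _]].
have pu : parS (set_ireg s' 11 i) by exact: par_set.
have [p2 t2 l2 sn2 [zE bT]] := @body_ok (set_ireg s' 11 i) pu t' l'.
split=> //; exists (selset c l K (den (pRes ;; pGrad ;; pTable ;; pBack ;; pKeep) (set_ireg s' 11 i))) => //.
by rewrite zE; apply: ihtS it bT.
Qed.
End Loop.

(** * Orthogonalisation and least squares *)

Section LeastSquares.
Variables (R : realType) (c l K m N : nat).
Let n := geo c l.
Hypotheses (c2 : (2 <= c)%N) (K0 : (0 < K)%N) (m0 : (0 < m)%N) (n0 : (0 < n)%N).
Let K1 := (K + K + K)%N.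
Hypothesis K1m : (K1 <= m)%N.
Variable mem0 : nat -> R.
Implicit Type s : state R.
Local Notation parS := (@par R c l K m N).
Local Notation o := (m * n + m)%N.
Local Notation cb := (m * n + m + n + n + m)%N.
Local Notation W := (m + n)%N.
Local Notation low := (@low R c l m mem0).
Local Notation A := (@memA R c l m mem0).
Local Notation y := (@memy R c l m mem0).
Local Notation sel := (@sel R c l).

Definition xv s k : 'cV[R]_(m + n) := \col_a rmem s (cb + 1 + (k * (m + n) + a)).
Definition xQ s k : 'cV[R]_m := usubmx (xv s k).
Definition xP s k : 'cV[R]_n := dsubmx (xv s k).

Lemma slot_sep k k' a a' : (k < k')%N -> (a < W)%N -> (k * W + a < k' * W + a')%N.
Proof.
move=> kk aW; have : (k.+1 * W <= k' * W)%N by rewrite leq_mul2r kk orbT.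
rewrite mulSn; move: (k * _)%N (k' * _)%N => u v; lia.
Qed.

Definition offslot k ad := ~~ ((cb + 1 + k * W <= ad) && (ad < cb + 1 + k * W + W))%N.

Lemma xv_frame s s' k k' : k != k' ->
  (forall ad, offslot k ad -> ad <> cb -> rmem s' ad = rmem s ad) -> xv s' k' = xv s k'.
Proof.
move=> kk H; apply/colP => a; rewrite !mxE; apply: H; last by lia.
have aW := ltn_ord a; rewrite /offslot; move: kk; rewrite neq_ltn => /orP[lt|lt].
  by have := @slot_sep k k' (W - 1) a lt; lia.
by have := @slot_sep k' k a 0 lt aW; lia.
Qed.

Lemma low_frame s s' k : low s ->
  (forall ad, offslot k ad -> ad <> cb -> rmem s' ad = rmem s ad) -> low s'.
Proof.
move=> ls H ad lt; rewrite H ?ls // /offslot; rewrite -/n in lt; lia.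
Qed.

Lemma pLoad_ok s k : parS s -> low s -> ireg s 8 = k -> (k <= K1)%N ->
  ((k < K1)%N -> (sel s k < n)%N) ->
  let s' := den pLoad s in
  [/\ ireg s' 8 = k, forall ad, offslot k ad -> rmem s' ad = rmem s ad,
      forall j : 'I_n, (k < K1)%N -> sel s k = j ->
        xQ s' k = A *m delta_mx j 0 /\ xP s' k = delta_mx j 0 &
      k = K1 -> xQ s' k = y /\ xP s' k = 0].
Proof.
move=> ps ls r8 kK sn; rewrite /pLoad den_seq.
have [h0 h2 h3 h4 h5] := ps; rewrite -/n in h4.
pose f1 a := if (k < K1)%N then rmem s (a * n + sel s k) else rmem s (m * n + a).
have [||g gE ->] := @den_vec R 10 vm (aX vk va)
   (XIte (XNat vk) (XNat eK1) (XMem (aA va (iL vk))) (XMem (aY va))) s m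
   (cb + 1 + k * W)%N f1.
- by rewrite /= h3.
- move=> a g am gE gr s1; split.
    by rewrite [LHS]/= gr !gE // h3 h4 r8 addnA.
  have rl ad : (ad < o)%N -> rmem s1 ad = rmem s ad by move=> lt; rewrite /= wrm_out //; lia.
  rewrite [evX (XIte _ _ _ _) _]/=.
  have -> : (((g 8)%:R : R) < (g 2 + g 2 + g 2)%:R) = (k < K1)%N.
    by rewrite ltr_nat !gE // h2 r8.
  rewrite /f1; case: ifP => kk.
    rewrite gr !gE // h4 r8 -/(sel s k); have lt := row_lt c2 K0 m0 n0 K1m am (sn kk).
    by rewrite -[wrm _ _ _ _]/(rmem s1) rl //; rewrite -/n in lt; lia.
  by rewrite gr !gE // h3 h4 -[wrm _ _ _ _]/(rmem s1) rl //; lia.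
set s1 := State _ _ _ _.
pose f2 a : R := if ((a - sel s k) + (sel s k - a) + (k + 1 - K1) < 1)%N then 1 else 0.
have q2 : ireg s1 2 = K by rewrite /= gE.
have q3 : ireg s1 3 = m by rewrite /= gE.
have q4 : ireg s1 4 = n by rewrite /= gE.
have q8 : ireg s1 8 = k by rewrite /= gE.
have im1 : imem s1 = imem s by [].
have rm1 : rmem s1 = wrm (rmem s) (cb + 1 + k * W) m f1 by [].
clearbody s1.
have [||g' gE' ->] := @den_vec R 10 vn (aX vk (vm + va)%H)
   (XIte (XNat ((va - iL vk) + (iL vk - va) + (vk + e1 - eK1))%H) x1 x1 x0) s1 n
   (cb + 1 + k * W + m)%N f2.
- by rewrite /= q4.
- move=> a g' an gE' gr; split.
    by rewrite [LHS]/= gr !gE' // q3 q4 q8 !addnA.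
  by rewrite [LHS]/= gr !gE' // q2 q4 q8 im1 -/(sel s k) ltr_nat /f2.
set s2 := State _ _ _ _.
have rm2 : rmem s2 = wrm (rmem s1) (cb + 1 + k * W + m) n f2 by [].
have i8 : ireg s2 8 = k by rewrite /= gE'.
clearbody s2.
have xQE i : xQ s2 k i 0 = f1 i.
  rewrite !mxE rm2 wrm_out; last by rewrite /=; have := ltn_ord i; lia.
  by rewrite rm1 /= addnA wrm_in.
have xPE j : xP s2 k j 0 = f2 j.
  by rewrite !mxE rm2 /= !addnA wrm_in.
split=> //.
- move=> ad; rewrite /offslot => h; rewrite rm2 wrm_out; last by lia.
  by rewrite rm1 wrm_out //; lia.
- move=> j kk sj; split.
    apply/colP => i; rewrite xQE /f1 kk sj mxE (bigD1 j) //= big1 ?addr0.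
      rewrite !mxE !eqxx mulr1 ls //.
      by have := row_lt c2 K0 m0 n0 K1m (ltn_ord i) (ltn_ord j); rewrite -/n; lia.
    by move=> j' /negbTE jj; rewrite !mxE jj mulr0.
  apply/colP => i; rewrite xPE /f2 sj !mxE eqxx andbT.
  case: (eqVneq i j) => [->|ne]; first by rewrite ifT //; lia.
  by rewrite ifF //; have : (i : nat) <> j by [move=> e; move/eqP: ne; apply; apply: ord_inj]; lia.
- move=> kE; split.
    apply/colP => i; rewrite xQE /f1 kE ltnn mxE ls //.
    by rewrite -/n; have := ltn_ord i; lia.
  by apply/colP => i; rewrite xPE /f2 mxE ifF //; lia.
Qed.

Lemma dotQE s k k' : dot (xQ s k) (xQ s k') =
  \sum_(a < m) rmem s (cb + 1 + (k * W + a)) * rmem s (cb + 1 + (k' * W + a)).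
Proof. by apply: eq_bigr => a _; rewrite !mxE. Qed.

Definition spn s k (u : 'cV[R]_(m + n)) : Prop :=
  exists al : nat -> R, u = \sum_(j < k) al j *: xv s j.

Lemma spn_add s k u (a : R) i : (i < k)%N -> spn s k u -> spn s k (u + a *: xv s i).
Proof.
move=> ik [al ->]; exists (fun j => if j == i then al j + a else al j).
rewrite [RHS](bigD1 (Ordinal ik)) //= eqxx [in LHS](bigD1 (Ordinal ik)) //= scalerDl.
rewrite addrAC; congr (_ + _); apply: eq_bigr => j ji; rewrite ifF //.
by apply/negP => /eqP e; move/eqP: ji; apply; exact: ord_inj.
Qed.

Lemma pOrth_ok s k : parS s -> ireg s 8 = k -> (k <= K1)%N ->
  (forall i i', (i < k)%N -> (i' < i)%N -> dot (xQ s i) (xQ s i') = 0) ->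
  let s' := den pOrth s in
  [/\ forall ad, offslot k ad -> ad <> cb -> rmem s' ad = rmem s ad,
      exists2 u, spn s k u & xv s' k = xv s k - u &
      forall i, (i < k)%N -> dot (xQ s' k) (xQ s i) = 0].
Proof.
move=> ps r8 kK orth.
have [h0 h2 h3 h4 h5] := ps; rewrite -/n in h4.
pose Inv i s' := [/\ parS s', ireg s' 8 = k,
  forall ad, offslot k ad -> ad <> cb -> rmem s' ad = rmem s ad,
  exists2 u, spn s k u & xv s' k = xv s k - u &
  forall j, (j < i)%N -> (j < k)%N -> dot (xQ s' k) (xQ s j) = 0].
suff [_ _ a1 a2 a3] : Inv K1 (den pOrth s).
  by split=> // i ik; apply: a3 => //; apply: leq_trans kK.
apply: (@den_for _ 6 eK1 _ s K1 Inv).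
- by rewrite /= h2.
- split=> //; exists 0; last by rewrite subr0.
  by exists (fun=> 0); rewrite big1 // => j _; rewrite scale0r.
move=> i s' iK [p' r8' fr' [u su xu] or'].
have [g0 g2 g3 g4 g5] := @par_set _ _ _ _ _ _ s' 6 i isT p'.
have pu := @par_set _ _ _ _ _ _ s' 6 i isT p'.
set t := set_ireg s' 6 i in g0 g2 g3 g4 g5 pu *; rewrite -/n in g4.
have [rmt t8 t6] : [/\ rmem t = rmem s', ireg t 8 = k & ireg t 6 = i] by [].
have xt j : xv t j = xv s' j by rewrite /xv rmt.
clearbody t.
have xs j : j != k -> xv s' j = xv s j.
  by move=> jk; apply: (@xv_frame s s' k); rewrite 1?eq_sym.
rewrite den_SIf.
have -> : (evX (XNat vi) t < evX (XNat vk) t) = (i < k)%N by rewrite /= ltr_nat t6 t8.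
case: ifP => ik; last first.
  rewrite den_SSkip; split=> //.
  - by move=> ad h1 h2'; rewrite rmt fr'.
  - by exists u => //; rewrite xt.
  - move=> j; rewrite ltnS leq_eqVlt => /orP[/eqP->|ji]; first by rewrite ik.
    by move=> jk; rewrite /xQ xt; exact: or'.
have ink : i != k by rewrite neq_ltn ik.
rewrite den_seq den_SRst.
have -> : evI t aC = cb by rewrite /= g3 g4.
set al := evX _ t.
have alE : al = dot (xQ s' k) (xQ s i) / dot (xQ s i) (xQ s i).
  have -> : xQ s i = xQ s' i by rewrite /xQ xs.
  rewrite !dotQE /al /xdot [LHS]/= g3; congr (_ / _); apply: eq_bigr => a _;
  by rewrite /upd /= g3 g4 ?t8 t6 rmt.
set t2 := set_rmem t cb al.
have p2 : parS t2 by [].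
have [t28 t26] : ireg t2 8 = k /\ ireg t2 6 = i by [].
have rm2 ad : rmem t2 ad = if ad == cb then al else rmem s' ad by rewrite /t2 /= rmt.
clearbody t2; have [k0 k2 k3 k4 k5] := p2; rewrite -/n in k4.
pose f a := rmem s' (cb + 1 + (k * W + a)) - al * rmem s' (cb + 1 + (i * W + a)).
have [||g gE ->] := @den_vec R 10 (vm + vn)%H (aX vk va)
   (XMem (aX vk va) - XMem aC * XMem (aX vi va))%X t2 W (cb + 1 + k * W)%N f.
- by rewrite /= k3 k4.
- move=> a g aW gE gr; split.
    by rewrite [LHS]/= gr !gE // k3 k4 t28 addnA.
  rewrite [LHS]/= gr !gE // k3 k4 t28 t26 /f.
  rewrite addnA wrm_out; last by lia.
  rewrite wrm_out; last by lia.
  have h := @slot_sep i k a 0 ik aW.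
  rewrite wrm_out; last by lia.
  rewrite !rm2 eqxx !ifF ?addnA //; lia.
set t3 := State _ _ _ _.
have rm3 : rmem t3 = wrm (rmem t2) (cb + 1 + k * W) W f by [].
have p3 : parS t3 by split; rewrite /= gE.
have t38 : ireg t3 8 = k by rewrite /= gE.
clearbody t3.
have fr3 ad : offslot k ad -> ad <> cb -> rmem t3 ad = rmem s ad.
  move=> h1 h2'; rewrite rm3 wrm_out // rm2; case: eqP => // _; exact: fr'.
have xv3 : xv t3 k = xv s' k - al *: xv s i.
  by rewrite -(xs i ink); apply/colP => a; rewrite !mxE rm3 addnA wrm_in // /f !addnA.
split=> //.
  exists (u + al *: xv s i); first exact: spn_add.
  by rewrite xv3 xu opprD addrA.
have Q3 : xQ t3 k = xQ s' k - al *: xQ s i.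
  by rewrite /xQ xv3 linearB linearZ.
move=> j; rewrite ltnS leq_eqVlt => /orP[/eqP-> _|ji jk].
  rewrite Q3 dotDl dotNl dotZl alE.
  (* If the squared norm is 0, slot [i] holds the zero vector and orthogonality to it is
     automatic. *)
  have [z|nz] := eqVneq (dot (xQ s i) (xQ s i)) 0; last by rewrite mulfVK // subrr.
  by rewrite (dot_eq0 z) !dot0r mulr0 subrr.
rewrite Q3 dotDl dotNl dotZl or' // orth // mulr0 subr0 //.
Qed.

Lemma spn_QP s k u : spn s k u -> (forall i, (i < k)%N -> xQ s i = A *m xP s i) ->
  usubmx u = A *m dsubmx u.
Proof.
move=> [al ->] H; rewrite !linear_sum; apply: eq_bigr => j _.
by rewrite !linearZ; congr (_ *: _); exact: H.
Qed.

Lemma spn_supp s k u (T : {set 'I_n}) : spn s k u ->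
  (forall i, (i < k)%N -> vsupp T (xP s i)) -> vsupp T (dsubmx u).
Proof.
move=> [al ->] H i iT; rewrite linear_sum summxE big1 // => j _.
by rewrite linearZ mxE H // mulr0.
Qed.

Lemma spn_dot s k u (v : 'cV[R]_m) : spn s k u ->
  (forall i, (i < k)%N -> dot v (xQ s i) = 0) -> dot v (usubmx u) = 0.
Proof.
move=> [al ->] H; rewrite linear_sum.
elim/big_rec: _ => [|j w _ IH]; first exact: dot0r.
by rewrite dotDr linearZ dotZr H // mulr0 IH addr0.
Qed.

Lemma pLS_ok s : parS s -> low s -> (forall k, (k < K1)%N -> (sel s k < n)%N) ->
  let s' := den pLS s in
  [/\ parS s', low s' & exists2 w, least_squares A y (selset c l K s) w &
     xQ s' K1 = y - A *m w /\ xP s' K1 = - w].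
Proof.
move=> ps ls sn; pose T := selset c l K s.
have selT k (j : 'I_n) : (k < K1)%N -> sel s k = j -> j \in T.
  by move=> kK e; rewrite inE; apply/existsP; exists (Ordinal kK); rewrite /= e.
(* The clause on [u] expresses, by duality, that the column of the [k']-th node lies in the span of
   the vectors of the slots up to [k']. Applied to the residual, which is orthogonal to all of them,
   it gives the normal equations. *)
pose Inv k s' := [/\ parS s', low s', imem s' = imem s &
  forall k', (k' < k)%N -> [/\ forall i, (i < k')%N -> dot (xQ s' k') (xQ s' i) = 0,
    vsupp T (xP s' k'),
    (k' < K1)%N -> xQ s' k' = A *m xP s' k' /\ forall u (j : 'I_n), sel s k' = j ->
       (forall i, (i <= k')%N -> dot u (xQ s' i) = 0) -> dot u (A *m delta_mx j 0) = 0 &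
    k' = K1 -> xQ s' k' = y + A *m xP s' k']].
suff [p' l' i' H] : Inv (K1 + 1)%N (den pLS s).
  set s' := den pLS s in p' l' i' H *; split=> //.
  have KK : (K1 < K1 + 1)%N by lia.
  have [o1 s1 _ /(_ erefl) q1] := H K1 KK.
  exists (- xP s' K1); last by rewrite opprK mulmxN opprK q1.
  split; first exact: vsuppN.
  move=> j jT; rewrite mulmxN opprK -q1.
  move: jT; rewrite inE => /existsP[k /eqP sk].
  have kK := ltn_ord k.
  have [|_ _ /(_ kK)[_ h] _] := H k _; first by lia.
  have := h (xQ s' K1) j sk; rewrite dotC dot_adj dotC => <-.
    rewrite /dot (bigD1 j) //= big1 ?addr0; first by rewrite !mxE !eqxx mulr1.
    by move=> j' /negbTE jj; rewrite !mxE jj mulr0.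
  by move=> i ik; apply: o1; lia.
have [h0 h2 h3 h4 h5] := ps.
apply: (@den_for _ 8 (eK1 + e1)%H _ s (K1 + 1)%N Inv).
- by rewrite /= h2.
- by split.
move=> k s' kK [p' l' i' H].
have pu := @par_set _ _ _ _ _ _ s' 8 k isT p'.
set t := set_ireg s' 8 k in pu *.
have [imt rmt t8] : [/\ imem t = imem s, rmem t = rmem s' & ireg t 8 = k] by [].
have lt : low t by [].
have xt j : xv t j = xv s' j by [].
clearbody t.
have kK1 : (k <= K1)%N by lia.
have snt : (k < K1)%N -> (sel t k < n)%N by move=> kk; rewrite (sel_imem c l imt); exact: sn.
rewrite den_seq.
have [a8 afr aL aY'] := pLoad_ok pu lt t8 kK1 snt.
have ai : imem (den pLoad t) = imem s by rewrite den_imem.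
have ap : parS (den pLoad t) by exact: par_den.
set v := den pLoad t in a8 afr aL aY' ai ap *; clearbody v.
have fr1 ad : offslot k ad -> ad <> cb -> rmem v ad = rmem t ad by move=> h _; exact: afr.
have xv1 j : (j < k)%N -> xv v j = xv s' j.
  by move=> jk; rewrite (@xv_frame t v k j) ?xt // neq_ltn jk orbT.
have orth i i2 : (i < k)%N -> (i2 < i)%N -> dot (xQ v i) (xQ v i2) = 0.
  move=> ik ii; have [o1 _ _ _] := H i ik.
  by rewrite /xQ !xv1 //; [exact: o1 | exact: ltn_trans ik].
have [bfr [u su xu] bor] := pOrth_ok ap a8 kK1 orth.
have bi : imem (den pOrth v) = imem s by rewrite den_imem.
have bp : parS (den pOrth v) by exact: par_den.
set w := den pOrth v in bfr xu bor bi bp *; clearbody w.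
have xw j : (j < k)%N -> xv w j = xv v j.
  by move=> jk; rewrite (@xv_frame v w k j) // neq_ltn jk orbT.
have xws j : (j < k)%N -> xv w j = xv s' j by move=> jk; rewrite xw // xv1.
have hQP i : (i < k)%N -> xQ v i = A *m xP v i.
  move=> ik; have [_ _ q3 _] := H i ik; have [|q _] := q3; first by lia.
  by rewrite /xQ /xP xv1.
have hsu i : (i < k)%N -> vsupp T (xP v i).
  by move=> ik; have [_ q _ _] := H i ik; rewrite /xP xv1.
have uQP := spn_QP su hQP; have usu := spn_supp su hsu.
have Qw : xQ w k = xQ v k - usubmx u by rewrite /xQ xu linearB.
have Pw : xP w k = xP v k - dsubmx u by rewrite /xP xu linearB.
have selk : sel t k = sel s k by rewrite (sel_imem c l imt).
split=> //.
  by apply: (low_frame (k := k)) bfr; apply: (low_frame (k := k)) fr1.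
move=> k'; rewrite ltnS leq_eqVlt => /orP[/eqP->|kk']; last first.
  have [o1 s1 q1 r1] := H k' kk'.
  split.
  - move=> i ik; rewrite /xQ !xws //; [exact: o1 | exact: ltn_trans kk'].
  - by rewrite /xP xws.
  - move=> kl; have [e1' e2'] := q1 kl; split; first by rewrite /xQ /xP xws.
    move=> u' j sj hu; apply: e2' sj _ => i ik; rewrite -(hu i ik) /xQ xws //.
    exact: leq_ltn_trans kk'.
  - by move=> ke; rewrite /xQ /xP xws //; exact: r1.
have [kl|ke] : (k < K1)%N \/ k = K1 by lia.
- pose j := Ordinal (sn k kl).
  have [qv pv] := aL j kl selk.
  split.
  + by move=> i ik; rewrite {2}/xQ xw //; exact: bor.
  + rewrite Pw pv; apply: vsuppB => // i iT; rewrite mxE.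
    case: (eqVneq i j) => // e; move: iT; rewrite e => /negP[]; exact: (selT k).
  + move=> _; split; first by rewrite Qw Pw qv pv uQP mulmxBr.
    move=> u' j' sj hu.
    have -> : j' = j by apply: ord_inj; rewrite -sj.
    rewrite -qv -[xQ v k](subrK (usubmx u)) -Qw dotDr hu // add0r.
    apply: (spn_dot su) => i ik; rewrite -(hu i (ltnW ik)) /xQ xw //.
  + by move=> e; exfalso; lia.
have [qv pv] := aY' ke.
split.
- by move=> i ik; rewrite {2}/xQ xw //; exact: bor.
- by rewrite Pw pv sub0r; exact: vsuppN.
- by rewrite ke ltnn.
- by move=> _; rewrite Qw Pw qv pv uQP sub0r mulmxN.
Qed.

Lemma pOut_ok s : parS s -> low s -> let s' := den pOut s in
  [/\ parS s', low s', zvec c l m s' = - xP s K1 & xv s' K1 = xv s K1].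
Proof.
move=> ps ls; have [h0 h2 h3 h4 h5] := ps; rewrite -/n in h4.
have [||g gE ->] := @den_vec R 7 vn (aZ vj) (x0 - XMem (aX eK1 (vm + vj)%H))%X s n o
  (fun j => 0 - rmem s (cb + 1 + (K1 * W + (m + j)))).
- by rewrite /= h4.
- move=> j g jn gE gr; split; first by rewrite [LHS]/= gr !gE // h3 h4.
  by rewrite [LHS]/= gr !gE // h2 h3 h4 wrm_out //; lia.
split.
- by split; rewrite /= gE.
- by move=> ad lt; rewrite /= wrm_out ?ls //; rewrite -/n in lt; lia.
- by apply/colP => j; rewrite !mxE [rmem _]/= wrm_in // sub0r.
- by apply/colP => a; rewrite !mxE [rmem _]/= wrm_out //; lia.
Qed.

Lemma pTest_ok s : parS s -> low s -> let s' := den pTest s in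
  let r := xQ s K1 in
  [/\ parS s', low s', zvec c l m s' = zvec c l m s & ireg s' 12 =
    if (0 < dot r r) && ~~ (16 * dot y y < 16 ^+ N * dot r r) then 0%N else K].
Proof.
move=> ps ls; have [h0 h2 h3 h4 h5] := ps; rewrite -/n in h4 => s' r.
have cbE (t : state R) : parS t -> evI t aC = cb by move=> [_ _ q3 q4 _]; rewrite /= q3 q4.
rewrite /s' /pTest den_seq den_SRst cbE // [evX x1 s]/=.
set s1 := set_rmem s cb _.
pose Inv i (t : state R) := [/\ parS t, rmem t cb = 16 ^+ i &
   forall ad, ad <> cb -> rmem t ad = rmem s ad].
have : Inv N (den (SFor 11 vN (SRst aC (XMem aC * XNat (ECst 16))%X)) s1).
  apply: (@den_for _ 11 vN _ s1 N Inv).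
  - by rewrite /= h5.
  - split=> //; first by rewrite /= /upd eqxx expr0.
    by move=> ad ne; rewrite /= /upd; case: eqP.
  move=> i t iN [pt ct ft].
  have pu := @par_set _ _ _ _ _ _ t 11 i isT pt.
  rewrite den_SRst cbE //; set u := set_ireg t 11 i in pu *.
  have ru : rmem u = rmem t by [].
  clearbody u; have [w0 w2 w3 w4 w5] := pu; rewrite -/n in w4.
  have -> : evX (XMem aC * XNat (ECst 16))%X u = 16 ^+ i.+1.
    by rewrite [LHS]/= w3 w4 ru ct exprSr.
  split=> //; first by rewrite /= /upd eqxx.
  by move=> ad ne; rewrite /= /upd ru; case: eqP => // _; exact: ft.
rewrite den_seq; set s2 := den (SFor 11 _ _) s1; clearbody s2 => -[p2 c2' f2].
have [q0 q2 q3 q4 q5] := p2; rewrite -/n in q4.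
have Kmn : (K <= m * n)%N by apply: leq_trans (leq_pmulr _ n0); move: K1m; rewrite /K1; lia.
rewrite den_seq den_SSet; last by rewrite /= q2 q3 q4.
rewrite [evI s2 vK]/= q2; set s3 := set_ireg s2 12 K.
have p3 : parS s3 by exact: par_set.
have [i3 rm3] : ireg s3 12 = K /\ rmem s3 = rmem s2 by [].
clearbody s3; have [t0 t2 t3 t4 t5] := p3; rewrite -/n in t4.
have l3 : low s3 by move=> ad lt; rewrite rm3 f2 ?ls //; rewrite -/n in lt; lia.
have z3 : zvec c l m s3 = zvec c l m s.
  by apply/colP => j; rewrite !mxE rm3 f2 //; have := ltn_ord j; rewrite -/n; lia.
have rrE : evX (xdot eK1 eK1) s3 = dot r r.
  rewrite /r dotQE [LHS]/= t3; apply: eq_bigr => a _.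
  by rewrite /upd /= t2 t3 t4 rm3 f2 //; lia.
have yyE : evX (XNat (ECst 16) * XSum 10 vm (XMem (aY va) * XMem (aY va)))%X s3 = 16 * dot y y.
  rewrite [LHS]/= t3; congr (_ * _); apply: eq_bigr => a _.
  rewrite /upd /= t3 t4 !mxE l3 //.
  by rewrite -/n; have := ltn_ord a; lia.
have crE : evX (XMem aC * xdot eK1 eK1)%X s3 = 16 ^+ N * dot r r.
  by rewrite -rrE -c2' -rm3 -(cbE s3 p3).
rewrite den_SIf rrE [evX x0 s3]/=.
case: ifP => _ /=; last by split.
rewrite den_SIf yyE crE; case: ifP => _; first by split.
rewrite den_SSet //; split=> //; exact: par_set.
Qed.
End LeastSquares.

(** * Cost of a round *)

(** The cost is split into [wX], [wS], constants of the program, and the volumes [vX], [vS]: the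
    largest product of nested loop bounds. Bounds are increased by 1 there, so that an empty loop
    still has positive volume. *)
Fixpoint wX (x : rexp) : nat :=
  match x with
  | XNat e | XMem e => cI e + isz e
  | XBin _ x y => (wX x + wX y).+1
  | XSum r e x => wX x + 600
  | XIte a b x y => (wX a + wX b + wX x + wX y).+1
  end%N.

Fixpoint wS (p : stmt) : nat :=
  match p with
  | SSkip => 0
  | SSet r e => cI (eclamp e) + isz (eclamp e) + 3
  | SIst a e => cI a + cI (eclamp e) + isz a + isz (eclamp e)
  | SRst a x => cI a + wX x + isz a
  | SSeq p q => wS p + wS q
  | SIf x y p q => (wX x + wX y + wS p + wS q).+1
  | SFor r e p => wS p + 600
  end%N.

Section Volume.
Variables (R : realType) (s : state R).

Fixpoint vX (x : rexp) : nat :=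
  match x with
  | XNat e | XMem e => 1
  | XBin _ x y => maxn (vX x) (vX y)
  | XSum r e x => (evI s e).+1 * vX x
  | XIte a b x y => maxn (maxn (vX a) (vX b)) (maxn (vX x) (vX y))
  end%N.

Fixpoint vS (p : stmt) : nat :=
  match p with
  | SSkip | SSet _ _ | SIst _ _ => 1
  | SRst a x => vX x
  | SSeq p q => maxn (vS p) (vS q)
  | SIf x y p q => maxn (maxn (vX x) (vX y)) (maxn (vS p) (vS q))
  | SFor r e p => (evI s e).+1 * vS p
  end%N.

Lemma vX_gt0 x : (0 < vX x)%N.
Proof. by elim: x => //= *; rewrite ?leq_max ?muln_gt0; lia. Qed.

Lemma vS_gt0 p : (0 < vS p)%N.
Proof. elim: p => //= *; rewrite ?leq_max ?muln_gt0 ?vX_gt0; lia. Qed.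

Lemma loop_vol k1 k2 k3 N C w v : (k1 <= k3)%N -> (k2 <= k3)%N -> (C <= w * v)%N ->
  (0 < v)%N -> (k1 + N * (C + k2) <= (w + k3) * (N.+1 * v))%N.
Proof.
move=> h1 h2 hC v0.
have a1 : (N * C <= N * (w * v))%N by rewrite leq_mul2l hC orbT.
have a2 : (N * k2 <= N * k3)%N by rewrite leq_mul2l h2 orbT.
have a3 : (N * k3 <= N * k3 * v)%N by rewrite leq_pmulr.
have a4 : (k3 <= k3 * v)%N by rewrite leq_pmulr.
lia.
Qed.

Lemma cX_vol x : (cX s x <= wX x * vX x)%N.
Proof.
elim: x => [e|e|o x IHx y IHy|r e x IH|a IHa b IHb x IHx y IHy] /=; rewrite ?muln1 //.
- have := vX_gt0 x; have := vX_gt0 y; nia.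
- exact: loop_vol (vX_gt0 x).
- have a0 := vX_gt0 a; have b0 := vX_gt0 b; have x0' := vX_gt0 x; have y0 := vX_gt0 y.
  set M := maxn _ _.
  have la : (vX a <= M)%N by rewrite /M; lia.
  have lb : (vX b <= M)%N by rewrite /M; lia.
  have lx : (vX x <= M)%N by rewrite /M; lia.
  have ly : (vX y <= M)%N by rewrite /M; lia.
  clearbody M.
  have := leq_trans IHa (leq_mul (leqnn (wX a)) la).
  have := leq_trans IHb (leq_mul (leqnn (wX b)) lb).
  have := leq_trans IHx (leq_mul (leqnn (wX x)) lx).
  have := leq_trans IHy (leq_mul (leqnn (wX y)) ly).
  rewrite mulSn !mulnDl; lia.
Qed.

Lemma cS_vol p : (cS s p <= wS p * vS p)%N.
Proof.
elim: p => [|r e|a e|a x|p IHp q IHq|x y p IHp q IHq|r e p IH] /=; rewrite ?muln1 //.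
- have v0 := vX_gt0 x; have h1 := cX_vol x.
  have h2 : (cI a <= cI a * vX x)%N by rewrite leq_pmulr.
  have h3 : (isz a <= isz a * vX x)%N by rewrite leq_pmulr.
  by rewrite 2!mulnDl; apply: leq_add => //; apply: leq_add.
- have p0 := vS_gt0 p; have q0 := vS_gt0 q; set M := maxn _ _.
  have lp : (vS p <= M)%N by rewrite /M; lia.
  have lq : (vS q <= M)%N by rewrite /M; lia.
  clearbody M.
  have := leq_trans IHp (leq_mul (leqnn (wS p)) lp).
  have := leq_trans IHq (leq_mul (leqnn (wS q)) lq).
  rewrite mulnDl; lia.
- have a0 := vX_gt0 x; have b0 := vX_gt0 y; have p0 := vS_gt0 p; have q0 := vS_gt0 q.
  set M := maxn _ _.
  have la : (vX x <= M)%N by rewrite /M; lia.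
  have lb : (vX y <= M)%N by rewrite /M; lia.
  have lp : (vS p <= M)%N by rewrite /M; lia.
  have lq : (vS q <= M)%N by rewrite /M; lia.
  clearbody M.
  have := leq_trans (cX_vol x) (leq_mul (leqnn (wX x)) la).
  have := leq_trans (cX_vol y) (leq_mul (leqnn (wX y)) lb).
  have := leq_trans IHp (leq_mul (leqnn (wS p)) lp).
  have := leq_trans IHq (leq_mul (leqnn (wS q)) lq).
  rewrite mulSn !mulnDl; lia.
- exact: loop_vol (vS_gt0 p).
Qed.
End Volume.

Section RoundCost.
Variables (R : realType) (c l K m N : nat).
Let n := geo c l.
Hypotheses (K0 : (0 < K)%N) (m0 : (0 < m)%N) (n0 : (0 < n)%N) (N0 : (0 < N)%N).
Hypothesis K1m : (K + K + K <= m)%N.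

(** The first term is [N] iterations of matrix-vector products and of the dynamic program, whose
    table fits in since [K <= m]; the second is the orthogonalisation of [3 * K + 1] slots of length
    [m + n] against each other. *)
Lemma vS_round (s : state R) : par c l K m N s ->
  (vS s pRound <= 8 * (N * (m * n)) + 180 * (K * K * (m + n)))%N.
Proof.
move=> [h0 h2 h3 h4 h5]; rewrite -/n in h4.
have mn : (0 < m * n)%N by rewrite muln_gt0 m0.
have nm1 : (n <= m * n)%N by rewrite leq_pmull.
have nm2 : (m <= m * n)%N by rewrite leq_pmulr.
have nm3 : (K * n <= m * n)%N by rewrite leq_mul2r; lia.
have KK : (K <= K * K)%N by rewrite leq_pmulr.
have NN : (m * n <= N * (m * n))%N by rewrite leq_pmull.
have NN' : (N <= N * (m * n))%N by rewrite leq_pmulr.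
have KW : (m + n <= K * K * (m + n))%N by rewrite leq_pmull // muln_gt0 K0.
have it : (vS s (pRes ;; pGrad ;; pTable ;; pBack ;; pKeep) <= 4 * (m * n))%N.
  rewrite /= h2 h3 h4 ?muln1 !geq_max; repeat (apply/andP; split); nia.
have ls : (vS s (pLoad ;; pOrth) <= 20 * (K * (m + n)))%N.
  rewrite /= h2 h3 h4 ?muln1 !geq_max; repeat (apply/andP; split); nia.
have -> : vS s pRound = maxn (vS s pTab) (maxn (vS s pZero) (maxn (N.+1 * vS s (pRes ;; pGrad ;; pTable ;; pBack ;; pKeep))
   (maxn ((K + K + K + 1).+1 * vS s (pLoad ;; pOrth)) (maxn (vS s pOut) (vS s pTest))))).
  by rewrite -[in N.+1]h5 -[in X in (X + X + X + 1)%N]h2.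
set X := (8 * _ + _)%N.
have b1 : (vS s pTab <= X)%N by rewrite /= h4 ?muln1 /X !geq_max; repeat (apply/andP; split); nia.
have b2 : (vS s pZero <= X)%N by rewrite /= h4 /X; nia.
have b3 : (N.+1 * vS s (pRes ;; pGrad ;; pTable ;; pBack ;; pKeep) <= X)%N.
  apply: (@leq_trans (N.+1 * (4 * (m * n)))); first by rewrite leq_mul2l it orbT.
  rewrite mulSn /X; nia.
have b4 : ((K + K + K + 1).+1 * vS s (pLoad ;; pOrth) <= X)%N.
  apply: (@leq_trans ((K + K + K + 1).+1 * (20 * (K * (m + n))))).
    by rewrite leq_mul2l ls orbT.
  rewrite /X; nia.
have b5 : (vS s pOut <= X)%N by rewrite /= h4 /X; nia.
have b6 : (vS s pTest <= X)%N.
  rewrite /= h3 h5 ?muln1 /X !geq_max; repeat (apply/andP; split); nia.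
move: b1 b2 b3 b4 b5 b6.
move: (vS s pTab) (vS s pZero) (N.+1 * vS s (pRes ;; pGrad ;; pTable ;; pBack ;; pKeep))%N
  ((K + K + K + 1).+1 * vS s (pLoad ;; pOrth))%N (vS s pOut) (vS s pTest).
by move=> x1 x2 x3 x4 x5 x6 h1' h2' h3' h4' h5' h6'; rewrite !geq_max h1' h2' h3' h4' h5' h6'.
Qed.
End RoundCost.

Section Round.
Variables (R : realType) (c l K m : nat).
Let n := geo c l.
Hypotheses (c2 : (2 <= c)%N) (K0 : (0 < K)%N) (m0 : (0 < m)%N) (n0 : (0 < n)%N).
Let K1 := (K + K + K)%N.
Hypothesis K1m : (K1 <= m)%N.
Variable mem0 : nat -> R.
Implicit Type s : state R.
Local Notation A := (@memA R c l m mem0).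
Local Notation y := (@memy R c l m mem0).

Definition rpost N s : Prop := exists z T w,
  [/\ iht c K1 A y N z T, least_squares A y T w, zvec c l m s = w &
      let r := y - A *m w in ireg s 12 =
      if (0 < dot r r) && ~~ (16 * dot y y < 16 ^+ N * dot r r) then 0%N else K].

Lemma pRound_ok N s : (0 < N)%N -> par c l K m N s -> low c l m mem0 s ->
  let s' := den pRound s in low c l m mem0 s' /\ rpost N s'.
Proof.
move=> N0 ps ls; rewrite /pRound den_seq.
have t1 := pTab_ok c2 K0 m0 n0 K1m ps.
have p1 : par c l K m N (den pTab s) by exact: par_den.
have r1 : rmem (den pTab s) = rmem s by exact: den_rmem.
set s1 := den pTab s in t1 p1 r1 *; clearbody s1; rewrite den_seq.
have r2 := pZero_ok p1.
have p2 : par c l K m N (den pZero s1) by exact: par_den.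
have i2 : imem (den pZero s1) = imem s1 by exact: den_imem.
set s2 := den pZero s1 in r2 p2 i2 *; clearbody s2; rewrite den_seq.
have t2 : tab c l s2 by rewrite /tab i2.
have l2 : low c l m mem0 s2.
  by move=> ad lt; rewrite r2 wrm_out ?r1 ?ls //; lia.
have z2 : zvec c l m s2 = 0.
  by apply/colP => j; rewrite !mxE r2 wrm_in.
have [p3 l3 sn3 [z it]] := pIter_ok c2 K0 m0 n0 K1m N0 p2 t2 l2 z2.
set s3 := den pIter s2 in p3 l3 sn3 it *; clearbody s3; rewrite den_seq.
have [p4 l4 [w lw [Q4 P4]]] := pLS_ok c2 K0 m0 n0 K1m p3 l3 sn3.
set s4 := den pLS s3 in p4 l4 Q4 P4 *; clearbody s4; rewrite den_seq.
have [p5 l5 z5 x5] := pOut_ok c2 K0 m0 n0 K1m p4 l4.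
set s5 := den pOut s4 in p5 l5 z5 x5 *; clearbody s5.
have [p6 l6 z6 f6] := pTest_ok c2 K0 m0 n0 K1m p5 l5.
set s6 := den pTest s5 in p6 l6 z6 f6 *; clearbody s6.
split=> //; exists z, (selset c l K s3), w; split=> //.
  by rewrite z6 z5 P4 opprK.
by rewrite /= f6 /xQ x5 -/(xQ c l m s4 (K + K + K)) Q4.
Qed.

Lemma par_bounded b (s : state R) e : (0 < b)%N ->
  (forall r, (r < npar)%N -> (ireg s r < 2 ^ b)%N) -> bndI e -> (evI s e < 2 ^ (8 * b))%N.
Proof.
move=> b0 h /andP[pe se].
pose s' := State (fun r => if (r < npar)%N then ireg s r else 0%N) (fun=> 0%N) (rreg s) (rmem s).
have -> : evI s e = evI s' e by apply: evI_par => // r rn /=; rewrite rn.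
have p2 : (0 < 2 ^ b)%N by rewrite expn_gt0.
apply: (@leq_trans (2 ^ (isz e * b))).
  by apply: evI_bound (parI_wfI pe) => //= r _; case: ifP => // /h.
by rewrite leq_exp2l // leq_mul2r se orbT.
Qed.

Variable B : nat.
Hypotheses (cB : (c < 2 ^ B)%N) (lB : (l < 2 ^ B)%N) (KB : (K < 2 ^ B)%N)
  (mB : (m < 2 ^ B)%N) (nB : (n < 2 ^ B)%N).

(** A bit bound for round [j], where the parameters are below [2 ^ B] and the number of iterations
    is [2 ^ j]; the factor 8 is the maximal size of a loop bound. *)
Definition bj j := (8 * (B + j + 2))%N.

Definition minv j s : Prop := [/\ par c l K m (2 ^ j) s, ireg s 1 = l,
  low c l m mem0 s, forall r, (r < nvar)%N -> (ireg s r < 2 ^ bj j)%N &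
  forall a, (imem s a < 2 ^ bj j)%N].

Lemma bj_mono j j' : (j <= j')%N -> (2 ^ bj j <= 2 ^ bj j')%N.
Proof. by move=> le; rewrite leq_exp2l // /bj; lia. Qed.

Lemma round_runs j s X : minv j s ->
  (forall s1, par c l K m (2 ^ j.+1) s1 -> (cS s1 pRound <= X)%N) ->
  runs (Seq (Do (IAdd 5 5 5)) (compS pRound nvar)) s ((2 + X) * bj j.+1)
    (fun s' => minv j.+1 s' /\ rpost (2 ^ j.+1) s').
Proof.
move=> [ps h1 ls br bi] cX; have [g0 g2 g3 g4 g5] := ps.
have b5 : (bitlen (ireg s 5) <= bj j.+1)%N.
  apply: bitlen_le; first by rewrite /bj; lia.
  by apply: leq_trans (bj_mono (leqnSn j)); exact: br.
apply: (@runs_seq _ _ _ _ (2 * bj j.+1) (X * bj j.+1)); last by rewrite mulnDl.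
apply: runs_do; first by rewrite /= mul2n -addnn leq_add.
set s1 := run_instr _ _.
have p1 : par c l K m (2 ^ j.+1) s1.
  by split=> //=; rewrite /upd /= g5 expnS mul2n -addnn.
have r1 r : r != 5 -> ireg s1 r = ireg s r by move=> /negbTE r5; rewrite /= /upd r5.
have l1 : low c l m mem0 s1 by [].
have N1 : (2 ^ j.+1 < 2 ^ (B + j.+1 + 2))%N by rewrite ltn_exp2l //; lia.
have BB x : (x < 2 ^ B)%N -> (x < 2 ^ (B + j.+1 + 2))%N.
  by move=> xB; apply: leq_trans xB _; rewrite leq_exp2l //; lia.
have bb : (2 ^ (B + j.+1 + 2) <= 2 ^ bj j.+1)%N by rewrite leq_exp2l // /bj; lia.
have [q0 q2 q3 q4 q5] := p1.
have q1 : ireg s1 1 = l by rewrite r1.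
have bs1 : bounded (bj j.+1) s1.
  split.
  - move=> r rn; have [->|r5] := eqVneq r 5; first by rewrite q5; exact: leq_trans bb.
    by rewrite r1 //; apply: leq_trans (br r rn) (bj_mono (leqnSn j)).
  - by move=> a; apply: leq_trans (bi a) (bj_mono (leqnSn j)).
  - move=> e be; apply: par_bounded => //; first by lia.
    move=> r; rewrite /npar; do 6 (case: r => [_|r]; first by rewrite ?q0 ?q1 ?q2 ?q3 ?q4 ?q5 //; exact: BB).
    by lia.
have bj0 : (0 < bj j.+1)%N by rewrite /bj; lia.
have le : (cS s1 pRound * bj j.+1 <= X * bj j.+1)%N by rewrite leq_mul2r cX ?orbT.
apply: runs_mono (compS_runs bj0 bs1 pRound_wf (leqnn _) (agree_refl _ _)) le _.
move=> s' [[a1 a2 a3] _].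
have N0 : (0 < 2 ^ j.+1)%N by rewrite expn_gt0.
have [l2 [z [T [w [it lw zw fl]]]]] := pRound_ok N0 p1 l1.
have p2 : par c l K m (2 ^ j.+1) (den pRound s1) by exact: par_den.
have [c1 c3 _] := den_bounded pRound_wf bs1.
split.
  split.
  - by have [e0' e2 e3 e4 e5] := p2; split; rewrite a1.
  - by rewrite a1 // den_par.
  - by move=> ad lt; rewrite a3 l2.
  - by move=> r rn; rewrite a1 // c1.
  - by move=> a; rewrite a2.
exists z, T, w; split=> //; last by rewrite a1.
by rewrite -zw; apply/colP => i; rewrite !mxE a3.
Qed.

(** [J] is a round whose test passes whatever subtree and fit come out, so the loop stops there at
    the latest. The costs [a + b * 2 ^ i] of rounds [j.+1] to [J] form a geometric sum. *)
Lemma loop_runs J a b d j s : (0 < J)%N ->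
  (forall z T w, iht c K1 A y (2 ^ J) z T -> least_squares A y T w ->
     let r := y - A *m w in
     (0 < dot r r) && ~~ (16 * dot y y < 16 ^+ (2 ^ J) * dot r r) = false) ->
  (forall i s1, par c l K m (2 ^ i) s1 -> (cS s1 pRound <= a + b * 2 ^ i)%N) ->
  (j + d = J)%N -> minv j s -> ((0 < j)%N -> rpost (2 ^ j) s) ->
  (j = 0%N -> ireg s 12 = 0%N) ->
  runs (While (ILt 12 2) (Seq (Do (IAdd 5 5 5)) (compS pRound nvar))) s
    ((d * (a + 4) + b * (2 ^ J.+1 - 2 ^ j.+1) + 2) * bj J)
    (fun s' => exists i, [/\ minv i s', rpost (2 ^ i) s' & ireg s' 12 = K]).
Proof.
move=> J0 stop cost; elim: d j s => [|d IH] j s jd mv rp fz.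
  have jJ : j = J by lia.
  have rpJ : rpost (2 ^ j) s by apply: rp; lia.
  have fK : ireg s 12 = K.
    have [z [T [w [it lw _ ->]]]] := rpJ; rewrite jJ in it *.
    by rewrite (stop _ _ _ it lw).
  have [[_ g2 _ _ _] _ _ br _] := mv.
  exists s, (test_cost (ILt 12 2) s); split.
  - by apply: exec_while_false; rewrite /= fK g2 ltnn.
  - rewrite mul0n jJ subnn muln0 !add0n mul2n -addnn /= leq_add //;
      by apply: bitlen_le; [rewrite /bj; lia | rewrite -jJ; exact: br].
  - by exists j.
have [[_ g2 _ _ _] _ _ br _] := mv.
have bjJ : (bj j <= bj J)%N by rewrite /bj; lia.
have tc : (test_cost (ILt 12 2) s <= 2 * bj J)%N.
  rewrite mul2n -addnn /= leq_add //; apply: leq_trans bjJ; apply: bitlen_le;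
  by [rewrite /bj; lia | exact: br].
have [fl|fl] : ireg s 12 = 0%N \/ ireg s 12 = K /\ (0 < j)%N.
  case: (posnP j) => [/fz|j0]; first by left.
  have [z [T [w [_ _ _ ->]]]] := rp j0; case: ifP => _; [by left | by right].
- have costj s1 : par c l K m (2 ^ j.+1) s1 -> (cS s1 pRound <= a + b * 2 ^ j.+1)%N by exact: cost.
  have [s1 [t1 [ex1 lt1 [mv1 rp1]]]] := round_runs mv costj.
  have jd' : (j.+1 + d = J)%N by lia.
  have nz : j.+1 = 0%N -> ireg s1 12 = 0%N by [].
  have [s2 [t2 [ex2 lt2 post]]] := IH j.+1 s1 jd' mv1 (fun _ => rp1) nz.
  exists s2, (test_cost (ILt 12 2) s + t1 + t2)%N; split=> //.
    by apply: exec_while_true ex1 ex2; rewrite /= fl g2.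
  have bj1 : (bj j.+1 <= bj J)%N by rewrite /bj; lia.
  have lt1' : (t1 <= (2 + (a + b * 2 ^ j.+1)) * bj J)%N.
    by apply: leq_trans lt1 _; rewrite leq_mul2l bj1 orbT.
  have e : (2 ^ J.+1 - 2 ^ j.+1 = 2 ^ j.+1 + (2 ^ J.+1 - 2 ^ j.+2))%N.
    have : (2 ^ j.+2 <= 2 ^ J.+1)%N by rewrite leq_exp2l //; lia.
    rewrite [(2 ^ j.+2)%N]expnS; lia.
  rewrite e mulnDr mulSn.
  move: tc lt1' lt2; move: (test_cost _ _) (2 ^ j.+1)%N (2 ^ J.+1 - _)%N (bj J) => x p q r.
  rewrite !mulnDl; lia.
- exists s, (test_cost (ILt 12 2) s); split.
  + by apply: exec_while_false; rewrite /= (proj1 fl) g2 ltnn.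
  + by apply: leq_trans tc _; rewrite leq_mul2r leq_addl orbT.
  + by exists j; split=> //; [exact: rp (proj2 fl) | exact: (proj1 fl)].
Qed.
End Round.

(** * Best tree approximation *)

(* A connected set that contains the root but not the parent of its node i could
   not leave the subtree of i. *)
Lemma tree_support_closed c n K (S : {set 'I_n}) : tree_support c K S -> tree_closed c S.
Proof.
move=> [_ [r rS r0] conn]; apply/tree_closedP => p i pi iS.
apply: contraT => pS.
have /andP[i0 /eqP pE] := pi.
have inv j : j \in S -> connect (fun u v => [&& u \in S, v \in S & tree_edge c u v]) i j ->
    anc c i j.
  move=> jS /connectP[q]; elim/last_ind: q j jS => [|q z IH] j jS.
    by move=> _ ->; constructor.
  rewrite rcons_path last_rcons => /andP[pth /and3P[uS zS e]] ->.
  have a := IH _ uS pth erefl; set u := last i q in uS e a.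
  case/orP: e => /andP[h1 /eqP h2].
    by apply: anc_step => //; rewrite /tpar h2.
  case: a h1 h2 => [h1 h2|u' u0 a' h1 h2].
    by move: pS; rewrite (_ : p = z) ?zS //; apply: ord_inj; rewrite -pE -h2.
  by rewrite -h2.
have := inv r rS (conn i r iS rS) => /anc_le; rewrite r0; lia.
Qed.

(** On a fixed support the best approximation is the restriction of [x]; the minimum thus runs over
    finitely many supports and is attained. *)
Lemma min_tree_dist (R : realType) c n K (x : 'cV[R]_n) : (0 < K)%N -> (0 < n)%N ->
  exists2 S : {set 'I_n}, tree_closed c S /\ (#|S| <= K)%N &
    is_min_tree_dist c K x (\sum_(i | i \notin S) `|x i 0|).
Proof.
move=> K0 n0.
pose f (S : {set 'I_n}) : R := \sum_(i | i \notin S) `|x i 0|.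
pose S1 : {set 'I_n} := [set Ordinal n0].
have h1 : `[< tree_support c K S1 >].
  apply/asboolP; split; first by rewrite cards1.
    by exists (Ordinal n0); rewrite ?inE.
  by move=> i j; rewrite !inE => /eqP-> /eqP->; exact: connect0.
have [S /asboolP hS minS] := @arg_minP _ R _ S1 (fun S => `[< tree_support c K S >]) f h1.
have Sk : (#|S| <= K)%N by case: hS.
exists S; first by split=> //; exact: tree_support_closed hS.
split.
  exists (restr S x).
    by exists S => // i; rewrite mxE; case: ifP => //; rewrite eqxx.
  rewrite /l1norm big_mkcond /=; apply: eq_bigr => i _; rewrite !mxE.
  by case: (i \in S); rewrite /= ?subrr ?normr0 ?subr0.
move=> x' [S' hS' hx'].
apply: le_trans (minS S' (introT (asboolP _) hS')) _.
rewrite /f big_mkcond /=; apply: ler_sum => i _; rewrite !mxE.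
case: (boolP (i \in S')) => //= iS'.
have -> : x' i 0 = 0 by apply/eqP; apply: contraNT iS' => /hx'.
by rewrite subr0.
Qed.

Section Input.
Variables (R : realType) (c l K m n : nat) (A : 'M[R]_(m, n)) (y : 'cV[R]_m).

Lemma nth_rows (x0 : R) (s : seq (seq R)) i j : all (fun r => size r == n) s ->
  (i < size s)%N -> (j < n)%N -> nth x0 (flatten s) (i * n + j) = nth x0 (nth [::] s i) j.
Proof.
elim: s i => // r s IH [|i] /= /andP[/eqP rn hs] si jn; rewrite nth_cat rn.
  by rewrite mul0n add0n jn.
rewrite mulSn -addnA ltnNge leq_addr /= addKn; exact: IH.
Qed.

Lemma input_A (i : 'I_m) (j : 'I_n) : rmem (input c l K A y) (i * n + j) = A i j.
Proof.
rewrite /= nth_cat.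
have sz : size [seq A i j | i <- enum 'I_m, j <- enum 'I_n] = (m * n)%N.
  by rewrite size_allpairs !size_enum_ord.
have lt : (i * n + j < m * n)%N.
  apply: (@leq_trans (i.+1 * n)); first by rewrite mulSn addnC ltn_add2r.
  by rewrite leq_mul2r ltn_ord orbT.
rewrite sz lt nth_rows //.
- rewrite (nth_map i) ?size_enum_ord // (nth_map j) ?size_enum_ord //.
  by rewrite !nth_ord_enum.
- by apply/allP => r /mapP[i' _ ->]; rewrite size_map size_enum_ord.
- by rewrite size_map size_enum_ord.
Qed.

Lemma input_y (i : 'I_m) : rmem (input c l K A y) (m * n + i) = y i 0.
Proof.
rewrite /= nth_cat size_allpairs !size_enum_ord ltnNge leq_addr /= addKn.
by rewrite (nth_map i) ?size_enum_ord // nth_ord_enum.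
Qed.
End Input.

Section Recover.
Variables (R : realType) (c l K m : nat).
Let n := geo c l.
Hypotheses (c2 : (2 <= c)%N) (K0 : (0 < K)%N) (m0 : (0 < m)%N) (n0 : (0 < n)%N).
Let K1 := (K + K + K)%N.
Hypothesis K1m : (K1 <= m)%N.
Variables (A : 'M[R]_(m, n)) (y : 'cV[R]_m) (B : nat).
Hypotheses (cB : (c < 2 ^ B)%N) (lB : (l < 2 ^ B)%N) (KB : (K < 2 ^ B)%N)
  (mB : (m < 2 ^ B)%N) (nB : (n < 2 ^ B)%N).

Let s0 := input c l K A y.

Lemma memAE : memA c l m (rmem s0) = A.
Proof. by apply/matrixP => i j; rewrite mxE input_A. Qed.

Lemma memyE : memy c l m (rmem s0) = y.
Proof. by apply/colP => i; rewrite mxE input_y. Qed.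

Definition stopped (N : nat) (w : 'cV[R]_n) : Prop :=
  let r := y - A *m w in dot r r = 0 \/ 16 * dot y y < 16 ^+ N * dot r r.

Lemma recover_runs J a b : (0 < J)%N ->
  (forall z T w, iht c K1 A y (2 ^ J) z T -> least_squares A y T w -> stopped (2 ^ J) w) ->
  (forall i (s1 : state R), par c l K m (2 ^ i) s1 -> (cS s1 pRound <= a + b * 2 ^ i)%N) ->
  runs recover s0 ((J * (a + 4) + b * 2 ^ J.+1 + 2) * bj B J + 1)
    (fun s' => exists N z T w, [/\ iht c K1 A y N z T, least_squares A y T w,
       output m n s' = w & stopped N w]).
Proof.
move=> J0 stop cost.
have neg N w : stopped N w <->
  (0 < dot (y - A *m w) (y - A *m w)) &&
  ~~ (16 * dot y y < 16 ^+ N * dot (y - A *m w) (y - A *m w)) = false.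
  rewrite /stopped lt0r dot_ge0 andbT; split.
    by move=> [->|->]; rewrite ?eqxx ?andbF.
  move/negbT; rewrite negb_and !negbK => /orP[/eqP|]; [by left | by right].
apply: (@runs_seq _ _ _ _ 1 ((J * (a + 4) + b * 2 ^ J.+1 + 2) * bj B J)); last by rewrite addnC.
apply: runs_do => //; set s1 := run_instr _ _.
have p1 : par c l K m (2 ^ 0) s1 by [].
have mv : minv c l K m (rmem s0) B 0 s1.
  have pB x : (x < 2 ^ B)%N -> (x < 2 ^ bj B 0)%N.
    by move=> xB; apply: leq_trans xB _; rewrite leq_exp2l // /bj; lia.
  have b0 : (1 < 2 ^ bj B 0)%N by rewrite -[X in (X < _)%N](expn0 2) ltn_exp2l // /bj; lia.
  split=> //.
  - move=> r rn; rewrite /= /upd; case: eqP => // _.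
    do 5 (case: r rn => [_|r rn]; first exact: pB); rewrite /= nth_nil; lia.
  - by move=> q /=; lia.
have st z T w : iht c (K + K + K) (memA c l m (rmem s0)) (memy c l m (rmem s0)) (2 ^ J) z T ->
    least_squares (memA c l m (rmem s0)) (memy c l m (rmem s0)) T w ->
    let r := memy c l m (rmem s0) - memA c l m (rmem s0) *m w in
    (0 < dot r r) && ~~ (16 * dot (memy c l m (rmem s0)) (memy c l m (rmem s0)) < 16 ^+ (2 ^ J) * dot r r) = false.
  by rewrite memAE memyE => it lw; apply/neg; exact: stop it lw.
have jd : (0 + J = J)%N by [].
have := loop_runs c2 K0 m0 n0 K1m cB lB KB mB nB J0 st cost jd mv.
move=> /(_ (fun h => False_ind _ (Bool.diff_false_true h)) (fun=> erefl)) h.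
apply: runs_mono h _ _.
  by rewrite leq_mul2r; apply/orP; right; rewrite leq_add2r leq_add2l leq_mul2l leq_subr orbT.
move=> s' [i [mv' [z [T [w [it lw zw fl]]]] fK]].
rewrite memAE memyE in it lw fl.
exists (2 ^ i)%N, z, T, w; split=> //.
apply/neg; move: fl; rewrite fK /=; case: ifP => // _ e; move: K0; rewrite e; lia.
Qed.
End Recover.

(** * Number of rounds and total time *)

Lemma geo_ge c h : (2 <= c)%N -> (h <= geo c h)%N.
Proof. by move=> c2; elim: h => //= h IH; nia. Qed.

(** The left side bounds [16 * dot y y] divided by the least nonzero residual of integer data; the
    exponent on the right is linear in [K * L], which is the number of iterations required. *)
Lemma bit_exponent M0 K n L m a : (0 < K)%N -> (K < 2 ^ L)%N -> (n < 2 ^ L)%N ->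
  (m <= 2 ^ (M0 + L))%N ->
  (16 * (m * n ^ (2 * a + 2)) * (((K + K + K) * m) ^ (K + K + K)) ^ 2 <=
   2 ^ (4 + (M0 + L) + (2 * a + 2) * L + 6 * K * (2 + M0 + 2 * L)))%N.
Proof.
move=> K0 KL nL mL.
set e1 := (2 * a + 2)%N; set e2 := (M0 + L)%N in mL *.
rewrite [X in (_ <= 2 ^ X)%N](_ : _ = (4 + (e2 + e1 * L)) + (2 + L + e2) * (6 * K))%N;
  last by rewrite /e2; ring.
rewrite [X in (_ <= X)%N]expnD; apply: leq_mul.
  rewrite [X in (_ <= X)%N]expnD [X in (_ <= _ * X)%N]expnD; apply: leq_mul => //; apply: leq_mul => //.
  by rewrite [X in (2 ^ X)%N]mulnC expnM leq_exp2r ?(ltnW nL) // /e1; lia.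
rewrite -expnM (_ : ((K + K + K) * 2 = 6 * K)%N); last lia.
rewrite [X in (_ <= X)%N]expnM leq_exp2r; last lia.
rewrite [X in (_ <= X)%N]expnD; apply: leq_mul => //.
by rewrite expnD; lia.
Qed.

(** One factor [L] comes from the number of iterations or of rounds, the other from the bit length
    of indices: hence the square of the logarithm in the theorem. *)
Lemma time_bound M0 ws h c K n L J t : (0 < K)%N -> (0 < n)%N -> (0 < L)%N ->
  (J <= (h + 2) * L)%N -> (2 ^ J.+1 <= 4 * (h * K * L))%N ->
  (t <= (J * (ws * (180 * (K * K * ((M0 + 1) * n))) + 4) +
         ws * (8 * (M0 * K * n)) * 2 ^ J.+1 + 2) * bj (c + M0 + L) J + 1)%N ->
  (t <= (((h + 2) * (180 * ws * (M0 + 1) + 4) + 32 * ws * M0 * h + 2) *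
         (8 * (c + M0 + h + 5)) + 1) * (K * K * n * (L * L)))%N.
Proof.
move=> K0 n0 L0 hJ hJ2 ht; apply: leq_trans ht _.
set P := (K * K * n)%N.
have P0 : (0 < P)%N by rewrite !muln_gt0 K0 n0.
have e1 : (J * (ws * (180 * (K * K * ((M0 + 1) * n))) + 4) <=
           (h + 2) * (180 * ws * (M0 + 1) + 4) * (P * L))%N.
  rewrite (_ : (h + 2) * _ * _ = (h + 2) * L * ((180 * ws * (M0 + 1) + 4) * P))%N; last by ring.
  apply: leq_mul => //; rewrite (_ : ws * _ = 180 * ws * (M0 + 1) * P)%N; last by rewrite /P; ring.
  by rewrite mulnDl leq_add2l; lia.
have e2 : (ws * (8 * (M0 * K * n)) * 2 ^ J.+1 <= 32 * ws * M0 * h * (P * L))%N.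
  rewrite (_ : 32 * ws * M0 * h * _ = ws * (8 * (M0 * K * n)) * (4 * (h * K * L)))%N;
    last by rewrite /P; ring.
  by rewrite leq_mul2l hJ2 orbT.
have e3 : (2 <= 2 * (P * L))%N by rewrite -[X in (X <= _)%N]muln1 leq_mul2l /= muln_gt0 P0.
have e4 : (bj (c + M0 + L) J <= 8 * (c + M0 + h + 5) * L)%N.
  rewrite /bj -mulnA leq_mul2l /=.
  have : (c + M0 + 2 <= (c + M0 + 2) * L)%N by rewrite -{1}[X in (X <= _)%N]muln1 leq_mul2l L0 orbT.
  move: hJ; nia.
rewrite [X in (_ <= X)%N]mulnDl mul1n; apply: leq_add; last by rewrite muln_gt0 P0 muln_gt0 L0.
set X := (h + 2)%N in e1 *; set Y := (180 * ws * (M0 + 1) + 4)%N in e1 *.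
set Z := (32 * ws * M0 * h)%N in e2 *; set W := (8 * _)%N in e4 *.
rewrite (_ : (X * Y + Z + 2) * W * (P * (L * L)) = ((X * Y + Z + 2) * (P * L)) * (W * L))%N; last by ring.
apply: leq_mul => //; rewrite 2![in X in (_ <= X)%N]mulnDl; apply: leq_add => //; exact: leq_add.
Qed.

Lemma round_count H h K L : (0 < H)%N -> (0 < L)%N -> (H <= h * K * L)%N -> (K < 2 ^ L)%N ->
  exists J, [/\ (0 < J)%N, (H < 2 ^ J)%N, (2 ^ J.+1 <= 4 * (h * K * L))%N & (J <= (h + 2) * L)%N].
Proof.
move=> H0 L0 Hh KL; exists (trunc_log 2 H).+1.
have /andP[h1 h2] := @trunc_log_bounds 2 H isT H0.
split=> //; first by rewrite !expnS; lia.
have : (2 ^ trunc_log 2 H < 2 ^ (h + (L + L)))%N.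
  apply: leq_ltn_trans h1 _; apply: leq_ltn_trans Hh _.
  have hh : (h < 2 ^ h)%N by exact: ltn_expl.
  have hL : (L < 2 ^ L)%N by exact: ltn_expl.
  rewrite -mulnA !expnD; apply: ltn_mul => //; exact: ltn_mul.
rewrite ltn_exp2l // => h3; apply: (leq_trans h3).
by rewrite mulnDl mul2n -addnn leq_add2r leq_pmulr.
Qed.

Lemma bitlen_ln (R : realType) n : (1 < n)%N -> (bitlen n)%:R <= 4 * ln n%:R :> R.
Proof.
move=> n1.
have n0 : (0 < n)%N by lia.
have /andP[h1 _] := @trunc_log_bounds 2 n isT n0.
have := @ln_ge R n 1 (trunc_log 2 n) isT; rewrite mul1n divr1 => /(_ h1) h2.
have := @ln_ge R n 1 1 isT; rewrite mul1n divr1 => /(_ n1) h3.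
by rewrite /bitlen -addn1 natrD; lra.
Qed.

Lemma rip_le (R : realType) c n m k k' (A : 'M[R]_(m, n)) : (k <= k')%N -> rip c k' A -> rip c k A.
Proof. by move=> kk ripA S0 v cS Sk; apply: ripA => //; exact: leq_trans Sk kk. Qed.

Lemma measurement_bound (R : realType) m n a (A : 'M[R]_(m, n)) (x : 'cV[R]_n) :
  (forall i j, A i j ^+ 2 = 1 /\ A i j \is a Num.int) ->
  (forall i, x i 0 \is a Num.int /\ `|x i 0| <= n%:R ^+ a) ->
  (forall i, (A *m x) i 0 \is a Num.int) /\
  dot (A *m x) (A *m x) <= (m * n ^ (2 * a + 2))%:R.
Proof.
move=> hA hx; split=> [i|].
  rewrite mxE; apply: rpred_sum => j _; apply: rpredM; [exact: (hA i j).2 | exact: (hx j).1].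
have b i : `|(A *m x) i 0| <= n%:R ^+ a.+1.
  rewrite mxE; apply: le_trans (ler_norm_sum _ _ _) _.
  apply: (@le_trans _ _ (\sum_(j < n) n%:R ^+ a)); last first.
    by rewrite sumr_const card_ord exprS mulr_natl.
  apply: ler_sum => j _; rewrite normrM.
  have -> : `|A i j| = 1.
    by apply/eqP; rewrite -(@eqrXn2 _ 2) // -normrX (hA i j).1 normr1 expr1n.
  by rewrite mul1r; exact: (hx j).2.
rewrite natrM /dot.
apply: (@le_trans _ _ (\sum_(i < m) (n ^ (2 * a + 2))%:R)); last first.
  by rewrite sumr_const card_ord mulr_natl.
apply: ler_sum => i _; rewrite -expr2 -real_normK ?num_real // natrX.
rewrite (_ : 2 * a + 2 = a.+1 * 2)%N; last lia.
by rewrite exprM; apply: lerXn2r; rewrite ?nnegrE ?exprn_ge0 ?b.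
Qed.

Section Stop.
Variables (R : realType) (c l K m : nat).
Let n := geo c l.
Let K1 := (K + K + K)%N.
Variables (A : 'M[R]_(m, n)) (y : 'cV[R]_m).

(** For real data: the gap, and so [J], depends on [y], but this suffices for termination. *)
Lemma stopped_eventually : exists2 J, (0 < J)%N &
  forall T w, least_squares A y T w -> stopped A y (2 ^ J) w.
Proof.
have [ep ep0 gap] := residual_gap A y.
have yy0 : 0 <= dot y y by exact: dot_ge0.
pose J := (Num.bound (16 * dot y y / ep)).+1.
exists J => // T w /gap[|le]; first by left.
right; apply: (@lt_le_trans _ _ (16 ^+ (2 ^ J) * ep)); last first.
  by apply: ler_wpM2l => //; exact: exprn_ge0.
rewrite -ltr_pdivrMr //; apply: lt_trans (archi_boundP _) _.
  by rewrite divr_ge0 ?mulr_ge0 // ltW.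
rewrite -natrX ltr_nat.
have h1 : (J < 2 ^ J)%N by exact: ltn_expl.
have h2 : (2 ^ J < 16 ^ (2 ^ J))%N by exact: ltn_expl.
apply: (ltn_trans _ h2); apply: (ltn_trans _ h1); exact: ltnSn.
Qed.

(** Multiplying [16 * dot y y] by [G ^ 2 * r], which is at least 1, leaves an integer below
    [2 ^ (2 ^ J)] times [r]. *)
Lemma stopped_int a L M0 J : (0 < K)%N -> (0 < m)%N -> rip c K1 A ->
  (forall i j, A i j ^+ 2 = 1 /\ A i j \is a Num.int) ->
  (forall i, y i 0 \is a Num.int) -> dot y y <= (m * n ^ (2 * a + 2))%:R ->
  (K < 2 ^ L)%N -> (n < 2 ^ L)%N -> (m <= 2 ^ (M0 + L))%N ->
  (4 + (M0 + L) + (2 * a + 2) * L + 6 * K * (2 + M0 + 2 * L) < 2 ^ J)%N ->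
  forall z T w, iht c K1 A y (2 ^ J) z T -> least_squares A y T w -> stopped A y (2 ^ J) w.
Proof.
move=> K0 m0 ripA hA yi yy KL nL mL hJ z T w it lw.
have [_ cT Tk] := iht_supp it.
have K10 : (0 < K1)%N by rewrite /K1; lia.
have := residual_gap_int m0 K10 ripA hA yi cT Tk lw; rewrite /stopped /=.
set r := dot (y - _) _; case=> [|g]; first by left.
right.
have r0 : 0 < r.
  rewrite lt_neqAle eq_sym dot_ge0 andbT; apply: contraTneq g => ->.
  by rewrite mulr0 ler10.
set G := ((K1 * m) ^ K1)%N in g.
have yy0 : 0 <= dot y y by exact: dot_ge0.
apply: (@le_lt_trans _ _ (16 * dot y y * (G%:R ^+ 2 * r))).
  by rewrite -[X in X <= _]mulr1; apply: ler_wpM2l => //; exact: mulr_ge0.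
rewrite mulrA ltr_pM2r //.
apply: (@le_lt_trans _ _ ((16 * (m * n ^ (2 * a + 2)) * G ^ 2)%:R)).
  rewrite 2!natrM natrX; apply: ler_wpM2r; first exact: exprn_ge0.
  by apply: ler_wpM2l.
rewrite -natrX ltr_nat.
apply: leq_ltn_trans (bit_exponent a K0 KL nL mL) _.
apply: (@ltn_trans (2 ^ (2 ^ J))); first by rewrite ltn_exp2l.
by rewrite ltn_exp2r // expn_gt0.
Qed.
End Stop.
Theorem theorem5p1 (R : realType) :
  exists2 C : R, 1 < C &
  forall c : nat, (2 <= c)%N ->
  exists (P : cmd) (Cm c0 : nat) (D : nat -> R),
  forall l K n : nat,
    n = ((c ^ l - 1) %/ (c - 1))%N -> (0 < K)%N -> K%:R < n%:R / 2 :> R ->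
  exists (m : nat) (A : 'M[R]_(m, n)),
    (m <= Cm * K)%N /\
    forall x : 'cV[R]_n, exists (xs : 'cV[R]_n) (d : R) (t : nat),
      [/\ returns P c l K A (A *m x) xs t,
          is_min_tree_dist c K x d,
          l1norm (x - xs) <= C * Num.sqrt (ln (n%:R / K%:R)) * d &
          forall a : nat,
            (forall i, x i 0 \is a Num.int /\ `|x i 0| <= n%:R ^+ a) ->
            t%:R <= D a * (K%:R ^+ 2 * n%:R * ln n%:R ^+ c0)].

Proof.
exists 1000; first lra.
move=> c c2.
(* Near isometry is required on [9 * K] nodes: three subtrees of [3 * K] nodes, a size that
   accommodates the best subtree with [K] nodes and the closure of the large entries with
   [2 * K]. *)
have [M0 hM0] : {M0 : nat | forall K, (0 < K)%N ->
    (2 ^ 14 * (c * (3 * (3 * K)) + 66 * (3 * (3 * K)) + 3) <= M0 * K)%N}.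
  exists (2 ^ 14 * (9 * c + 597))%N => K K0.
  by rewrite -mulnA leq_mul2l; apply/orP; right; rewrite mulnDl; lia.
have [ws ws_ge] : {ws : nat | forall s : state R, (cS s pRound <= ws * vS s pRound)%N}.
  by exists (wS pRound) => s; exact: cS_vol.
pose h a := (4 + (M0 + 1) + (2 * a + 2) + 6 * (4 + M0))%N.
pose Q a := (((h a + 2) * (180 * ws * (M0 + 1) + 4) + 32 * ws * M0 * h a + 2) *
             (8 * (c + M0 + h a + 5)) + 1)%N.
exists recover, M0, 2, (fun a => 16 * (Q a)%:R) => l K n nE K0 Kn2.
have {}Kn2 : (K + K < n)%N by rewrite -(ltr_nat R) natrD; lra.
have n0 : (0 < n)%N by lia.
have n1 : (1 < n)%N by lia.
rewrite -(geoE c2) in nE; subst n.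
have ln_geo := geo_ge l c2.
have k0 : (0 < 3 * (3 * K))%N by lia.
have [A [ripA hA]] := rip_exists R (geo c l) (ltnW c2) k0.
have mM := hM0 K K0.
have mlb : (K + K + K <= 2 ^ 14 * (c * (3 * (3 * K)) + 66 * (3 * (3 * K)) + 3))%N.
  by apply: (@leq_trans (c * (3 * (3 * K)) + 66 * (3 * (3 * K)) + 3)); [lia | exact: leq_pmull].
move: (2 ^ 14 * _)%N A ripA hA mM mlb => m A ripA hA mM K1m.
have m0 : (0 < m)%N by lia.
have A1 i j : A i j ^+ 2 = 1 by case: (hA i j).
exists m, A; split=> // x.
have K3 : (K + K + K = 3 * K)%N by lia.
pose L := bitlen (geo c l).
have nL : (geo c l < 2 ^ L)%N.
  by have /andP[] := @trunc_log_bounds 2 (geo c l) isT n0.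
have KL : (K < 2 ^ L)%N by lia.
have mL : (m < 2 ^ (M0 + L))%N.
  apply: leq_ltn_trans mM _; rewrite expnD; apply: ltn_mul => //; exact: ltn_expl.
have up (i j : nat) (ij : (i <= j)%N) z : (z < 2 ^ i)%N -> (z < 2 ^ j)%N.
  by move=> zi; apply: leq_trans zi _; rewrite leq_exp2l.
have cB : (c < 2 ^ (c + M0 + L))%N by apply: (up c); [lia | exact: ltn_expl].
have lB : (l < 2 ^ (c + M0 + L))%N by apply: (up L); lia.
have KB : (K < 2 ^ (c + M0 + L))%N by apply: (up L); lia.
have mB : (m < 2 ^ (c + M0 + L))%N by apply: (up (M0 + L)%N); lia.
have nB : (geo c l < 2 ^ (c + M0 + L))%N by apply: (up L); lia.
have cost i (s1 : state R) : par c l K m (2 ^ i) s1 -> (cS s1 pRound <=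
    ws * (180 * (K * K * ((M0 + 1) * geo c l))) + ws * (8 * (M0 * K * geo c l)) * 2 ^ i)%N.
  move=> ps; apply: leq_trans (ws_ge s1) _.
  have N0 : (0 < 2 ^ i)%N by rewrite expn_gt0.
  rewrite -[(ws * (8 * _) * _)%N]mulnA -mulnDr leq_mul2l; apply/orP; right.
  apply: leq_trans (vS_round K0 m0 n0 N0 K1m ps) _.
  rewrite addnC; apply: leq_add.
    rewrite !leq_mul2l; apply/orP; right; apply/orP; right.
    by rewrite mulnDl mul1n leq_add2r (leq_trans mM) // leq_mul2l; apply/orP; right; lia.
  rewrite -[(8 * _ * _)%N]mulnA leq_mul2l /= [X in (X <= _)%N]mulnC leq_mul2r; apply/orP; right.
  by rewrite leq_mul2r mM orbT.
have [S [cS Sk] minS] := min_tree_dist c x K0 n0.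
(* This run, for arbitrary real [x], supplies the output and the time; its time bound is
   discarded. *)
have [J J0 stopJ] := stopped_eventually A (A *m x).
have [s [t [ex _ [N [z [T [w [it lw outw st]]]]]]]] :=
  recover_runs c2 K0 m0 n0 K1m cB lB KB mB nB J0 (fun z T w _ => stopJ T w) cost.
exists w, (\sum_(i | i \notin S) `|x i 0|), t; split=> //.
- by exists s.
- have [_ cT Tk] := iht_supp it; rewrite K3 in it Tk.
  apply: (l1_guarantee c2 K0 Kn2 m0 ripA A1 cT Tk lw.1 _ cS Sk).
  by move=> u U cU Uk su; exact: (iht_stop m0 ripA it lw cU Uk su st).
move=> a hx.
have [yi yy] := measurement_bound hA hx.
have ripK : rip c (K + K + K) A by apply: rip_le ripA; lia.
have L0 : (0 < L)%N by [].
pose H := (4 + (M0 + L) + (2 * a + 2) * L + 6 * K * (2 + M0 + 2 * L))%N.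
have H0 : (0 < H)%N by rewrite /H; lia.
have Hh : (H <= h a * K * L)%N.
  have e1 : (4 + (M0 + L) <= (4 + (M0 + 1)) * (K * L))%N by nia.
  have e2 : ((2 * a + 2) * L <= (2 * a + 2) * (K * L))%N.
    by rewrite leq_mul2l leq_pmull ?orbT.
  have e3 : (6 * K * (2 + M0 + 2 * L) <= 6 * (4 + M0) * (K * L))%N.
    rewrite (_ : 6 * (4 + M0) * (K * L) = 6 * K * ((4 + M0) * L))%N; last by ring.
    by rewrite leq_mul2l; apply/orP; right; nia.
  rewrite /H /h -[(_ * K * L)%N]mulnA 2![in X in (_ <= X)%N]mulnDl; apply: leq_add => //; exact: leq_add.
have [J' [J0' HJ J4 JL]] := round_count H0 L0 Hh KL.
have stop' := stopped_int K0 m0 ripK hA yi yy KL nL (ltnW mL) HJ.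
(* The same execution analysed again for integer [x], now with an explicit number of rounds; by
   [exec_det] it has the time [t] chosen above. *)
have [s' [t' [ex' tle _]]] := recover_runs c2 K0 m0 n0 K1m cB lB KB mB nB J0' stop' cost.
have [_ tt] := exec_det ex ex'; subst t'.
have := time_bound K0 n0 L0 JL J4 tle; rewrite -/(Q a) => tQ.
apply: (@le_trans _ _ ((Q a * (K * K * geo c l * (L * L)))%N%:R)); first by rewrite ler_nat.
have ll := bitlen_ln R n1; rewrite -/L in ll.
rewrite !natrM; set lg := ln _ in ll *; set nR := (geo c l)%:R.
(* 16 is the square of the constant 4 in [bitlen_ln]. *)
rewrite (_ : 16 * _ * _ = (Q a)%:R * (K%:R * K%:R * nR * ((4 * lg) * (4 * lg)))); last by ring.
by do 2 (apply: ler_wpM2l; rewrite ?mulr_ge0 //); exact: ler_pM.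
Qed.
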